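(* Let $2<q<\infty$ and let $w:\mathbb{Z}\to(0,\infty)$ be a weight. (i) Let $1<p<\infty$. The operator $\mathcal{V}_q\mathcal{A}^+$ is bounded on $\ell^p(\mathbb{Z},w)$, i.e. there is a constant $C$ such that $$\sum_{n\in\mathbb{Z}}\big(\mathcal{V}_q\mathcal{A}^+(f)(n)\big)^p w(n)\le C\sum_{n\in\mathbb{Z}}|f(n)|^p w(n)\quad\text{for all } f\in\ell^p(\mathbb{Z},w),$$ if and only if $w\in A_p^+$. (ii) The operator $\mathcal{V}_q\mathcal{A}^+$ maps $\ell^1(\mathbb{Z},w)$ into $\ell^{1,\infty}(\mathbb{Z},w)$ boundedly, i.e. there is a constant $C$ such that $$w\big(\{n\in\mathbb{Z}:\mathcal{V}_q\mathcal{A}^+(f)(n)>\lambda\}\big)\le \frac{C}{\lambda}\sum_{n\in\mathbb{Z}}|f(n)|w(n)\quad\text{for all } f\in\ell^1(\mathbb{Z},w),\ \lambda>0,$$ if and only if $w\in A_1^+$.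
   Context: For a complex-valued function $f$ on $\mathbb{Z}$ and an integer $N\ge0$, $A_N^+(f)(n)=\frac{1}{N+1}\sum_{i=0}^N f(n+i)$, and $\mathcal{A}^+(f)(n)=\{A_N^+(f)(n)\}_{N\ge0}$. For a sequence $a=\{a_N\}_{N\ge0}$ of complex numbers, $\|a\|_{v_q}=\sup\big(\sum_{j=0}^\infty|a_{N_j}-a_{N_{j+1}}|^q\big)^{1/q}$, the supremum running over all increasing sequences $\{N_j\}$ of nonnegative integers. $\mathcal{V}_q\mathcal{A}^+(f)(n)=\|\mathcal{A}^+(f)(n)\|_{v_q}$. Weights on $\mathbb{Z}$ are positive functions; $w(E)=\sum_{n\in E}w(n)$; $\ell^p(\mathbb{Z},w)$ is the space of $f$ with $\sum_n|f(n)|^pw(n)<\infty$. $w\in A_1^+$ if there is a constant $C$ with $\sum_{i=n-k}^{n}w(i)\le C(k+1)\min\{w(i):i\in[n,n+k]\}$ for all $n\in\mathbb{Z}$, $k\ge0$. $w\in A_p^+$ ($1<p<\infty$) if there is a constant $C$ with $\sum_{i=0}^k w(n+i)\,\big(\sum_{i=k}^{2k}w(n+i)^{-\frac1{p-1}}\big)^{p-1}\le C(k+1)^p$ for all $n\in\mathbb{Z}$, $k\ge0$. *)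

(* Defs.v *)
From HB Require Import structures.
From mathcomp Require Import all_boot all_order all_algebra.
From mathcomp Require Import all_classical all_reals all_analysis.
From mathcomp.real_closed Require Import complex.

Set Implicit Arguments.
Unset Strict Implicit.
Unset Printing Implicit Defensive.

Import Order.TTheory GRing.Theory Num.Theory.
Import numFieldNormedType.Exports.

Local Open Scope classical_set_scope.
Local Open Scope ring_scope.

(* The library norm `|z| on R[i] takes its values in R[i]; this is the
   real-valued modulus. *)
Notation cabs := (@ComplexField.Normc.normc _).

Definition ergodic_avg (R : realType) (f : int -> R[i]) (n : int) (N : nat)
    : R[i] :=
  (\sum_(0 <= i < N.+1) f (n + i%:Z)) / N.+1%:R.

Definition variation_norm (R : realType) (q : R) (a : nat -> R[i]) : \bar R :=
  ereal_sup [set ((\sum_(0 <= j <oo) (cabs (a (N j) - a (N j.+1)) `^ q)%:E)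
                    `^ q^-1)%E
            | N in [set N : nat -> nat | increasing_seq N]].

Definition variation_op (R : realType) (q : R) (f : int -> R[i]) (n : int)
    : \bar R :=
  variation_norm q (ergodic_avg f n).

Definition weight (R : realType) (w : int -> R) : Prop := forall n, 0 < w n.

Definition weight_measure (R : realType) (w : int -> R) (E : set int)
    : \bar R :=
  (\esum_(n in E) (w n)%:E)%E.

Definition ellp (R : realType) (p : R) (w : int -> R) : set (int -> R[i]) :=
  [set f | (\esum_(n in [set: int]) (cabs (f n) `^ p * w n)%:E < +oo)%E].

(* The iterated minimum starts from w n, which is itself one of the values
   w i, n <= i <= n + k. *)
Definition A1plus (R : realType) (w : int -> R) : Prop :=
  exists C : R, forall (n : int) (k : nat),
    \sum_(0 <= i < k.+1) w (n - k%:Z + i%:Z) <=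
    C * k.+1%:R * \big[Num.min/w n]_(0 <= i < k.+1) w (n + i%:Z).

Definition Applus (R : realType) (p : R) (w : int -> R) : Prop :=
  exists C : R, forall (n : int) (k : nat),
    (\sum_(0 <= i < k.+1) w (n + i%:Z)) *
    (\sum_(k <= i < (2 * k).+1) w (n + i%:Z) `^ (- (1 / (p - 1)))) `^ (p - 1)
    <= C * k.+1%:R `^ p.

(* Main.v *)
(* Sufficiency. Splitting f into the positive and negative parts of its real and
   imaginary parts and restricting to windows reduces everything to
   nonnegative, finitely supported sequences on nat and to averages of bounded
   length, with constants independent of both.

   The unweighted weak (1,1) bound comes from a one-sided Calderon-Zygmund
   decomposition f = g + b given by the rising sun lemma. Off the exceptional
   set the averages of b are -rho(x+N+1)/(N+1) with rho bounded by lambda times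
   the distance to the set, and the squares of these telescope. For the bounded
   part g, averages are compared with dyadic martingale averages in l^2, and
   the q-variation of the martingale is controlled, since q > 2, by counting
   jumps of size lambda 2^-s.

   With w in A_p^+ (or A_1^+), a good-lambda inequality between the variation
   and the one-sided maximal function is obtained on each maximal run [a, b) of
   {variation > lambda}: the run is cut into rings 2^r <= b - n < 2^(r+1), the
   averages beyond a ring are compared with those at the point b, outside the
   level set, and the local part is handled by the weak (1,1) bound on the ring;
   the weight condition compares the mass of a ring with that of the part of
   the next one where the local variation is small. The maximal function itself
   is bounded directly, through a layering of the level sets and the two-sided
   maximal function with respect to the dual weight.

   Necessity. If f >= 0 lives on [n+k, n+2k] with sum s, then at the points of
   [n, n+k] the averages of lengths 2k+1 and 4k+2 differ by s/(4k+2); take f to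
   be the dual weight there for p > 1, a unit mass for p = 1. *)

Require Import Defs.
From mathcomp Require Import all_boot all_order all_algebra.
From mathcomp Require Import all_classical all_reals all_analysis.
From mathcomp.real_closed Require Import complex.
From mathcomp Require Import ring lra zify.

Set Implicit Arguments.
Unset Strict Implicit.
Unset Printing Implicit Defensive.

Import Order.TTheory GRing.Theory Num.Theory.
Import numFieldNormedType.Exports.

Local Open Scope classical_set_scope.
Local Open Scope ring_scope.

(** * Partial sums and truncated variation *)

(** Sums over intervals are written throughout as differences of the primitive [psum], which suits
    both the rising sun lemma and telescoping. The obstacle of the weighted part is that a one-sided
    weight condition only compares masses up to a constant. The good-lambda inequality therefore
    gains a factor eps < 1 that depends on the weight and may be close to 1. Summing over levels B^j
    requires B^p eps < 1, so B is chosen after eps and arbitrarily close to 1. This is why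
    variations are split with the unequal factors (1 + th)^q and (1 + 1/th)^q, and why the far part
    is compared with the point b with leading constant near 1. Absorbing the eps term requires
    finite sums, which finite support and bounded lengths supply; all limits are taken at the end,
    with constants already uniform. In the square function part, an average at scale k interacts
    with a martingale difference i scales away with gain 2^-i in l^2. Passing from l^2 bounds on a
    sequence and on its increments to its 2-variation goes through the signed square x|x|. *)

Definition psum (R : realType) (f : nat -> R) (t : nat) : R := \sum_(i < t) f i.

Lemma psum0 (R : realType) (f : nat -> R) : psum f 0 = 0.
Proof. by rewrite /psum big_ord0. Qed.

Lemma psumS (R : realType) (f : nat -> R) t : psum f t.+1 = psum f t + f t.
Proof. by rewrite /psum big_ord_recr. Qed.

Lemma psum_eq (R : realType) (f g : nat -> R) t :
  (forall i, (i < t)%N -> f i = g i) -> psum f t = psum g t.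
Proof. by move=> fg; apply: eq_bigr => i _; exact: fg. Qed.

Lemma psum_leB (R : realType) (f g : nat -> R) a b : (a <= b)%N ->
  (forall i, (a <= i < b)%N -> f i <= g i) ->
  psum f b - psum f a <= psum g b - psum g a.
Proof.
elim: b => [|b IH]; first by rewrite leqn0 => /eqP -> _; rewrite !psum0.
rewrite leq_eqVlt => /orP[/eqP -> _|]; first by rewrite !subrr.
rewrite ltnS => ab fg; rewrite !psumS.
have h : f b <= g b by apply: fg; rewrite ab ltnSn.
have {}IH : psum f b - psum f a <= psum g b - psum g a.
  by apply: IH => // i /andP[h1 h2]; apply: fg; rewrite h1 ltnS ltnW.
by lra.
Qed.

Lemma psum_le (R : realType) (f g : nat -> R) t :
  (forall i, (i < t)%N -> f i <= g i) -> psum f t <= psum g t.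
Proof. by move=> fg; apply: ler_sum => i _; exact: fg. Qed.

Lemma psum_ge0 (R : realType) (f : nat -> R) t :
  (forall i, (i < t)%N -> 0 <= f i) -> 0 <= psum f t.
Proof. by move=> fg; apply: sumr_ge0 => i _; exact: fg. Qed.

Lemma psum_cst (R : realType) (c : R) t : psum (fun=> c) t = t%:R * c.
Proof. by rewrite /psum sumr_const card_ord mulr_natl. Qed.

Lemma psum_mono (R : realType) (f : nat -> R) a b : (a <= b)%N ->
  (forall i, (a <= i < b)%N -> 0 <= f i) -> psum f a <= psum f b.
Proof. by move=> ab f0; have := psum_leB ab f0; rewrite !psum_cst; lra. Qed.

Lemma psumD (R : realType) (f g : nat -> R) t :
  psum (fun i => f i + g i) t = psum f t + psum g t.
Proof. by rewrite /psum big_split. Qed.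

Lemma psumB (R : realType) (f g : nat -> R) t :
  psum (fun i => f i - g i) t = psum f t - psum g t.
Proof. by rewrite /psum sumrB. Qed.

Lemma psumZ (R : realType) (c : R) (f : nat -> R) t :
  psum (fun i => c * f i) t = c * psum f t.
Proof. by rewrite /psum mulr_sumr. Qed.

Lemma psum_shift (R : realType) (f : nat -> R) k t :
  psum (fun i => f (i + k)%N) t = psum f (t + k) - psum f k.
Proof.
elim: t => [|t IH]; first by rewrite psum0 add0n subrr.
by rewrite addSn !psumS IH; ring.
Qed.

Lemma psum_exch (R : realType) (F : nat -> nat -> R) a b :
  psum (fun i => psum (F i) a) b = psum (fun j => psum (F^~ j) b) a.
Proof. by rewrite /psum exchange_big. Qed.

Lemma psum_supp (R : realType) (f : nat -> R) L t :
  (forall i, (L <= i)%N -> f i = 0) -> (L <= t)%N -> psum f t = psum f L.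
Proof.
move=> f0 /subnKC <-; elim: (t - L)%N => [|d IH]; first by rewrite addn0.
by rewrite addnS psumS IH f0 ?addr0 ?leq_addr.
Qed.

(** Weighted Cauchy-Schwarz, by induction on t: each cross term 2 f_t f_i is split by completing the
    square (c_t f_i - c_i f_t)^2. *)
Lemma psum_wsqr (R : realType) (c f : nat -> R) t : (forall i, 0 < c i) ->
  psum f t ^+ 2 <= psum c t * psum (fun i => f i ^+ 2 / c i) t.
Proof.
move=> c0; elim: t => [|t IH]; first by rewrite !psum0 mulr0 expr0n.
have ct := c0 t.
have h : 2 * f t * psum f t <=
    psum (fun i => c t * (f i ^+ 2 / c i) + f t ^+ 2 / c t * c i) t.
  rewrite -psumZ; apply: psum_le => i _; have ci := c0 i.
  have -> : c t * (f i ^+ 2 / c i) + f t ^+ 2 / c t * c i =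
      2 * f t * f i + (c t * f i - c i * f t) ^+ 2 / (c t * c i).
    by field; rewrite !gt_eqF.
  by rewrite lerDl divr_ge0 ?sqr_ge0 // mulr_ge0 // ltW.
move: h; rewrite !psumS psumD !psumZ => h.
have -> : (psum c t + c t) * (psum (fun i => f i ^+ 2 / c i) t + f t ^+ 2 / c t) =
   psum c t * psum (fun i => f i ^+ 2 / c i) t +
   (c t * psum (fun i => f i ^+ 2 / c i) t + f t ^+ 2 / c t * psum c t) + f t ^+ 2.
  by field; rewrite gt_eqF.
by rewrite sqrrD; lra.
Qed.

Lemma psum_sqr (R : realType) (f : nat -> R) t :
  psum f t ^+ 2 <= t%:R * psum (fun i => f i ^+ 2) t.
Proof.
have := @psum_wsqr R (fun=> 1) f t (fun=> ltr01); rewrite psum_cst mulr1.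
by rewrite (@psum_eq _ (fun i => _ / 1) (fun i => f i ^+ 2)) // => i _; rewrite divr1.
Qed.

Lemma psum_term (R : realType) (f : nat -> R) i t : (i < t)%N ->
  (forall j, (j < t)%N -> 0 <= f j) -> f i <= psum f t.
Proof.
move=> it f0; rewrite /psum (bigD1 (Ordinal it)) //= lerDl.
by apply: sumr_ge0 => j _; exact: f0.
Qed.

Lemma ler_powR_base (R : realType) (q x y : R) :
  0 <= q -> 0 <= x -> x <= y -> x `^ q <= y `^ q.
Proof.
move=> q0 x0 xy; apply: ge0_ler_powR => //; rewrite nnegrE //.
exact: le_trans xy.
Qed.

Lemma ltr_powR_base (R : realType) (q x y : R) :
  0 < q -> 0 <= x -> x < y -> x `^ q < y `^ q.
Proof.
move=> q0 x0 xy; apply: gt0_ltr_powR => //; rewrite nnegrE //.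
exact: le_trans (ltW xy).
Qed.

Lemma ltr_powR_inv (R : realType) (q x y : R) :
  0 <= q -> 0 <= y -> x `^ q < y `^ q -> x < y.
Proof.
move=> q0 y0 h; rewrite ltNge; apply/negP => yx.
by move: h; rewrite ltNge ler_powR_base.
Qed.

(** Either y <= th x, and x + y <= (1 + th) x, or x < y / th, and x + y <= (1 + 1/th) y. A small
    [th] keeps the factor of the main term x close to 1. *)
Lemma powR_add_weighted (R : realType) (q th x y : R) :
  0 <= q -> 0 < th -> 0 <= x -> 0 <= y ->
  (x + y) `^ q <= (1 + th) `^ q * x `^ q + (1 + th^-1) `^ q * y `^ q.
Proof.
move=> q0 th0 x0 y0; have thV : 0 < th^-1 by rewrite invr_gt0.
have e1 : 0 <= 1 + th by lra.
have e2 : 0 <= 1 + th^-1 by lra.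
rewrite -!powRM //.
have [h|h] := lerP y (th * x).
  apply: ler_wpDr; first exact: powR_ge0.
  by apply: ler_powR_base; rewrite ?addr_ge0 //; nra.
apply: ler_wpDl; first exact: powR_ge0.
apply: ler_powR_base; rewrite ?addr_ge0 // mulrDl mul1r addrC lerD2l.
by rewrite ler_pdivlMl // ltW.
Qed.

Lemma powR_superadd (R : realType) (q x y : R) : 1 <= q -> 0 <= x -> 0 <= y ->
  x `^ q + y `^ q <= (x + y) `^ q.
Proof.
move=> q1 x0 y0; have q0 : 0 < q by lra.
rewrite -(mulr_powRB1 x0 q0) -(mulr_powRB1 y0 q0) -(@mulr_powRB1 _ (x + y)) ?addr_ge0 //.
rewrite mulrDl; apply: lerD; apply: ler_wpM2l => //; apply: ler_powR_base; lra.
Qed.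

(** * Variation along finite increasing index sequences *)

Fixpoint vpath (R : realType) (q : R) (a : nat -> R) (x : nat) (s : seq nat) : R :=
  if s is y :: s' then `|a x - a y| `^ q + vpath q a y s' else 0.

Definition vseq (R : realType) (q : R) (a : nat -> R) (s : seq nat) : R :=
  if s is x :: s' then vpath q a x s' else 0.

(* [vmax q M a] is the q-th power of the q-variation of a_0, ..., a_M. *)
Definition vmax (R : realType) (q : R) (M : nat) (a : nat -> R) : R :=
  \big[Num.max/0]_(m : M.+1.-tuple bool) vseq q a (mask m (iota 0 M.+1)).

Lemma vmax_ge0 (R : realType) (q : R) M a : 0 <= vmax q M a.
Proof. exact: bigmax_ge_id. Qed.

Lemma vpath_leq_ltn (R : realType) (q : R) a x s : 0 < q -> path leq x s ->
  exists s', [/\ path ltn x s', vpath q a x s = vpath q a x s' &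
                 last x s = last x s'].
Proof.
move=> q0; elim: s x => [|y s IH] x /=; first by exists [::].
move=> /andP[]; rewrite leq_eqVlt => /orP[/eqP <- /IH|xy /IH].
  by move=> [s' [h1 h2 h3]]; exists s'; rewrite subrr normr0 powR0 ?gt_eqF // add0r.
by move=> [s' [h1 h2 h3]]; exists (y :: s'); rewrite /= xy h1 h2.
Qed.

Lemma vpath_le_vmax (R : realType) (q : R) M a x s : 0 < q -> path leq x s ->
  (last x s <= M)%N -> vpath q a x s <= vmax q M a.
Proof.
move=> q0 /(@vpath_leq_ltn _ q a _ _ q0)[s' [h1 -> ->]] h3.
have hall : all (fun y => y <= last x s')%N (x :: s').
  elim: s' x h1 {h3} => [|y s' IH] x /=; first by rewrite leqnn.
  move=> /andP[xy /[dup] ys /IH /= /andP[yl ->]]; rewrite yl !andbT.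
  exact: leq_trans (ltnW xy) yl.
have e : x :: s' = [seq i <- iota 0 M.+1 | i \in x :: s'].
  apply: (irr_sorted_eq ltn_trans ltnn).
  - exact: h1.
  - by apply: sorted_filter; [exact: ltn_trans|exact: iota_ltn_sorted].
  - move=> i; rewrite mem_filter mem_iota add0n leq0n /= ltnS.
    case: (boolP (i \in _)) => //= ix.
    by rewrite (leq_trans (allP hall _ ix)).
pose m := [tuple of map (fun i => i \in x :: s') (iota_tuple M.+1 0)].
have em : mask m (iota 0 M.+1) = x :: s' by rewrite [RHS]e filter_mask.
have -> : vpath q a x s' = vseq q a (mask m (iota 0 M.+1)) by rewrite em.
exact: (le_bigmax _ (fun m : M.+1.-tuple bool => vseq q a (mask m (iota 0 M.+1)))).
Qed.

Lemma mask_iota_path m (x : nat) s M :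
  mask m (iota 0 M.+1) = x :: s -> path ltn x s /\ (last x s <= M)%N.
Proof.
move=> e; have h : subseq (x :: s) (iota 0 M.+1) by rewrite -e mask_subseq.
split.
  have := subseq_sorted ltn_trans h (iota_ltn_sorted 0 M.+1).
  by [].
have /mem_subseq/(_ (last x s)) := h.
by rewrite mem_last mem_iota add0n ltnS => /(_ isT).
Qed.

Lemma vmax_le (R : realType) (q : R) M a c : 0 <= c ->
  (forall x s, path ltn x s -> (last x s <= M)%N -> vpath q a x s <= c) ->
  vmax q M a <= c.
Proof.
move=> c0 h; apply: bigmax_le => // m _.
case e : (mask m (iota 0 M.+1)) => [//|x s] /=.
by have [h1 h2] := mask_iota_path e; exact: h.
Qed.

Lemma path_ltn_leq x s : path ltn x s -> path leq x s.
Proof. by apply: sub_path => i j; exact: ltnW. Qed.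

Lemma path_leq_last x s : path leq x s -> (x <= last x s)%N.
Proof.
elim: s x => //= y s IH x /andP[xy /IH]; exact: leq_trans.
Qed.

(** The device behind the truncated variation bounds: a potential [psi] whose increments dominate
    the q-th powers of the jumps telescopes along every path at once. *)
Lemma vpath_tel (R : realType) (q : R) a (psi : nat -> R) M x s :
  (forall i j, (i <= j)%N -> (j <= M)%N -> `|a i - a j| `^ q <= psi j - psi i) ->
  path leq x s -> (last x s <= M)%N -> vpath q a x s <= psi (last x s) - psi x.
Proof.
move=> h; elim: s x => [|y s IH] x /=; first by rewrite subrr.
move=> /andP[xy ys] lM; have := IH _ ys lM.
have := h _ _ xy (leq_trans (path_leq_last ys) lM); lra.
Qed.

Lemma vpath_le_add (R : realType) (q th : R) (a b c : nat -> R) M x s :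
  0 <= q -> 0 < th ->
  (forall i j, (i <= j)%N -> (j <= M)%N ->
     `|a i - a j| <= `|b i - b j| + `|c i - c j|) ->
  path leq x s -> (last x s <= M)%N ->
  vpath q a x s <= (1 + th) `^ q * vpath q b x s + (1 + th^-1) `^ q * vpath q c x s.
Proof.
move=> q0 th0 h; elim: s x => [|y s IH] x /=; first by rewrite !mulr0 addr0.
move=> /andP[xy ys] lM; have h1 := IH _ ys lM.
have h2 := h _ _ xy (leq_trans (path_leq_last ys) lM).
have h3 := @powR_add_weighted _ q th _ _ q0 th0 (normr_ge0 (b x - b y)) (normr_ge0 (c x - c y)).
have h4 : `|a x - a y| `^ q <= (`|b x - b y| + `|c x - c y|) `^ q by exact: ler_powR_base.
rewrite !mulrDr; lra.
Qed.

Lemma vmax_add (R : realType) (q th : R) (b c : nat -> R) M : 0 < q -> 0 < th ->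
  vmax q M (fun i => b i + c i) <=
  (1 + th) `^ q * vmax q M b + (1 + th^-1) `^ q * vmax q M c.
Proof.
move=> q0 th0; apply: vmax_le.
  by rewrite addr_ge0 ?mulr_ge0 ?powR_ge0 ?vmax_ge0.
move=> x s /path_ltn_leq h1 h2.
apply: le_trans (@vpath_le_add _ q th (fun i => b i + c i) b c M x s (ltW q0) th0 _ h1 h2) _.
  move=> i j _ _; rewrite opprD addrACA; exact: ler_normD.
by apply: lerD; apply: ler_wpM2l; rewrite ?powR_ge0 //; exact: vpath_le_vmax.
Qed.

Lemma vmax_eq (R : realType) (q : R) (a b : nat -> R) M :
  (forall i, (i <= M)%N -> a i = b i) -> vmax q M a = vmax q M b.
Proof.
move=> ab; apply: eq_bigr => m _; case e: (mask m _) => [//|x s] /=.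
have [/path_ltn_leq h1 h2] := mask_iota_path e.
elim: s x h1 h2 {e} => //= y s IH x /andP[xy ys] h2.
have yM := leq_trans (path_leq_last ys) h2.
by rewrite IH // !ab // (leq_trans xy yM).
Qed.

Lemma vpath_comp (R : realType) (q : R) a (phi : nat -> nat) x s :
  vpath q (a \o phi) x s = vpath q a (phi x) (map phi s).
Proof. by elim: s x => //= y s IH x; rewrite IH. Qed.

Lemma vpath_reparam (R : realType) (q : R) a (phi : nat -> nat) M x s : 0 < q ->
  {homo phi : i j / (i <= j)%N} -> path leq x s -> (phi (last x s) <= M)%N ->
  vpath q (a \o phi) x s <= vmax q M a.
Proof.
move=> q0 hphi h1 h2; rewrite vpath_comp; apply: vpath_le_vmax => //.
  by rewrite path_map; apply: sub_path h1 => i j; exact: hphi.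
by rewrite last_map.
Qed.

Definition avg (R : realType) (f : nat -> R) (n N : nat) : R :=
  (psum f (n + N.+1) - psum f n) / N.+1%:R.

Definition ind (R : realType) (P : Prop) : R := `[< P >]%:R.
Arguments ind {R} P.

Lemma ind1 (R : realType) (P : Prop) : P -> @ind R P = 1.
Proof. by move=> p; rewrite /ind asboolT. Qed.

Lemma ind0 (R : realType) (P : Prop) : ~ P -> @ind R P = 0.
Proof. by move=> p; rewrite /ind asboolF. Qed.

Lemma indP (R : realType) (P : Prop) : (P /\ @ind R P = 1) \/ (~ P /\ @ind R P = 0).
Proof. by have [p|p] := EM P; [left; rewrite ind1|right; rewrite ind0]. Qed.

Lemma ind_ge0 (R : realType) (P : Prop) : 0 <= @ind R P.
Proof. by rewrite /ind ler0n. Qed.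

Lemma ind_le1 (R : realType) (P : Prop) : @ind R P <= 1.
Proof. by case: (indP R P) => -[_ ->]; rewrite ?lexx ?ler01. Qed.

Lemma ind_imp (R : realType) (P Q : Prop) : (P -> Q) -> @ind R P <= ind Q.
Proof.
move=> pq; case: (indP R P) => -[p ->]; first by rewrite ind1 //; exact: pq.
exact: ind_ge0.
Qed.

#[export] Hint Resolve ind_ge0 ind_le1 : core.

Ltac nng := repeat first
  [ assumption | exact: ind_ge0 | exact: ler0n | exact: powR_ge0
  | exact: vmax_ge0 | apply: ltW; assumption | apply: addr_ge0
  | apply: mulr_ge0 | rewrite invr_ge0 | apply: exprn_ge0 ].

Ltac nat_lia := repeat match goal with
  | H : ?T |- _ => lazymatch T with
      | is_true (leq _ _) => fail
      | is_true (andb _ _) => fail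
      | is_true (negb _) => fail
      | @eq nat _ _ => fail
      | nat => fail
      | _ => clear H
      end
  end; lia.

(** * Rising sun lemma and Calderon-Zygmund decomposition *)

(** For constant [T] this is the level set of the one-sided maximal function: some forward average
    starting at t exceeds [T]. A variable [T] gives the maximal function relative to a measure. *)
Definition above (R : realType) (f T : nat -> R) (t : nat) : Prop :=
  exists s, (t < s)%N /\ psum T s - psum T t < psum f s - psum f t.

(** The recursion runs backwards from L, so k is the distance to L and the value is the envelope at
    the point L - k. *)
Fixpoint rising_env (R : realType) (f T : nat -> R) (L k : nat) : R :=
  if k is k'.+1 then
    Num.max (psum f (L - k)) (rising_env f T L k' - T (L - k)%N)
  else psum f L.

(* Riesz' rising sun lemma: [G] is the least majorant of the primitive of [f]
   whose increments are bounded by those of the primitive of [T]. *)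
Lemma rising_sun (R : realType) (f T : nat -> R) L :
  (forall i, 0 <= f i) -> (forall i, 0 <= T i) ->
  (forall i, (L <= i)%N -> f i = 0) ->
  exists G : nat -> R,
   [/\ forall t, psum f t <= G t,
       forall t, (L <= t)%N -> G t = psum f t,
       forall t, 0 <= G t.+1 - G t <= T t,
       forall t, psum f t < G t -> G t.+1 - G t = T t
     & forall t, psum f t < G t <-> above f T t].
Proof.
move=> f0 T0 fL; pose G t := rising_env f T L (L - t).
have F_mono a b : (a <= b)%N -> psum f a <= psum f b by move=> ab; apply: psum_mono.
have GL t : (L <= t)%N -> G t = psum f t.
  by move=> Lt; rewrite /G (eqP Lt) /= (psum_supp fL Lt).
have GS t : (t < L)%N -> G t = Num.max (psum f t) (G t.+1 - T t).
  move=> tL; rewrite /G.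
  have -> : (L - t = (L - t.+1).+1)%N by rewrite subnSK.
  rewrite /=; have -> // : (L - (L - t.+1).+1 = t)%N by lia.
have FG t : psum f t <= G t.
  by case: (ltnP t L) => tL; [rewrite GS // le_max lexx|rewrite GL].
have Ginc t : 0 <= G t.+1 - G t <= T t.
  case: (ltnP t L) => tL.
    rewrite (GS _ tL); have h := FG t.+1; have h2 := F_mono _ _ (leqnSn t).
    by have := T0 t; case: (lerP (psum f t) (G t.+1 - T t)) => ?; lra.
  by rewrite !GL ?(leq_trans tL) // !psumS fL // addr0 subrr lexx T0.
(* [att] and [low] identify G t with the maximum over s >= t of F(s) minus the [T]-mass of [t, s), F
   being the primitive of f. This is what matches {F < G} with [above]. *)
have att k t : (L - t = k)%N ->
    exists s, (t <= s)%N /\ G t = psum f s - (psum T s - psum T t).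
  elim: k t => [|k IH] t Lt.
    by exists t; split=> //; rewrite GL -?subn_eq0 ?Lt // subrr subr0.
  have tL : (t < L)%N by rewrite -subn_gt0 Lt.
  rewrite GS //; case: lerP => _; last by exists t; rewrite subrr subr0.
  have [|s [ts ->]] := IH t.+1; first by rewrite subnS Lt.
  by exists s; split; [exact: ltnW|rewrite psumS; ring].
have low t s : (t <= s)%N -> psum f s - (psum T s - psum T t) <= G t.
  move=> /subnKC <-; move: (s - t)%N => d; elim: d t => [|d IH] t.
    by rewrite addn0 subrr subr0.
  have := IH t.+1; rewrite addSnnS psumS => h.
  by have /andP[_] := Ginc t; lra.
exists G; split => //.
- move=> t h; have tL : (t < L)%N by rewrite ltnNge; apply/negP => /GL e; rewrite e ltxx in h.
  by move: h; rewrite GS //; case: (lerP (psum f t) (G t.+1 - T t)) => ? h; [ring|rewrite ltxx in h].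
- move=> t; split=> [h|[s [ts h]]].
    have [s [ts e]] := att _ t erefl; exists s; split; last by lra.
    rewrite ltn_neqAle ts andbT; apply/eqP => e'.
    by move: h; rewrite e -e' subrr subr0 ltxx.
  by have := low _ _ (ltnW ts); lra.
Qed.

(** On the set [above] the envelope grows exactly by [T], and its total growth is at most F(L),
    since G(L) = F(L) and G(0) >= 0. This is the weak type bound with constant 1. *)
Lemma weak_max (R : realType) (f T : nat -> R) L :
  (forall i, 0 <= f i) -> (forall i, 0 <= T i) ->
  (forall i, (L <= i)%N -> f i = 0) ->
  psum (fun t => ind (above f T t) * T t) L <= psum f L.
Proof.
move=> f0 T0 fL; have [G [h1 h2 h3 h4 h5]] := rising_sun f0 T0 fL.
apply: (@le_trans _ _ (psum (fun t => G t.+1 - G t) L)).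
  apply: psum_le => t _; have /andP[g0 gT] := h3 t.
  by case: (indP R (above f T t)) => -[h ->]; rewrite ?mul1r ?mul0r // h4 //; apply/h5.
have -> : psum (fun t => G t.+1 - G t) L = G L - G 0%N.
  elim: {h2 fL} L => [|L IH]; first by rewrite psum0 subrr.
  by rewrite psumS IH; ring.
by rewrite h2 //; have := h1 0%N; rewrite psum0; lra.
Qed.

Lemma powR_split2 (R : realType) (q x : R) : 2 <= q -> 0 <= x ->
  x `^ q = x `^ (q - 2) * x ^+ 2.
Proof.
move=> q2; rewrite le_eqVlt => /orP[/eqP <-|x0].
  by rewrite expr0n mulr0 powR0 // gt_eqF //; lra.
rewrite -powR_mulrn ?ltW // -powRD ?subrK //.
by rewrite (gt_eqF x0) implybT.
Qed.

Lemma abs_tel (R : realType) (h : nat -> R) i j : (i <= j)%N ->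
  `|h i - h j| <= psum (fun N => `|h N.+1 - h N|) j - psum (fun N => `|h N.+1 - h N|) i.
Proof.
move=> /subnKC <-; elim: (j - i)%N => [|d IH]; first by rewrite addn0 !subrr normr0.
rewrite addnS psumS; have := ler_normD (h i - h (i + d)%N) (h (i + d)%N - h (i + d).+1).
rewrite subrKA (distrC (h (i + d)%N)); lra.
Qed.

(** The summand is r/(d+1) - r/(d+2); the truncation starts the telescoping only where r/(d+1) <=
    lam. *)
Lemma truncated_tail (R : realType) (lam r : R) D : 0 < lam -> 0 <= r ->
  psum (fun d => ind (r <= lam * d.+1%:R) * (r / (d.+1%:R * d.+2%:R))) D <= lam.
Proof.
move=> l0 r0.
(* Strengthened for the induction: the maximum with 0 records whether the truncation has begun. *)
suff h : psum (fun d => ind (r <= lam * d.+1%:R) * (r / (d.+1%:R * d.+2%:R))) D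
         <= Num.max 0 (lam - r / D.+1%:R).
  apply: le_trans h _; rewrite ge_max ltW //= gerBl.
  by rewrite divr_ge0.
elim: D => [|D IH]; first by rewrite psum0 le_max lexx.
rewrite psumS; set a : R := D.+1%:R; set b : R := D.+2%:R.
have a0 : 0 < a by rewrite ltr0n.
have eb : b = a + 1 by rewrite /b /a -natr1.
rewrite -/a in IH; case: (indP R (r <= lam * a)) => -[h ->].
  rewrite mul1r le_max; apply/orP; right.
  have h2 : r / a <= lam by rewrite ler_pdivrMr.
  move: IH; rewrite (max_idPr _) ?subr_ge0 // => IH.
  have -> : r / b = r / a - r / (a * b).
    rewrite eb; field; lra.
  move: IH; move: (psum _ _) (r / (a * b)) (r / a) => S x y; lra.
rewrite mul0r addr0; apply: le_trans IH _.
have h2 : lam < r / a by rewrite ltr_pdivlMr // ltNge; apply/negP.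
have h3 : lam - r / a <= 0 by rewrite subr_le0 ltW.
by rewrite (max_idPl h3) le_max lexx.
Qed.

(* [u] below is the average of the bad part at a point where the envelope
   touches; the square of a nonnegative sequence controls its 2-variation. *)
Lemma var_sqr (R : realType) (q lam : R) M (u : nat -> R) : 2 <= q ->
  (forall N, 0 <= u N <= lam) ->
  vmax q M u <= lam `^ (q - 2) * psum (fun N => `|u N.+1 ^+ 2 - u N ^+ 2|) M.
Proof.
move=> q2 hu; have psi0 a b : (a <= b)%N -> psum (fun N => `|u N.+1 ^+ 2 - u N ^+ 2|) a
   <= psum (fun N => `|u N.+1 ^+ 2 - u N ^+ 2|) b by move=> ab; apply: psum_mono.
have P0 : 0 <= lam `^ (q - 2) := powR_ge0 _ _.
apply: vmax_le; first by rewrite mulr_ge0 // psum_ge0.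
move=> x s /path_ltn_leq h1 h2.
apply: le_trans (@vpath_tel _ q u (fun n => lam `^ (q - 2) *
   psum (fun N => `|u N.+1 ^+ 2 - u N ^+ 2|) n) M x s _ h1 h2) _; last first.
  rewrite -mulrBr ler_wpM2l // lerBlDr (le_trans (psi0 _ _ h2)) // lerDl.
  exact: psum_ge0.
move=> i j ij _; rewrite powR_split2 // -mulrBr.
have /andP[i0 il] := hu i; have /andP[j0 jl] := hu j.
have h3 : `|u i - u j| <= lam by rewrite ler_norml; lra.
apply: ler_pM; rewrite ?powR_ge0 ?sqr_ge0 //.
  by apply: ler_powR_base => //; lra.
apply: le_trans (abs_tel (fun n => u n ^+ 2) ij).
rewrite expr2 subr_sqr normrM ler_wpM2l //.
by rewrite [`|u i + u j|]ger0_norm ?addr_ge0 // ler_norml; lra.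
Qed.

Lemma avg_shift_env (R : realType) (f g : nat -> R) (G : nat -> R) x N :
  (forall t, G t.+1 - G t = g t) -> G x = psum f x ->
  avg (fun i => f i - g i) x N = - ((G (x + N.+1)%N - psum f (x + N.+1)) / N.+1%:R).
Proof.
move=> hg hx; have hP t : psum g t = G t - G 0%N.
  elim: t => [|t IH]; first by rewrite psum0 subrr.
  by rewrite psumS IH -hg; ring.
by rewrite /avg !psumB !hP hx -mulNr; congr (_ / _); ring.
Qed.

(** With a = N + 1 this bounds one increment of the square of rho / length: the change of the
    numerator costs [E], the change of the denominator costs [lam]. Every term on the right has the
    form r/(a(a+1)), ready for [truncated_tail]; the factor 2 at r' comes from 1/(a+1) <=
    2/(a+2). *)
Lemma frac_ineq (R : realType) (a lam E r r' : R) : 0 < a -> 0 <= r -> 0 <= r' ->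
  `|r' - r| <= E -> r <= lam * a ->
  `|(r' / (a + 1)) ^+ 2 - (r / a) ^+ 2| <=
  E * (r / (a * (a + 1))) + 2 * E * (r' / ((a + 1) * (a + 2)))
  + 2 * lam * (r / (a * (a + 1))).
Proof.
move=> a0 r0 r'0 hE hl.
have a1 : 0 < a + 1 by lra.
have a2 : 0 < a + 2 by lra.
have E0 : 0 <= E := le_trans (normr_ge0 _) hE.
rewrite !invfM; set i := a^-1; set j := (a + 1)^-1; set k := (a + 2)^-1.
have i0 : 0 < i by rewrite invr_gt0.
have j0 : 0 < j by rewrite invr_gt0.
have k0 : 0 < k by rewrite invr_gt0.
have ei : a * i = 1 by rewrite divff // gt_eqF.
have ej : (a + 1) * j = 1 by rewrite divff // gt_eqF.
have ek : (a + 2) * k = 1 by rewrite divff // gt_eqF.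
have ij : j <= i by rewrite lef_pV2 ?posrE //; lra.
have jk : j <= 2 * k.
  by rewrite -(ler_pM2l a1) ej -(ler_pM2l a2) mulr1 mulrCA [(a + 2) * _]mulrCA ek mulr1; lra.
have li : r * i <= lam by rewrite ler_pdivrMr.
have e1 : i - j = i * j.
  have t1 : i = i * ((a + 1) * j) by rewrite ej mulr1.
  have t2 : j = a * i * j by rewrite ei mul1r.
  by lra.
have -> : (r' * j) ^+ 2 - (r * i) ^+ 2 =
    (r' - r) * ((r' + r) * j ^+ 2) - r ^+ 2 * ((i * j) * (i + j)).
  by rewrite -e1; ring.
apply: le_trans (ler_normB _ _) _.
have i0' := ltW i0; have j0' := ltW j0.
rewrite normrM [`|(r' + r) * _|]ger0_norm; last by rewrite !mulr_ge0 ?addr_ge0.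
rewrite [`|r ^+ 2 * _|]ger0_norm; last first.
  by do ![apply: addr_ge0|apply: mulr_ge0|apply: sqr_ge0] => //.
have b1 : `|r' - r| * ((r' + r) * j ^+ 2) <= E * ((r' + r) * j ^+ 2).
  by rewrite ler_wpM2r // !mulr_ge0 ?addr_ge0.
have b2 : r * j ^+ 2 <= r * (i * j) by rewrite ler_wpM2l // expr2 ler_wpM2r // ltW.
have b3 : r' * j ^+ 2 <= r' * (2 * (j * k)).
  by rewrite ler_wpM2l // expr2 mulrCA ler_wpM2l // ltW.
have b4 : r ^+ 2 * (i * j * (i + j)) <= lam * (2 * (r * (i * j))).
  have -> : r ^+ 2 * (i * j * (i + j)) = (r * (i + j)) * (r * (i * j)) by ring.
  rewrite [leRHS]mulrA ler_wpM2r ?mulr_ge0 ?(ltW i0) ?(ltW j0) //.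
  by have : r * j <= r * i; [rewrite ler_wpM2l|lra].
have := ler_wpM2l E0 b2; have := ler_wpM2l E0 b3.
lra.
Qed.

(** Here g is the increment of the envelope G and rho = G - F. The sum over x and N is regrouped by
    the end point t = x + N + 1, and the sum over N at fixed t costs [lam] times f(t) + g(t). The
    total 3 lam f + 5 lam g gives the constant 8. *)
Lemma cz_decomposition (R : realType) (q lam : R) (f : nat -> R) L M :
  2 <= q -> 0 < lam -> (forall i, 0 <= f i) ->
  (forall i, (L <= i)%N -> f i = 0) ->
  exists g : nat -> R,
   [/\ forall t, 0 <= g t <= lam,
       forall t, (L <= t)%N -> g t = 0,
       psum g L <= psum f L
     & psum (fun x => ind (~ above f (fun=> lam) x) *
                vmax q M (avg (fun i => f i - g i) x)) L
       <= 8 * lam `^ (q - 2) * lam * psum f L].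
Proof.
move=> q2 l0 f0 fL.
have [//|G [h1 h2 h3 h4 h5]] := @rising_sun R f (fun=> lam) L f0 _ fL.
  by move=> _; exact: ltW.
pose g t := G t.+1 - G t; pose rho t := G t - psum f t.
have rho0 t : 0 <= rho t by rewrite subr_ge0.
have g0 t : 0 <= g t by case/andP: (h3 t).
have rhoL t : (L <= t)%N -> rho t = 0 by move=> /h2; rewrite /rho => ->; rewrite subrr.
have gL t : (L <= t)%N -> g t = 0.
  by move=> Lt; rewrite /g !h2 ?(leq_trans Lt) // psumS fL // addr0 subrr.
have Pg : psum g L <= psum f L.
  have -> : psum g L = G L - G 0%N.
    elim: {h2 fL gL rhoL} L => [|L' IH]; first by rewrite psum0 subrr.
    by rewrite psumS IH /g; ring.
  by rewrite h2 //; have := h1 0%N; rewrite psum0; lra.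
exists g; split => //.
pose e t := f t + g t.
have e0 t : 0 <= e t by rewrite addr_ge0.
have lq0 : 0 <= lam `^ (q - 2) := powR_ge0 _ _.
(* Bounds the increment of the squared average from x = t - N - 1. At a point x outside the
   exceptional set the three truncations hold automatically; they keep what is needed of that
   information once x is summed out. *)
pose K t N :=
  e t * (ind (rho t <= lam * N.+1%:R) * (rho t / (N.+1%:R * N.+2%:R))) +
  2 * e t * (ind (rho t.+1 <= lam * N.+2%:R) * (rho t.+1 / (N.+2%:R * N.+3%:R))) +
  2 * lam * (ind (rho t <= lam * N.+1%:R) * (rho t / (N.+1%:R * N.+2%:R))).
have frac0 (r : R) m n : 0 <= r -> 0 <= r / (m.+1%:R * n.+1%:R).
  by move=> r0; rewrite divr_ge0 // mulr_ge0.
have K0 t N : 0 <= K t N.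
  have l0' := ltW l0.
  rewrite /K; repeat first [exact: l0'|exact: e0|exact: rho0|exact: ind_ge0|exact: ler0n|apply: addr_ge0|apply: frac0|apply: mulr_ge0].
have KL t N : (L <= t)%N -> K t N = 0.
  move=> Lt; rewrite /K /e fL // gL // !rhoL ?(leq_trans Lt) //.
  by rewrite !mul0r !mulr0 !addr0.
have pw x : ~ above f (fun=> lam) x ->
    vmax q M (avg (fun i => f i - g i) x) <=
    lam `^ (q - 2) * psum (fun N => K (x + N.+1)%N N) M.
  move=> nx; have ex : G x = psum f x.
    apply/eqP; rewrite eq_le h1 andbT leNgt; apply/negP => /h5; exact: nx.
  have rx d : rho (x + d)%N <= lam * d%:R.
    elim: d => [|d IH]; first by rewrite addn0 mulr0 /rho ex subrr.
    move: IH; rewrite addnS /rho psumS -natr1 mulrDr mulr1.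
    by have := f0 (x + d)%N; have /andP[_] := h3 (x + d)%N; lra.
  pose u N := rho (x + N.+1)%N / N.+1%:R.
  have hu N : 0 <= u N <= lam.
    by rewrite divr_ge0 //= ler_pdivrMr ?ltr0n // rx.
  apply: (@le_trans _ _ (vmax q M u)).
    apply: vmax_le; first exact: vmax_ge0.
    move=> y s /path_ltn_leq s1 s2.
    rewrite (_ : vpath _ _ _ _ = vpath q u y s); first by apply: vpath_le_vmax => //; lra.
    elim: s y {s1 s2} => //= z s IH y; rewrite IH !(avg_shift_env _ (fun t => erefl (g t)) ex).
    by rewrite -opprD normrN.
  apply: le_trans (var_sqr M q2 hu) _; apply: ler_wpM2l => //.
  apply: psum_le => N _.
  rewrite /K !ind1 ?mul1r -?addnS ?rx //.
  rewrite /u ?(addnS x N.+1).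
  have hr := rx N.+1; set t := (x + N.+1)%N in hr *.
  have hre : `|rho t.+1 - rho t| <= e t.
    have -> : rho t.+1 - rho t = g t - f t by rewrite /rho /g psumS; ring.
    by rewrite ler_norml /e; have := f0 t; have := g0 t; lra.
  have e2 : N.+2%:R = N.+1%:R + 1 :> R by rewrite natr1.
  have e3 : N.+3%:R = N.+1%:R + 2 :> R by rewrite -natrD addn2.
  rewrite e3 e2; exact: frac_ineq.
apply: (@le_trans _ _ (psum (fun x => lam `^ (q - 2) * psum (fun N => K (x + N.+1)%N N) M) L)).
  apply: psum_le => x _; case: (indP R (~ above f (fun=> lam) x)) => -[h ->].
    by rewrite mul1r; exact: pw.
  by rewrite mul0r mulr_ge0 // psum_ge0.
have -> : 8 * lam `^ (q - 2) * lam * psum f L = lam `^ (q - 2) * (8 * lam * psum f L) by ring.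
rewrite psumZ ler_wpM2l // psum_exch.
apply: (@le_trans _ _ (psum (fun N => psum (K^~ N) L) M)).
  apply: psum_le => N _; rewrite (psum_shift (K^~ N)).
  rewrite (@psum_supp _ (K^~ N) L (L + N.+1)) ?leq_addr //; last by move=> t; exact: KL.
  by rewrite gerBl psum_ge0.
rewrite psum_exch.
apply: (@le_trans _ _ (psum (fun t => 3 * lam * f t + 5 * lam * g t) L)); last first.
  by rewrite psumD !psumZ; nra.
apply: psum_le => t _; rewrite /K !psumD !psumZ.
have A1 := @truncated_tail R lam (rho t) M l0 (rho0 t).
have A2 : psum (fun N => ind (rho t.+1 <= lam * N.+2%:R) * (rho t.+1 / (N.+2%:R * N.+3%:R))) M <= lam.
  apply: le_trans (@truncated_tail R lam (rho t.+1) M.+1 l0 (rho0 t.+1)).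
  have := psum_shift (fun d => ind (rho t.+1 <= lam * d.+1%:R) * (rho t.+1 / (d.+1%:R * d.+2%:R))) 1 M.
  rewrite addn1 (psumS _ 0) psum0 add0r => e1.
  rewrite -[X in _ <= X](subrK (ind (rho t.+1 <= lam * 1%:R) * (rho t.+1 / (1%:R * 2%:R)))).
  rewrite -e1; under [X in _ <= X + _]psum_eq => i _ do rewrite addn1.
  by rewrite lerDl mulr_ge0 // frac0.
(* The third term of [K] carries no factor f + g, but it vanishes unless rho(t) > 0, and there g(t)
   = lam. *)
have A3 : lam * psum (fun i => ind (rho t <= lam * i.+1%:R) * (rho t / (i.+1%:R * i.+2%:R))) M
    <= lam * g t.
  have [r0|r0] := ltP 0 (rho t).
    have -> : g t = lam by apply: h4; rewrite -subr_gt0.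
    by rewrite ler_wpM2l // ltW.
  have -> : rho t = 0 by apply/eqP; rewrite eq_le r0 rho0.
  have -> : @psum R (fun i => ind (0 <= lam * i.+1%:R) * (0 / (i.+1%:R * i.+2%:R))) M = psum (fun=> 0) M.
    by apply: psum_eq => i _; rewrite mul0r mulr0.
  by rewrite psum_cst !mulr0 mulr_ge0 // ltW.
have := ler_wpM2l (e0 t) A1; have := ler_wpM2l (e0 t) A2; rewrite /e.
move: A3; move: (psum _ _) (psum _ _) => X Y; lra.
Qed.

(** * Square functions against dyadic averages *)

Definition bconst (R : realType) (b : nat) (h : nat -> R) : Prop :=
  forall n, h n = h (n %/ b * b)%N.

Definition bzero (R : realType) (b : nat) (h : nat -> R) : Prop :=
  forall m, psum h (m * b) = 0.

Lemma psum_block (R : realType) (h : nat -> R) b m :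
  psum h (m.+1 * b) - psum h (m * b) = psum (fun i => h (i + m * b)%N) b.
Proof. by rewrite psum_shift mulSn. Qed.

Lemma block_le (R : realType) (h h' : nat -> R) b m :
  (forall m, psum (fun i => h (i + m * b)%N) b <= psum (fun i => h' (i + m * b)%N) b) ->
  psum h (m * b) <= psum h' (m * b).
Proof.
move=> H; elim: m => [|m IH]; first by rewrite mul0n !psum0.
by have := H m; rewrite -!psum_block; lra.
Qed.

Lemma block_div b i m : (i < b)%N -> ((i + m * b) %/ b = m)%N.
Proof. by move=> ib; rewrite addnC divnMDl ?(leq_ltn_trans _ ib) // divn_small // addn0. Qed.

Lemma bconst_block (R : realType) b (h : nat -> R) i m : bconst b h -> (i < b)%N ->
  h (i + m * b)%N = h (m * b)%N.
Proof. by move=> hb ib; rewrite hb block_div. Qed.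

(** The orthogonality behind the martingale energy identity: on a block the constant comes out and
    the block sum of h vanishes. *)
Lemma bconst_bzero (R : realType) b (c h : nat -> R) : bconst b c -> bzero b h ->
  bzero b (fun i => c i * h i).
Proof.
move=> hc hh; elim=> [|m IH]; first by rewrite mul0n psum0.
have := psum_block (fun i => c i * h i) b m; rewrite IH subr0 => ->.
rewrite (@psum_eq _ _ (fun i => c (m * b)%N * h (i + m * b)%N)).
  by rewrite psumZ -psum_block !hh subrr mulr0.
by move=> i ib; rewrite bconst_block.
Qed.

Lemma psum_shift_le (R : realType) (h : nat -> R) X k : (forall i, 0 <= h i) ->
  (forall i, (X <= i)%N -> h i = 0) -> psum (fun i => h (i + k)%N) X <= psum h X.
Proof.
move=> h0 hX; rewrite psum_shift (psum_supp hX) ?leq_addr // gerBl.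
exact: psum_ge0.
Qed.

Lemma avg_diff (R : realType) (h : nat -> R) n N :
  avg h n N.+1 - avg h n N = (h (n + N.+1)%N - avg h n N) / N.+2%:R.
Proof.
rewrite /avg (addnS n N.+1) psumS.
have -> : N.+2%:R = N.+1%:R + 1 :> R by rewrite natr1.
have a0 : 0 < N.+1%:R :> R by [].
by move: (N.+1%:R : R) a0 => a a0; field; rewrite !gt_eqF ?addr_gt0.
Qed.

Lemma avg_psum (R : realType) (h : nat -> R) n N :
  avg h n N = psum (fun s => h (s + n)%N) N.+1 / N.+1%:R.
Proof. by rewrite /avg psum_shift addnC. Qed.

Lemma avg_sqr (R : realType) (h : nat -> R) n N :
  avg h n N ^+ 2 <= psum (fun s => h (s + n)%N ^+ 2) N.+1 / N.+1%:R.
Proof.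
rewrite avg_psum expr_div_n ler_pdivrMr ?exprn_gt0 ?ltr0n //.
apply: le_trans (psum_sqr _ _) _.
by rewrite expr2 mulrA divfK ?pnatr_eq0 // mulrC.
Qed.

Lemma avg_l2 (R : realType) (h : nat -> R) X N :
  (forall i, (X <= i)%N -> h i = 0) ->
  psum (fun n => avg h n N ^+ 2) X <= psum (fun n => h n ^+ 2) X.
Proof.
move=> hX.
apply: (@le_trans _ _ (psum (fun n => N.+1%:R^-1 * psum (fun s => h (s + n)%N ^+ 2) N.+1) X)).
  by apply: psum_le => n _; rewrite mulrC; exact: avg_sqr.
rewrite psumZ psum_exch mulrC ler_pdivrMr ?ltr0n // mulrC -psum_cst.
apply: psum_le => s _; under [X in X <= _]psum_eq => i _ do rewrite addnC.
apply: psum_shift_le => [i|i Xi]; first exact: sqr_ge0.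
by rewrite hX // expr0n.
Qed.

Lemma davg_l2 (R : realType) (h : nat -> R) X N :
  (forall i, (X <= i)%N -> h i = 0) ->
  psum (fun n => (avg h n N.+1 - avg h n N) ^+ 2) X <=
  4 / N.+2%:R ^+ 2 * psum (fun n => h n ^+ 2) X.
Proof.
move=> hX.
apply: (@le_trans _ _ (psum (fun n => 2 / N.+2%:R ^+ 2 * (h (n + N.+1)%N ^+ 2 + avg h n N ^+ 2)) X)).
  apply: psum_le => n _; rewrite avg_diff expr_div_n [leRHS]mulrAC ler_wpM2r ?invr_ge0 ?sqr_ge0 //.
  have := sqr_ge0 (h (n + N.+1)%N + avg h n N); nra.
rewrite psumZ psumD.
have h1 := avg_l2 N hX.
have h2 : psum (fun n => h (n + N.+1)%N ^+ 2) X <= psum (fun n => h n ^+ 2) X.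
  apply: (psum_shift_le (h := fun i => h i ^+ 2)) => [i|i Xi]; first exact: sqr_ge0.
  by rewrite hX // expr0n.
have h3 : 0 <= 2 / N.+2%:R ^+ 2 :> R by rewrite divr_ge0 // sqr_ge0.
rewrite [4 / _](_ : _ = 2 / N.+2%:R ^+ 2 + 2 / N.+2%:R ^+ 2); last by rewrite -mulrDl; congr (_ / _); ring.
have h4 := ler_wpM2l h3 h1; have h5 := ler_wpM2l h3 h2.
move: h4 h5; move: (2 / _) (psum _ _) (psum _ _) (psum _ _) => A x y z; nra.
Qed.

(** Whole blocks cancel, so the primitive of h at t only sees the piece of its own block before t,
    of length at most b. An average is a difference of two such values over N + 1, whence the gain
    (b/(N+1))^2. *)
Lemma fine_l2 (R : realType) (h : nat -> R) b m N : bzero b h ->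
  (forall i, (m * b <= i)%N -> h i = 0) ->
  psum (fun n => avg h n N ^+ 2) (m * b) <=
  4 * (b%:R / N.+1%:R) ^+ 2 * psum (fun n => h n ^+ 2) (m * b).
Proof.
move=> hz hX; set X := (m * b)%N in hX *.
have HX i : (X <= i)%N -> psum h i ^+ 2 = 0.
  by move=> Xi; rewrite (psum_supp hX Xi) /X hz expr0n.
have HH : psum (fun t => psum h t ^+ 2) X <= psum (fun n => b%:R ^+ 2 * h n ^+ 2) X.
  apply: block_le => m'; rewrite psumZ expr2 -mulrA -psum_cst; apply: psum_le => i ib.
  have -> : psum h (i + m' * b) = psum (fun j => h (j + m' * b)%N) i.
    by rewrite psum_shift hz subr0.
  apply: le_trans (psum_sqr _ _) _; apply: ler_pM => //.
  - by apply: psum_ge0 => j _; exact: sqr_ge0.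
  - by rewrite ler_nat ltnW.
  - by apply: psum_mono => [|j _]; [exact: ltnW|exact: sqr_ge0].
have h3 : 0 <= 2 / N.+1%:R ^+ 2 :> R by rewrite divr_ge0 // sqr_ge0.
apply: (@le_trans _ _ (psum (fun n => 2 / N.+1%:R ^+ 2 * (psum h (n + N.+1) ^+ 2 + psum h n ^+ 2)) X)).
  apply: psum_le => n _; rewrite /avg expr_div_n [leRHS]mulrAC ler_wpM2r ?invr_ge0 ?sqr_ge0 //.
  have := sqr_ge0 (psum h (n + N.+1) + psum h n); nra.
rewrite psumZ psumD.
have h2 : psum (fun n => psum h (n + N.+1) ^+ 2) X <= psum (fun n => psum h n ^+ 2) X.
  by apply: (psum_shift_le (h := fun i => psum h i ^+ 2)) => [i|i Xi]; [exact: sqr_ge0|exact: HX].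
move: HH; rewrite psumZ => HH.
rewrite [4 * _](_ : _ = (2 / N.+1%:R ^+ 2) * (2 * b%:R ^+ 2)); last by field; rewrite ?natr1 ?nat1r pnatr_eq0.
rewrite -mulrA ler_wpM2l //; lra.
Qed.

Lemma count_tail (R : realType) b N t : 
  psum (fun i => @ind R (b <= i + N)%N) t <= (t + N - b)%N%:R.
Proof.
elim: t => [|t IH]; first by rewrite psum0.
rewrite psumS; case: (indP R (b <= t + N)%N) => -[h ->].
  by rewrite addSn subSn // -natr1 lerD2r.
by rewrite addr0; apply: le_trans IH _; rewrite ler_nat addSn leq_sub2r.
Qed.

(** The average differs from h(n) only if the window leaves the block of n, which happens for at
    most N of the b positions. As N < 2b it reaches at most the next two blocks, hence three terms
    with factor 4. *)
Lemma coarse_l2 (R : realType) (h : nat -> R) b m N : (0 < b)%N -> bconst b h ->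
  (N < 2 * b)%N -> (forall i, (m * b <= i)%N -> h i = 0) ->
  psum (fun n => (avg h n N - h n) ^+ 2) (m * b) <=
  12 * (N%:R / b%:R) * psum (fun n => h n ^+ 2) (m * b).
Proof.
move=> b0 hc Nb hX; set X := (m * b)%N in hX *.
have bR : 0 < b%:R :> R by rewrite ltr0n.
pose chi n : R := ind (b <= n %% b + N)%N.
have pw n : (avg h n N - h n) ^+ 2 <=
   4 * (chi n * h n ^+ 2 + chi n * h (n + b)%N ^+ 2 + chi n * h (n + 2 * b)%N ^+ 2).
  have -> : avg h n N - h n = avg (fun i => h i - h n) n N.
    rewrite !avg_psum psumB psum_cst; field; by rewrite ?natr1 ?nat1r pnatr_eq0.
  apply: le_trans (avg_sqr _ _ _) _; rewrite ler_pdivrMr ?ltr0n // [leRHS]mulrC -(psum_cst _ N.+1).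
  apply: psum_le => s sN.
  have hn : h n = h (n %/ b * b)%N := hc n.
  have h1 : h (n + b)%N = h ((n %/ b + 1) * b)%N.
    by rewrite hc -{1}[b in (n + b)%N]mul1n divnDMl.
  have h2 : h (n + 2 * b)%N = h ((n %/ b + 2) * b)%N by rewrite hc divnDMl.
  have hs : h (s + n)%N = h ((n %/ b + (n %% b + s) %/ b) * b)%N.
    by rewrite hc addnC {1}(divn_eq n b) -addnA divnMDl.
  have [small|big] := ltnP (n %% b + s) b.
    rewrite hs (divn_small small) addn0 -hn subrr expr0n mulr_ge0 //.
    by rewrite !addr_ge0 // mulr_ge0 ?sqr_ge0 // /chi.
  have -> : chi n = 1 by rewrite /chi ind1 //; lia.
  rewrite !mul1r.
  have hcase : ((n %% b + s) %/ b = 1 \/ (n %% b + s) %/ b = 2)%N.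
    have h3 : (0 < (n %% b + s) %/ b)%N by rewrite divn_gt0.
    have h4 : ((n %% b + s) %/ b < 3)%N.
      by rewrite ltn_divLR //; have := ltn_pmod n b0; lia.
    lia.
  have := sqr_ge0 (h (s + n)%N + h n); have := sqr_ge0 (h n).
  have := sqr_ge0 (h (n + b)%N); have := sqr_ge0 (h (n + 2 * b)%N).
  by case: hcase => e; rewrite hs e -?h1 -?h2; nra.
apply: le_trans (psum_le (fun n _ => pw n)) _.
rewrite psumZ !psumD.
have chiS n k : chi (n + k * b)%N = chi n by rewrite /chi [(n + _)%N]addnC modnMDl.
have shift k : psum (fun n => chi n * h (n + k * b)%N ^+ 2) X <= psum (fun n => chi n * h n ^+ 2) X.
  under psum_eq => i _ do rewrite -(chiS i k).
  apply: (psum_shift_le (h := fun i => chi i * h i ^+ 2)) => [i|i Xi].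
    by rewrite mulr_ge0 ?sqr_ge0 // /chi.
  by rewrite hX // expr0n mulr0.
have := shift 1%N; have := shift 2%N; rewrite mul1n.
have : psum (fun n => chi n * h n ^+ 2) X <= psum (fun n => N%:R / b%:R * h n ^+ 2) X.
  apply: block_le => m'.
  rewrite (@psum_eq _ _ (fun i => h (m' * b)%N ^+ 2 * ind (b <= i + N)%N)); last first.
    by move=> i ib; rewrite chiS bconst_block // mulrC /chi modn_small.
  rewrite (@psum_eq _ (fun i => _ * h (i + m' * b)%N ^+ 2) (fun=> N%:R / b%:R * h (m' * b)%N ^+ 2)); last first.
    by move=> i ib; rewrite bconst_block.
  rewrite psumZ psum_cst.
  have -> : b%:R * (N%:R / b%:R * h (m' * b)%N ^+ 2) = h (m' * b)%N ^+ 2 * N%:R :> R.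
    by field; rewrite gt_eqF.
  by rewrite ler_wpM2l ?sqr_ge0 //; have := @count_tail R b N b; rewrite addKn.
rewrite psumZ; lra.
Qed.

(** * Summation over dyadic scales and signed squares *)

Definition scale (N : nat) : nat := trunc_log 2 N.+1.

Lemma scale_bounds N : (2 ^ scale N <= N.+1 < 2 ^ (scale N).+1)%N.
Proof. exact: trunc_log_bounds. Qed.

Lemma scale_eq k N : (2 ^ k <= N.+1 < 2 ^ k.+1)%N -> scale N = k.
Proof. exact: trunc_log_eq. Qed.

Lemma scale_le M N : (M <= N)%N -> (scale M <= scale N)%N.
Proof. by move=> MN; apply: leq_trunc_log. Qed.

Lemma scale_lt K N : (N.+1 < 2 ^ K)%N -> (scale N < K)%N.
Proof.
move=> h; have /andP[h1 _] := scale_bounds N.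
by rewrite -(ltn_exp2l _ _ (isT : 1 < 2)%N) (leq_ltn_trans h1 h).
Qed.

Lemma psum_dyadic (R : realType) (F : nat -> R) K :
  psum F (2 ^ K - 1) = psum (fun k => psum F (2 ^ k.+1 - 1) - psum F (2 ^ k - 1)) K.
Proof.
elim: K => [|K IH]; first by rewrite expn0 subnn !psum0.
by rewrite psumS -IH; ring.
Qed.

(** Scale k contains about 2^k steps inside the scale, each costing kap d(k) / 2^k, and a single
    step N = 2^(k+1) - 2 to the next scale, for which the cruder bound suffices. *)
Lemma scale_sum (R : realType) (F d : nat -> R) (kap : R) K M :
  0 <= kap -> (forall k, 0 <= d k) -> (forall N, 0 <= F N) ->
  (forall N, (N.+1 < 2 ^ K)%N -> scale N.+1 = scale N ->
     F N <= kap * d (scale N) / (2 ^ scale N)%:R) ->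
  (forall N, (N.+1 < 2 ^ K)%N -> F N <= 2 * kap * (d (scale N) + d (scale N.+1))) ->
  (M <= 2 ^ K - 1)%N -> psum F M <= 5 * kap * psum d K.+1.
Proof.
move=> kap0 d0 F0 hin hbd MK.
apply: (@le_trans _ _ (psum F (2 ^ K - 1))); first exact: psum_mono.
rewrite psum_dyadic.
apply: (@le_trans _ _ (psum (fun k => 3 * kap * d k + 2 * kap * d k.+1) K)); last first.
  rewrite psumD !psumZ.
  have e : psum (fun k => d k.+1) K = psum d K.+1 - d 0%N.
    have := psum_shift d 1 K; rewrite addn1 (psumS _ 0) psum0 add0r => <-.
    by apply: psum_eq => i _; rewrite addn1.
  have e2 : psum d K <= psum d K.+1 by rewrite psumS lerDl.
  rewrite e; have := d0 0%N; nra.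
apply: psum_le => k kK.
have p0 : (0 < 2 ^ k)%N by rewrite expn_gt0.
have kK' : (2 ^ k.+1 <= 2 ^ K)%N by rewrite leq_exp2l.
have e2 : (2 ^ k.+1 = 2 ^ k + 2 ^ k)%N by rewrite expnS; lia.
have -> : (2 ^ k.+1 - 1 = (2 ^ k.+1 - 2).+1)%N by lia.
rewrite psumS addrAC.
have s1 : scale (2 ^ k.+1 - 2) = k by apply: scale_eq; lia.
have s2 : scale (2 ^ k.+1 - 2).+1 = k.+1 by apply: scale_eq; rewrite (expnS 2 k.+1); lia.
have h1 : F (2 ^ k.+1 - 2)%N <= 2 * kap * (d k + d k.+1).
  by have := hbd (2 ^ k.+1 - 2)%N; rewrite s1 s2; apply; lia.
have h2 : psum F (2 ^ k.+1 - 2) - psum F (2 ^ k - 1) <= kap * d k.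
  apply: (@le_trans _ _ (psum (fun=> kap * d k / (2 ^ k)%:R) (2 ^ k.+1 - 2) -
     psum (fun=> kap * d k / (2 ^ k)%:R) (2 ^ k - 1))).
    apply: psum_leB; first lia.
    move=> N /andP[N1 N2].
    have sN : scale N = k by apply: scale_eq; lia.
    have sN' : scale N.+1 = k by apply: scale_eq; lia.
    by have := hin N; rewrite sN sN'; apply => //; lia.
  rewrite !psum_cst -mulrBl mulrA ler_pdivrMr ?ltr0n // mulrC.
  apply: ler_wpM2l; first by rewrite mulr_ge0.
  by rewrite -natrB; [rewrite ler_nat; lia|lia].
lra.
Qed.

(** Dominates the increment of the signed square a|a|. It is a product of an increment and a size,
    so l^2 bounds on both control its sum. *)
Definition jumpsq (R : realType) (a : nat -> R) (N : nat) : R :=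
  `|a N.+1 - a N| * (`|a N.+1| + `|a N|).

Lemma jumpsq_ge0 (R : realType) (a : nat -> R) N : 0 <= jumpsq a N.
Proof. by rewrite mulr_ge0 // addr_ge0. Qed.

(** The map x -> x|x| satisfies (x - y)^2 <= 2 |x|x| - y|y||, so the total variation of the signed
    square controls the 2-variation of a. *)
Lemma var_signed (R : realType) (a : nat -> R) i j : (i <= j)%N ->
  (a i - a j) ^+ 2 <= 2 * (psum (jumpsq a) j - psum (jumpsq a) i).
Proof.
have key (x y : R) : (x - y) ^+ 2 <= 2 * `|x * `|x| - y * `|y| | /\
    `|x * `|x| - y * `|y| | <= `|x - y| * (`|x| + `|y|).
  split.
    apply: (@le_trans _ _ (2 * ((x * `|x| - y * `|y|) * (if y <= x then 1 else -1)))).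
      have := sqr_ge0 (x + y); rewrite sqrrD sqrrB.
      by case: (lerP y x) => xy; case: (ger0P x) => x0; case: (ger0P y) => y0; nra.
    rewrite ler_wpM2l // (le_trans (ler_norm _)) // normrM.
    by case: ifP => _; rewrite ?normrN normr1 mulr1.
  rewrite ler_norml.
  by case: (ger0P x) => x0; case: (ger0P y) => y0; case: (ger0P (x - y)) => xy; apply/andP; split; nra.
move=> ij; have [h _] := key (a i) (a j); apply: le_trans h _; rewrite ler_wpM2l //.
apply: le_trans (abs_tel (fun n => a n * `|a n|) ij) _.
by apply: psum_leB => // N _; have [_] := key (a N.+1) (a N).
Qed.

(** Increments carry no decay in i, sizes carry (1/2)^i. Balancing the two would give 2^(-i/2); the
    rational ratio 3/4 is slightly larger and satisfies (1/2)/(3/4) <= 3/4. Inside a scale the cost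
    is (4 + 24) (3/4)^i d(k)/2^k, and 140 = 5 * 28 by [scale_sum]. *)
Lemma family_bound (R : realType) (v : nat -> nat -> R) (d : nat -> R) i K X M :
  (forall k, 0 <= d k) ->
  (forall N, (N.+1 < 2 ^ K)%N -> scale N.+1 = scale N ->
     psum (fun n => (v N.+1 n - v N n) ^+ 2) X <= 4 / (2 ^ scale N)%:R ^+ 2 * d (scale N)) ->
  (forall N, (N < 2 ^ K)%N ->
     psum (fun n => v N n ^+ 2) X <= 24 * (1 / 2) ^+ i * d (scale N)) ->
  (M <= 2 ^ K - 1)%N ->
  psum (fun n => psum (jumpsq (v^~ n)) M) X <= 140 * (3 / 4) ^+ i * psum d K.+1.
Proof.
move=> d0 hD hv MK; rewrite psum_exch.
have r0 : 0 < (3 / 4 : R) ^+ i by apply: exprn_gt0; lra.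
have h12 : (1 / 2 : R) ^+ i <= (3 / 4) ^+ i by apply: lerXn2r; rewrite ?nnegrE; lra.
have -> : 140 * (3 / 4) ^+ i = 5 * (28 * (3 / 4) ^+ i) :> R by ring.
apply: scale_sum => //.
- by move=> N; apply: psum_ge0 => n _; exact: (jumpsq_ge0 (v^~ n)).
- move=> N NK sN; set k := scale N.
  have p0 : 0 < (2 ^ k)%:R :> R by rewrite ltr0n expn_gt0.
  (* The weight of the arithmetic-geometric inequality: 2^k equalizes increments and sizes in k, and
     (3/4)^i shares the decay between them. *)
  pose eta : R := (2 ^ k)%:R * (3 / 4) ^+ i.
  have eta0 : 0 < eta by rewrite mulr_gt0.
  apply: (@le_trans _ _ (psum (fun n => eta * (v N.+1 n - v N n) ^+ 2 +
      (2 * eta)^-1 * (v N.+1 n ^+ 2 + v N n ^+ 2)) X)).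
    apply: psum_le => n _; rewrite /jumpsq -(real_normK (num_real (v N.+1 n - v N n))).
    rewrite -(real_normK (num_real (v N.+1 n))) -(real_normK (num_real (v N n))).
    move: `|_ - _| `|v N.+1 n| `|v N n| => D x y.
    have -> : eta * D ^+ 2 + (2 * eta)^-1 * (x ^+ 2 + y ^+ 2) =
       D * (x + y) + (2 * eta)^-1 * ((eta * D - x) ^+ 2 + (eta * D - y) ^+ 2).
      by field; rewrite gt_eqF.
    by rewrite lerDl mulr_ge0 ?addr_ge0 ?sqr_ge0 // invr_ge0 mulr_ge0 // ltW.
  rewrite psumD !psumZ psumD.
  have a1 := hD N NK sN; rewrite -/k in a1.
  have a2 := hv N (ltnW NK); rewrite -/k in a2.
  have a3 := hv N.+1 NK; rewrite sN -/k in a3.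
  have ie0 : 0 <= (2 * eta)^-1 by rewrite invr_ge0 mulr_ge0 // ltW.
  apply: (@le_trans _ _ (eta * (4 / (2 ^ k)%:R ^+ 2 * d k) +
     (2 * eta)^-1 * (24 * (1 / 2) ^+ i * d k + 24 * (1 / 2) ^+ i * d k))).
    by apply: lerD; apply: ler_wpM2l => //; [exact: ltW|exact: lerD].
  have -> : (2 * eta)^-1 * (24 * (1 / 2) ^+ i * d k + 24 * (1 / 2) ^+ i * d k)
      = 24 * (2 / 3) ^+ i * (d k / (2 ^ k)%:R).
    rewrite /eta; have -> : (1 / 2 : R) ^+ i = (3 / 4) ^+ i * (2 / 3) ^+ i.
      by rewrite -exprMn; congr (_ ^+ _); field.
    by field; rewrite !gt_eqF.
  have -> : eta * (4 / (2 ^ k)%:R ^+ 2 * d k) = 4 * (3 / 4) ^+ i * (d k / (2 ^ k)%:R).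
    by rewrite /eta; field; rewrite gt_eqF.
  rewrite -mulrDl -mulrA; apply: ler_wpM2r; first by rewrite divr_ge0 // ltW.
  have : (2 / 3 : R) ^+ i <= (3 / 4) ^+ i by apply: lerXn2r; rewrite ?nnegrE; lra.
  lra.
- move=> N NK.
  apply: (@le_trans _ _ (psum (fun n => 2 * (v N.+1 n ^+ 2 + v N n ^+ 2)) X)).
    apply: psum_le => n _; rewrite /jumpsq.
    have := ler_normB (v N.+1 n) (v N n); have := normr_ge0 (v N.+1 n - v N n).
    rewrite -(real_normK (num_real (v N.+1 n))) -(real_normK (num_real (v N n))).
    move: `|_ - _| `|v N.+1 n| `|v N n| (normr_ge0 (v N.+1 n)) (normr_ge0 (v N n)) => D x y x0 y0 D0 hD'.
    by have := sqr_ge0 (x - y); nra.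
  rewrite psumZ psumD; have a2 := hv N (ltnW NK); have a3 := hv N.+1 NK.
  apply: (@le_trans _ _ (2 * (24 * (1 / 2) ^+ i * d (scale N.+1) + 24 * (1 / 2) ^+ i * d (scale N)))).
    by rewrite ler_wpM2l // lerD.
  have := d0 (scale N); have := d0 (scale N.+1); nra.
Qed.

(** * Conditional expectations on dyadic blocks and their martingale differences *)

Definition dyad (R : realType) (k : nat) (g : nat -> R) (n : nat) : R :=
  (psum g ((n %/ 2 ^ k).+1 * 2 ^ k) - psum g (n %/ 2 ^ k * 2 ^ k)) / (2 ^ k)%:R.

Lemma pow2_gt0 k : (0 < 2 ^ k)%N.
Proof. by rewrite expn_gt0. Qed.

Lemma pow2R_gt0 (R : realType) k : 0 < (2 ^ k)%:R :> R.
Proof. by rewrite ltr0n pow2_gt0. Qed.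

Lemma dyad_bconst (R : realType) k (g : nat -> R) : bconst (2 ^ k) (dyad k g).
Proof. by move=> n; rewrite /dyad mulnK ?pow2_gt0. Qed.

Lemma bconst_coarse (R : realType) i j (h : nat -> R) : (i <= j)%N ->
  bconst (2 ^ j) h -> bconst (2 ^ i) h.
Proof.
move=> ij hj n; rewrite hj [RHS]hj; congr h; congr (_ * _)%N.
by rewrite -(subnKC ij) expnD !divnMA mulnK ?pow2_gt0.
Qed.

Lemma dyad_block (R : realType) k (g : nat -> R) m :
  dyad k g (m * 2 ^ k) = (psum g (m.+1 * 2 ^ k) - psum g (m * 2 ^ k)) / (2 ^ k)%:R.
Proof. by rewrite /dyad mulnK ?pow2_gt0. Qed.

Lemma dyad_sum (R : realType) k (g : nat -> R) m :
  psum (dyad k g) (m * 2 ^ k) = psum g (m * 2 ^ k).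
Proof.
elim: m => [|m IH]; first by rewrite mul0n !psum0.
have := psum_block (dyad k g) (2 ^ k) m.
rewrite (@psum_eq _ (fun i => dyad k g (i + m * 2 ^ k)) (fun=> dyad k g (m * 2 ^ k))); last first.
  by move=> i ib; rewrite (bconst_block _ (dyad_bconst k g)).
rewrite psum_cst dyad_block mulrC divfK ?gt_eqF ?pow2R_gt0 // IH.
lra.
Qed.

Lemma dyad0 (R : realType) (g : nat -> R) n : dyad 0 g n = g n.
Proof. by rewrite /dyad expn0 divn1 !muln1 psumS divr1 addrC addKr. Qed.

Lemma dyad_supp (R : realType) (g : nat -> R) k K n : (k <= K)%N ->
  (forall i, (2 ^ K <= i)%N -> g i = 0) -> (2 ^ K <= n)%N -> dyad k g n = 0.
Proof.
move=> kK gK nK; have h : (2 ^ K <= n %/ 2 ^ k * 2 ^ k)%N.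
  rewrite -{1}(subnK kK) expnD leq_mul2r; apply/orP; right.
  by rewrite leq_divRL ?pow2_gt0 // -expnD subnK.
have h2 : (2 ^ K <= (n %/ 2 ^ k).+1 * 2 ^ k)%N.
  by rewrite (leq_trans h) // leq_mul2r leqnSn orbT.
by rewrite /dyad (psum_supp gK h) (psum_supp gK h2) subrr mul0r.
Qed.

Lemma dyad_bounds (R : realType) (g : nat -> R) lam k n :
  (forall t, 0 <= g t <= lam) -> 0 <= dyad k g n <= lam.
Proof.
move=> hg; rewrite /dyad psum_block.
rewrite divr_ge0 ?(ltW (pow2R_gt0 _ _)) ?psum_ge0 //=; last by move=> i _; case/andP: (hg (i + n %/ 2 ^ k * 2 ^ k)%N).
rewrite ler_pdivrMr ?pow2R_gt0 // mulrC -psum_cst; apply: psum_le => i _.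
by case/andP: (hg (i + n %/ 2 ^ k * 2 ^ k)%N).
Qed.

Lemma avg_bounds (R : realType) (g : nat -> R) lam n N :
  (forall t, 0 <= g t <= lam) -> 0 <= avg g n N <= lam.
Proof.
move=> hg; rewrite avg_psum divr_ge0 ?psum_ge0 //=; last by move=> i _; case/andP: (hg (i + n)%N).
rewrite ler_pdivrMr ?ltr0n // mulrC -psum_cst; apply: psum_le => i _.
by case/andP: (hg (i + n)%N).
Qed.

(* Martingale differences of the dyadic filtration, coarsest average last. *)
Definition mdiff (R : realType) (K : nat) (g : nat -> R) (j n : nat) : R :=
  if (j < K)%N then dyad j g n - dyad j.+1 g n
  else if j == K then dyad K g n else 0.

Lemma mdiff_bconst (R : realType) K (g : nat -> R) j : bconst (2 ^ j) (mdiff K g j).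
Proof.
move=> n; rewrite /mdiff; case: ifP => _.
  rewrite -(dyad_bconst j g n); congr (_ - _).
  exact: (bconst_coarse (leqnSn j) (dyad_bconst j.+1 g)).
by case: eqP => // <-; exact: dyad_bconst.
Qed.

Lemma mdiff_bzero (R : realType) K (g : nat -> R) j : (j < K)%N ->
  bzero (2 ^ j.+1) (mdiff K g j).
Proof.
move=> jK m; rewrite /mdiff jK psumB dyad_sum.
by rewrite expnS mulnA dyad_sum subrr.
Qed.

Lemma mdiff_supp (R : realType) K (g : nat -> R) j :
  (forall i, (2 ^ K <= i)%N -> g i = 0) ->
  forall n, (2 ^ K <= n)%N -> mdiff K g j n = 0.
Proof.
move=> gK n nK; rewrite /mdiff; case: ifP => jK.
  by rewrite !(@dyad_supp _ g _ K) ?subrr // ltnW.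
by case: eqP => // _; rewrite (@dyad_supp _ g _ K).
Qed.

Lemma mdiff_sum (R : realType) K (g : nat -> R) n k : (k <= K)%N ->
  psum (fun j => mdiff K g j n) k = g n - dyad k g n.
Proof.
elim: k => [|k IH] kK; first by rewrite psum0 dyad0 subrr.
by rewrite psumS IH ?(ltnW kK) // /mdiff kK; ring.
Qed.

Lemma mdiff_tail (R : realType) K (g : nat -> R) n k : (k <= K)%N ->
  psum (fun i => mdiff K g (i + k)%N n) K.+1 = dyad k g n.
Proof.
move=> kK; rewrite (psum_shift (fun j => mdiff K g j n)) (mdiff_sum g n kK).
rewrite (@psum_supp _ _ K.+1) ?leq_addr //; last first.
  by move=> i iK; rewrite /mdiff ltnNge (ltnW iK) /= gtn_eqF.
by rewrite psumS mdiff_sum // /mdiff ltnn eqxx; ring.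
Qed.

(** Pythagoras one level at a time: the coarser average is constant, and the difference has sum
    zero, on blocks of length 2^(k+1), which tile the whole range. *)
Lemma mdiff_energy (R : realType) K (g : nat -> R) :
  psum (fun j => psum (fun n => mdiff K g j n ^+ 2) (2 ^ K)) K.+1 =
  psum (fun n => g n ^+ 2) (2 ^ K).
Proof.
have step k : (k <= K)%N ->
    psum (fun j => psum (fun n => mdiff K g j n ^+ 2) (2 ^ K)) k
    + psum (fun n => dyad k g n ^+ 2) (2 ^ K) = psum (fun n => g n ^+ 2) (2 ^ K).
  elim: k => [|k IH] kK.
    by rewrite psum0 add0r; apply: psum_eq => n _; rewrite dyad0.
  rewrite psumS -(IH (ltnW kK)) -addrA; congr (_ + _).
  have h : bzero (2 ^ k.+1) (fun n => dyad k.+1 g n * mdiff K g k n).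
    exact: bconst_bzero (dyad_bconst _ _) (mdiff_bzero _ kK).
  have := h (2 ^ (K - k.+1))%N; rewrite -expnD subnK // => h0.
  rewrite -psumD -[RHS]addr0 -[X in _ + X](mulr0 (-2)) -[X in _ = _ + _ * X]h0 -psumZ -psumD.
  by apply: psum_eq => n _; rewrite /mdiff kK; ring.
rewrite psumS -(step K (leqnn K)); congr (_ + _).
by apply: psum_eq => n _; rewrite /mdiff ltnn eqxx.
Qed.

Lemma psum_rev (R : realType) (F : nat -> R) k :
  psum (fun i => F (k - 1 - i)%N) k = psum F k.
Proof.
rewrite /psum (reindex_inj rev_ord_inj) /=; apply: eq_bigr => i _; congr F.
by have := ltn_ord i; lia.
Qed.

Lemma psum_geo (R : realType) (x : R) K : 0 <= x -> x < 1 ->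
  psum (fun i => x ^+ i) K <= (1 - x)^-1.
Proof.
move=> x0 x1; have y0 : 0 < 1 - x by lra.
have -> : psum (fun i => x ^+ i) K = (1 - x ^+ K) / (1 - x).
  elim: K => [|K IH]; first by rewrite psum0 expr0 subrr mul0r.
  by rewrite psumS IH exprSr; field; rewrite gt_eqF.
by rewrite ler_pdivrMr // mulVf ?gt_eqF // gerBl exprn_ge0.
Qed.

(** The index i is the gap between the martingale level and the scale of the average, so for fixed i
    the level moves with N. Differences finer than the scale enter through cancellation; for those
    at least as coarse, [vcoarse] takes the deviation of the average from the value at n. *)
Definition vfine (R : realType) K (g : nat -> R) (i N n : nat) : R :=
  if (i < scale N)%N then avg (mdiff K g (scale N - 1 - i)) n N else 0.

Definition vcoarse (R : realType) K (g : nat -> R) (i N n : nat) : R :=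
  avg (mdiff K g (i + scale N)) n N - mdiff K g (i + scale N) n.

Lemma avgB (R : realType) (f g : nat -> R) n N :
  avg (fun i => f i - g i) n N = avg f n N - avg g n N.
Proof. by rewrite !avg_psum psumB mulrBl. Qed.

Lemma avg_sum (R : realType) (F : nat -> nat -> R) n N k :
  avg (fun t => psum (F t) k) n N = psum (fun j => avg (F^~ j) n N) k.
Proof.
rewrite avg_psum psum_exch mulrC -psumZ; apply: psum_eq => j _.
by rewrite avg_psum mulrC.
Qed.

Lemma avg_eq (R : realType) (f g : nat -> R) n N : (forall i, f i = g i) ->
  avg f n N = avg g n N.
Proof. by move=> fg; rewrite !avg_psum; congr (_ / _); apply: psum_eq. Qed.

(** The average of the dyadic average is inserted in the middle: levels below the scale give the
    first difference, levels from the scale on give the second. *)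
Lemma avg_decomp (R : realType) K (g : nat -> R) n N : (N < 2 ^ K)%N ->
  avg g n N - dyad (scale N) g n =
  psum (fun i => vfine K g i N n) K + psum (fun i => vcoarse K g i N n) K.+1.
Proof.
move=> NK; set k := scale N.
have kK : (k <= K)%N by rewrite -ltnS scale_lt // expnS; lia.
have e1 : psum (fun i => vfine K g i N n) K = avg g n N - avg (dyad k g) n N.
  rewrite (@psum_supp _ _ k) //; last by move=> i ki; rewrite /vfine -/k ltnNge ki.
  rewrite (@psum_eq _ _ (fun i => avg (mdiff K g (k - 1 - i)) n N)); last first.
    by move=> i ik; rewrite /vfine -/k ik.
  rewrite (psum_rev (fun j => avg (mdiff K g j) n N)) -avg_sum -avgB.
  by apply: avg_eq => i; rewrite mdiff_sum.
have e2 : psum (fun i => vcoarse K g i N n) K.+1 = avg (dyad k g) n N - dyad k g n.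
  rewrite psumB mdiff_tail // -(avg_sum (fun t i => mdiff K g (i + k)%N t)).
  by congr (_ - _); apply: avg_eq => i; rewrite mdiff_tail.
by rewrite e1 e2 -/k; ring.
Qed.

Definition l2 (R : realType) (X : nat) (h : nat -> R) : R := psum (fun n => h n ^+ 2) X.

Lemma l2_ge0 (R : realType) X (h : nat -> R) : 0 <= l2 X h.
Proof. by apply: psum_ge0 => n _; exact: sqr_ge0. Qed.

Lemma davg_scale (R : realType) (h : nat -> R) X N :
  (forall i, (X <= i)%N -> h i = 0) ->
  psum (fun n => (avg h n N.+1 - avg h n N) ^+ 2) X <=
  4 / (2 ^ scale N)%:R ^+ 2 * l2 X h.
Proof.
move=> hX; apply: le_trans (davg_l2 N hX) _; apply: ler_wpM2r; first exact: l2_ge0.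
have /andP[h1 _] := scale_bounds N; have p0 := pow2R_gt0 R (scale N).
rewrite ler_wpM2l // lef_pV2 ?posrE ?exprn_gt0 //.
apply: lerXn2r; rewrite ?nnegrE ?ler0n // ler_nat.
exact: leq_trans (leqnSn _).
Qed.

Lemma fine_family (R : realType) K (g : nat -> R) i M :
  (forall t, (2 ^ K <= t)%N -> g t = 0) -> (M <= 2 ^ K - 1)%N ->
  psum (fun n => psum (jumpsq (fun N => vfine K g i N n)) M) (2 ^ K) <=
  140 * (3 / 4) ^+ i * l2 (2 ^ K) g.
Proof.
move=> gK MK; set X := (2 ^ K)%N.
pose e j := l2 X (mdiff K g j).
(* Energy of the level seen from scale k with gap i. For fixed i distinct scales see distinct
   levels, so the sum over k is at most the total energy. *)
pose d k := if (i < k)%N then e (k - 1 - i)%N else 0.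
have d0 k : 0 <= d k by rewrite /d; case: ifP => // _; exact: l2_ge0.
have hs j := mdiff_supp j gK.
have dsum t : psum d t = psum e (t - i.+1).
  elim: t => [|t IH]; first by rewrite !psum0.
  rewrite psumS IH /d; case: ltnP => it; last by rewrite addr0; congr psum; lia.
  have -> : (t.+1 - i.+1 = (t - i.+1).+1)%N by lia.
  by rewrite psumS; congr (_ + e _); lia.
apply: (@le_trans _ _ (140 * (3 / 4) ^+ i * psum d K.+1)).
  apply: family_bound => //.
  - move=> N NK sN; rewrite /d /vfine sN; case: ltnP => ik.
      by apply: davg_scale; exact: hs.
    rewrite mulr0 (@psum_eq _ _ (fun=> 0)) ?psum_cst ?mulr0 // => n _.
    by rewrite subrr expr0n.
  - move=> N NK; rewrite /d /vfine; set k := scale N; case: ltnP => ik; last first.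
      rewrite mulr0 (@psum_eq _ _ (fun=> 0)) ?psum_cst ?mulr0 // => n _.
      by rewrite expr0n.
    have kK : (k <= K)%N by rewrite -ltnS scale_lt // expnS; lia.
    have jK : (k - 1 - i < K)%N by lia.
    have eX : (2 ^ (K - (k - 1 - i).+1) * 2 ^ (k - 1 - i).+1 = X)%N by rewrite -expnD subnK.
    have := @fine_l2 R (mdiff K g (k - 1 - i)) (2 ^ (k - 1 - i).+1) (2 ^ (K - (k - 1 - i).+1)) N.
    rewrite eX => /(_ (mdiff_bzero g jK) (hs _)) h; apply: le_trans h _.
    apply: ler_wpM2r; first exact: l2_ge0.
    have /andP[h1 _] := scale_bounds N; rewrite -/k in h1.
    have hx : (2 ^ (k - 1 - i).+1)%:R / N.+1%:R <= (1 / 2 : R) ^+ i.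
      rewrite ler_pdivrMr ?ltr0n // expr_div_n expr1n mul1r -natrX ler_pdivlMl ?pow2R_gt0 //.
      rewrite -natrM ler_nat -expnD; have -> : (i + (k - 1 - i).+1 = k)%N by lia.
      exact: h1.
    have x0 : 0 <= (2 ^ (k - 1 - i).+1)%:R / N.+1%:R :> R by rewrite divr_ge0.
    have x1 : (1 / 2 : R) ^+ i <= 1 by apply: exprn_ile1; lra.
    move: hx x0 x1; move: (_ / _ : R) ((1 / 2) ^+ i) => x y; nra.
apply: ler_wpM2l; first by rewrite mulr_ge0 // exprn_ge0 //; lra.
rewrite dsum /l2 -mdiff_energy; apply: psum_mono => [|j _]; first by rewrite leq_subr.
exact: l2_ge0.
Qed.

Lemma coarse_family (R : realType) K (g : nat -> R) i M :
  (forall t, (2 ^ K <= t)%N -> g t = 0) -> (M <= 2 ^ K - 1)%N ->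
  psum (fun n => psum (jumpsq (fun N => vcoarse K g i N n)) M) (2 ^ K) <=
  140 * (3 / 4) ^+ i * l2 (2 ^ K) g.
Proof.
move=> gK MK; set X := (2 ^ K)%N.
pose e j := l2 X (mdiff K g j).
pose d k := e (k + i)%N.
have hs j := mdiff_supp j gK.
have d0 k : 0 <= d k by exact: l2_ge0.
apply: (@le_trans _ _ (140 * (3 / 4) ^+ i * psum d K.+1)).
  apply: family_bound => //.
  - move=> N NK sN; rewrite /d [(scale N + i)%N]addnC; apply: le_trans (davg_scale N (hs (i + scale N)%N)).
    by apply: psum_le => n _; rewrite /vcoarse sN le_eqVlt; apply/orP; left; apply/eqP; ring.
  - move=> N NK; rewrite /d /vcoarse [(scale N + i)%N]addnC; set k := scale N.
    case: (ltnP K (i + k)) => ik.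
      have z n : mdiff K g (i + k) n = 0 by rewrite /mdiff ltnNge (ltnW ik) /= gtn_eqF.
      rewrite (@psum_eq _ _ (fun=> 0)); last first.
        by move=> n _; rewrite (@avg_eq _ _ (fun=> 0) n N z) avg_psum psum_cst mulr0 mul0r z subrr expr0n.
      rewrite psum_cst mulr0 mulr_ge0 ?l2_ge0 // mulr_ge0 // exprn_ge0 //; lra.
    have eX : (2 ^ (K - (i + k)) * 2 ^ (i + k) = X)%N by rewrite -expnD subnK.
    have /andP[h1 h2] := scale_bounds N; rewrite -/k in h1 h2.
    have N2 : (N.+1 < 2 * 2 ^ (i + k))%N.
      by apply: leq_trans h2 _; rewrite -expnS leq_exp2l //; lia.
    have := @coarse_l2 R (mdiff K g (i + k)) (2 ^ (i + k)) (2 ^ (K - (i + k))) N.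
    rewrite eX => /(_ (pow2_gt0 _) (mdiff_bconst _ _ _) (ltnW N2) (hs _)) h; apply: le_trans h _.
    apply: ler_wpM2r; first exact: l2_ge0.
    have hx : N%:R / (2 ^ (i + k))%:R <= 2 * (1 / 2 : R) ^+ i.
      rewrite expnD natrM ler_pdivrMr ?mulr_gt0 ?pow2R_gt0 // expr_div_n expr1n mul1r -natrX.
      have -> : 2 * (2 ^ i)%:R^-1 * ((2 ^ i)%:R * (2 ^ k)%:R) = (2 ^ k.+1)%:R :> R.
        by rewrite expnS natrM; field; rewrite gt_eqF ?pow2R_gt0.
      by rewrite ler_nat; lia.
    move: hx; move: (_ / _ : R) ((1 / 2) ^+ i) => x y; lra.
apply: ler_wpM2l; first by rewrite mulr_ge0 // exprn_ge0 //; lra.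
rewrite /l2 -mdiff_energy; apply: psum_shift_le => [j|j Kj]; first exact: l2_ge0.
rewrite /e /l2 (@psum_eq _ _ (fun=> 0)) ?psum_cst ?mulr0 // => n _.
by rewrite /mdiff ltnNge (ltnW Kj) /= gtn_eqF // expr0n.
Qed.

(** The weights (8/7)^i pay for Cauchy-Schwarz in i, with the sum of (7/8)^i at most 8, and
    (8/7)(3/4) = 6/7 remains summable. The factor 32 is 8 from that sum, 2 from [var_signed] and 2
    from adding the two families. *)
Definition sqweight (R : realType) K (g : nat -> R) (n N : nat) : R :=
  32 * (psum (fun i => (8 / 7) ^+ i * jumpsq (fun N => vfine K g i N n) N) K +
        psum (fun i => (8 / 7) ^+ i * jumpsq (fun N => vcoarse K g i N n) N) K.+1).

Lemma sqweight_ge0 (R : realType) K (g : nat -> R) n N : 0 <= sqweight K g n N.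
Proof.
have p i : 0 <= (8 / 7 : R) ^+ i by apply: exprn_ge0; lra.
by rewrite mulr_ge0 // addr_ge0 // psum_ge0 // => i _; rewrite mulr_ge0 // jumpsq_ge0.
Qed.

Lemma sum_var (R : realType) (v : nat -> nat -> R) K N N' : (N <= N')%N ->
  (psum (v^~ N) K - psum (v^~ N') K) ^+ 2 <=
  16 * (psum (fun m => psum (fun i => (8 / 7) ^+ i * jumpsq (v i) m) K) N' -
        psum (fun m => psum (fun i => (8 / 7) ^+ i * jumpsq (v i) m) K) N).
Proof.
move=> NN; rewrite -psumB.
have c0 i : 0 < (7 / 8 : R) ^+ i by apply: exprn_gt0; lra.
apply: le_trans (@psum_wsqr R (fun i => (7 / 8) ^+ i) _ K c0) _.
rewrite !(psum_exch (fun m i => (8 / 7) ^+ i * jumpsq (v i) m)) -psumB.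
have -> : 16 = 8 * 2 :> R by ring.
rewrite -mulrA; apply: ler_pM.
- by apply: psum_ge0 => i _; exact: ltW.
- by apply: psum_ge0 => i _; rewrite divr_ge0 ?sqr_ge0 // ltW.
- have h := @psum_geo R (7 / 8) K; apply: (le_trans (h _ _)); [lra|lra|].
  by have -> : (1 - 7 / 8 : R)^-1 = 8 by field.
rewrite -psumZ; apply: psum_le => i _.
rewrite !psumZ -mulrBr mulrCA.
have -> : (7 / 8 : R) ^+ i = ((8 / 7) ^+ i)^-1 by rewrite -exprVn invf_div.
rewrite invrK mulrC; apply: ler_wpM2l; first by apply: exprn_ge0; lra.
exact: var_signed.
Qed.

Lemma sq_pointwise (R : realType) K (g : nat -> R) n N N' :
  (N <= N')%N -> (N' < 2 ^ K)%N ->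
  ((avg g n N - dyad (scale N) g n) - (avg g n N' - dyad (scale N') g n)) ^+ 2
  <= psum (sqweight K g n) N' - psum (sqweight K g n) N.
Proof.
move=> NN NK; rewrite !(@avg_decomp _ K) ?(leq_ltn_trans NN) //.
have eW m : psum (sqweight K g n) m = 32 *
   (psum (fun m => psum (fun i => (8 / 7) ^+ i * jumpsq (fun N => vfine K g i N n) m) K) m +
    psum (fun m => psum (fun i => (8 / 7) ^+ i * jumpsq (fun N => vcoarse K g i N n) m) K.+1) m).
  by rewrite psumZ psumD.
rewrite !eW.
have h1 := @sum_var R (fun i N => vfine K g i N n) K N N' NN.
have h2 := @sum_var R (fun i N => vcoarse K g i N n) K.+1 N N' NN.
have key (a b c d x y z t : R) : (a - b) ^+ 2 <= 16 * (x - y) ->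
    (c - d) ^+ 2 <= 16 * (z - t) -> (a + c - (b + d)) ^+ 2 <= 32 * (x + z) - 32 * (y + t).
  by move=> k1 k2; have := sqr_ge0 ((a - b) - (c - d)); nra.
exact: key h1 h2.
Qed.

(** Here 980 = 140 * 7, where 7 is the sum of the powers of 6/7, and 64 = 32 * 2 for the two
    families. *)
Lemma sq_total (R : realType) K (g : nat -> R) M :
  (forall t, (2 ^ K <= t)%N -> g t = 0) -> (M <= 2 ^ K - 1)%N ->
  psum (fun n => psum (sqweight K g n) M) (2 ^ K) <= 64 * 980 * l2 (2 ^ K) g.
Proof.
move=> gK MK.
have E0 := l2_ge0 (2 ^ K) g.
have tot (v : nat -> nat -> nat -> R) k :
   (forall i, psum (fun n => psum (jumpsq (fun N => v i N n)) M) (2 ^ K) <=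
      140 * (3 / 4) ^+ i * l2 (2 ^ K) g) ->
   psum (fun n => psum (fun N => psum (fun i => (8 / 7) ^+ i * jumpsq (fun N => v i N n) N) k) M) (2 ^ K)
   <= 980 * l2 (2 ^ K) g.
  move=> hv.
  rewrite (@psum_eq _ _ (fun n => psum (fun i => (8 / 7) ^+ i * psum (jumpsq (fun N => v i N n)) M) k)); last first.
    by move=> n _; rewrite psum_exch; apply: psum_eq => i _; rewrite psumZ.
  rewrite psum_exch.
  apply: (@le_trans _ _ (psum (fun i => 140 * l2 (2 ^ K) g * (6 / 7) ^+ i) k)).
    apply: psum_le => i _; rewrite psumZ.
    have -> : (6 / 7 : R) ^+ i = (8 / 7) ^+ i * (3 / 4) ^+ i.
      by rewrite -exprMn; congr (_ ^+ _); field.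
    have p : 0 <= (8 / 7 : R) ^+ i by apply: exprn_ge0; lra.
    have := ler_wpM2l p (hv i); lra.
  rewrite psumZ.
  have := @psum_geo R (6 / 7) k; move=> /(_ ltac:(lra) ltac:(lra)).
  have -> : (1 - 6 / 7 : R)^-1 = 7 by field.
  nra.
rewrite (@psum_eq _ _ (fun n =>
  32 * (psum (fun N => psum (fun i => (8 / 7) ^+ i * jumpsq (fun N => vfine K g i N n) N) K) M +
   psum (fun N => psum (fun i => (8 / 7) ^+ i * jumpsq (fun N => vcoarse K g i N n) N) K.+1) M))); last first.
  by move=> n _; rewrite psumZ psumD.
rewrite psumZ psumD.
have := tot (vfine K g) K (fun i => fine_family i gK MK).
have := tot (vcoarse K g) K.+1 (fun i => coarse_family i gK MK).
move: (psum _ _) (psum _ _) => a b; lra.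
Qed.

(** * Variation of dyadic averages and the unweighted weak type bound *)

(* Greedy jump times of the reversed martingale [k |-> dyad k g n], read from
   scale [K] down to scale 0; [jref] is the value at the last jump. *)
Fixpoint jref (R : realType) (g : nat -> R) (eta : R) (K n t : nat) : R :=
  if t is t'.+1 then
    if eta <= `|dyad (K - t') g n - jref g eta K n t'| then dyad (K - t') g n
    else jref g eta K n t'
  else 0.

Definition jump (R : realType) (g : nat -> R) (eta : R) (K n l : nat) : R :=
  (eta <= `|dyad l g n - jref g eta K n (K - l)|)%R%:R.

(** The same greedy count, below level k and with the current reference value as an argument. The
    energy bound is proved by induction over scales and needs an arbitrary reference on each
    block. *)
Fixpoint jcount (R : realType) (g : nat -> R) (eta : R) (k n : nat) (c : R) : R :=
  if k is k'.+1 then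
    if eta <= `|dyad k' g n - c| then 1 + jcount g eta k' n (dyad k' g n)
    else jcount g eta k' n c
  else 0.

Lemma jump_ge0 (R : realType) (g : nat -> R) eta K n l : 0 <= jump g eta K n l.
Proof. exact: ler0n. Qed.

Lemma jcount_jump (R : realType) (g : nat -> R) eta K n k : (k <= K.+1)%N ->
  psum (jump g eta K n) k = jcount g eta k n (jref g eta K n (K.+1 - k)).
Proof.
elim: k => [|k IH] kK; first by rewrite psum0.
rewrite psumS IH ?(ltnW kK) // /jump /=.
have -> : (K.+1 - k = (K - k).+1)%N by rewrite subSn.
rewrite subSS /=; have -> : (K - (K - k) = k)%N by rewrite subKn.
by case: ifP => _; rewrite ?addr0 // addrC.
Qed.

(** At a jump on a block of length 2^k the reference c is replaced by the block average a, and the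
    sum of (g - c)^2 drops by 2^k (a - c)^2 >= 2^k eta^2, one eta^2 for each point at which the jump
    is counted. *)
Lemma jcount_energy (R : realType) (g : nat -> R) eta k m c : 0 <= eta ->
  eta ^+ 2 * (psum (fun n => jcount g eta k n c) (m.+1 * 2 ^ k) -
              psum (fun n => jcount g eta k n c) (m * 2 ^ k)) <=
  psum (fun n => (g n - c) ^+ 2) (m.+1 * 2 ^ k) -
  psum (fun n => (g n - c) ^+ 2) (m * 2 ^ k).
Proof.
move=> eta0; elim: k m c => [|k IH] m c.
  rewrite /= !psum_cst !mulr0 subrr mulr0 subr_ge0; apply: psum_mono => [|i _].
    by rewrite leq_mul2r leqnSn orbT.
  exact: sqr_ge0.
have child m' : eta ^+ 2 * (psum (fun n => jcount g eta k.+1 n c) (m'.+1 * 2 ^ k) -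
              psum (fun n => jcount g eta k.+1 n c) (m' * 2 ^ k)) <=
  psum (fun n => (g n - c) ^+ 2) (m'.+1 * 2 ^ k) -
  psum (fun n => (g n - c) ^+ 2) (m' * 2 ^ k).
  set a := dyad k g (m' * 2 ^ k)%N.
  have ea i : (i < 2 ^ k)%N -> dyad k g (i + m' * 2 ^ k) = a.
    by move=> ik; rewrite (bconst_block _ (dyad_bconst k g) ik).
  have := IH m' c; have := IH m' a; rewrite !psum_block => IHa IHc.
  case: (boolP (eta <= `|a - c|)) => big; last first.
    rewrite (@psum_eq _ _ (fun i => jcount g eta k (i + m' * 2 ^ k) c)) // => i ik.
    by rewrite /= ea // (negbTE big).
  rewrite (@psum_eq _ _ (fun i => 1 + jcount g eta k (i + m' * 2 ^ k) a)); last first.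
    by move=> i ik; rewrite /= ea // big.
  have e1 : psum (fun i => (g (i + m' * 2 ^ k)%N - c) ^+ 2) (2 ^ k) =
      psum (fun i => (g (i + m' * 2 ^ k)%N - a) ^+ 2) (2 ^ k) + (2 ^ k)%:R * (a - c) ^+ 2.
    have e2 : psum (fun i => g (i + m' * 2 ^ k)%N) (2 ^ k) = (2 ^ k)%:R * a.
      by rewrite /a dyad_block -psum_block mulrC divfK // gt_eqF ?pow2R_gt0.
    have -> : psum (fun i => (g (i + m' * 2 ^ k)%N - c) ^+ 2) (2 ^ k) =
       psum (fun i => (g (i + m' * 2 ^ k)%N - a) ^+ 2 + (2 * (a - c) * g (i + m' * 2 ^ k)%N
         + (c ^+ 2 - a ^+ 2))) (2 ^ k) by apply: psum_eq => i _; ring.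
    rewrite psumD; congr (_ + _); rewrite psumD psumZ e2 psum_cst; ring.
  have h2 : eta ^+ 2 <= (a - c) ^+ 2.
    by rewrite -(real_normK (num_real (a - c))); apply: lerXn2r; rewrite ?nnegrE.
  rewrite e1 psumD psum_cst mulr1 mulrDr [leRHS]addrC; apply: lerD => //.
  by rewrite mulrC ler_wpM2l.
have := child (2 * m)%N; have := child (2 * m).+1%N.
have -> : (m * 2 ^ k.+1 = 2 * m * 2 ^ k)%N by rewrite expnS; lia.
have -> : (m.+1 * 2 ^ k.+1 = (2 * m).+2 * 2 ^ k)%N by rewrite expnS; lia.
by move=> h1 h2; rewrite !mulrBr in h1 h2 *; lra.
Qed.

Lemma jump_energy (R : realType) (g : nat -> R) eta K : 0 <= eta ->
  (forall t, (2 ^ K <= t)%N -> g t = 0) ->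
  eta ^+ 2 * psum (fun n => psum (jump g eta K n) K.+1) (2 ^ K) <= l2 (2 ^ K) g.
Proof.
move=> eta0 gK.
(* Counting the levels 0, ..., K takes a block of length 2^(K+1); g vanishes on its second half. *)
have := @jcount_energy R g eta K.+1 0 0 eta0; rewrite mul0n !psum0 !subr0 mul1n.
rewrite expnS mul2n -addnn => h.
apply: (@le_trans _ _ (eta ^+ 2 * psum (fun n => jcount g eta K.+1 n 0) (2 ^ K + 2 ^ K))).
  rewrite ler_wpM2l ?sqr_ge0 //.
  have e n : psum (jump g eta K n) K.+1 = jcount g eta K.+1 n 0.
    by rewrite jcount_jump // subnn.
  rewrite (@psum_eq _ _ _ _ (fun n _ => e n)).
  apply: psum_mono => [|n _]; first exact: leq_addr.
  by rewrite -e; apply: psum_ge0 => l _; exact: jump_ge0.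
apply: le_trans h _; rewrite /l2 (@psum_supp _ _ (2 ^ K)) ?leq_addr //.
  by apply: psum_le => n _; rewrite subr0.
by move=> t Kt; rewrite gK // subr0 expr0n.
Qed.

Lemma jref_close (R : realType) (g : nat -> R) eta K n l : 0 < eta -> (l <= K)%N ->
  `|dyad l g n - jref g eta K n (K - l).+1| < eta.
Proof.
move=> eta0 lK /=; rewrite subKn //.
case: (boolP (eta <= `|dyad l g n - jref g eta K n (K - l)|)) => h.
  by rewrite subrr normr0.
by rewrite ltNge.
Qed.

(** If no level of [i, j) jumps, the reference after level j is still the one after level i, and
    both dyadic averages lie within eta of it. *)
Lemma jump_detect (R : realType) (g : nat -> R) eta K n i j : 0 < eta ->
  (i <= j)%N -> (j <= K)%N -> 2 * eta <= `|dyad i g n - dyad j g n| ->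
  1 <= psum (jump g eta K n) j - psum (jump g eta K n) i.
Proof.
move=> eta0 ij jK big.
have [[l /andP[li lj] hl]|no] := EM (exists2 l, (i <= l < j)%N & jump g eta K n l = 1).
  have := @psum_leB R (fun t => (t == l)%N%:R) (jump g eta K n) i j ij.
  have -> : psum (fun t => (t == l)%N%:R : R) j - psum (fun t => (t == l)%N%:R) i = 1.
    have e t : psum (fun t => (t == l)%N%:R : R) t = (l < t)%N%:R.
      elim: t => [|t IH]; first by rewrite psum0 ltn0.
      rewrite psumS IH ltnS (leq_eqVlt l t) eq_sym.
      by case: (ltngtP l t) => //= _; rewrite ?addr0 ?add0r.
    by rewrite !e lj ltnNge li subr0.
  apply=> t _; case: eqP => [->|_]; [by rewrite hl|exact: jump_ge0].
suff h d : (i + d <= j)%N -> jref g eta K n (K - (i + d)).+1 = jref g eta K n (K - i).+1.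
  have h1 := jref_close g n eta0 (leq_trans ij jK).
  have h2 := jref_close g n eta0 jK.
  have := h (j - i)%N; rewrite subnKC // => /(_ (leqnn _)) e; rewrite e in h2.
  move: h1 h2 big; move: (jref _ _ _ _ _) => r h1 h2 big.
  have := ler_distD r (dyad i g n) (dyad j g n); rewrite (distrC r); lra.
elim: d => [|d IH] dj; first by rewrite addn0.
rewrite -IH; last by lia.
have -> : (K - (i + d) = (K - (i + d.+1)).+1)%N by lia.
set t := (K - (i + d.+1))%N.
rewrite [RHS]/=; case: ifP => // hh; exfalso; apply: no; exists (i + d)%N; first lia.
have e1 : (K - (i + d) = t.+1)%N by rewrite /t; lia.
have e2 : (K - t.+1 = i + d)%N by rewrite /t; lia.
by rewrite /jump e1 -e2 hh.
Qed.

Lemma dyadic_pick (R : realType) (d lam : R) J : d <= lam -> lam * (1 / 2) ^+ J < d ->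
  exists2 s, (s < J)%N & lam * (1 / 2) ^+ s.+1 < d <= lam * (1 / 2) ^+ s.
Proof.
move=> dl; elim: J => [|J IH] h; first by move: h; rewrite expr0 mulr1; lra.
have [h2|h2] := ltP (lam * (1 / 2) ^+ J) d.
  by have [s sJ hs] := IH h2; exists s => //; rewrite ltnS ltnW.
by exists J; rewrite ?h ?h2.
Qed.

Lemma powRX (R : realType) (x q : R) n : 0 <= x -> (x ^+ n) `^ q = (x `^ q) ^+ n.
Proof.
move=> x0; elim: n => [|n IH]; first by rewrite !expr0 powR1.
by rewrite !exprS powRM ?exprn_ge0 // IH.
Qed.

(** Potential for [vpath_tel]. A difference in (lam 2^-(s+1), lam 2^-s] is twice the threshold lam
    2^-(s+2) and is detected at layer s; the last term pays (lam 2^-J)^q per step for the smaller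
    ones and disappears as J grows. *)
Definition jweight (R : realType) (q lam : R) (g : nat -> R) (K J n N : nat) : R :=
  psum (fun s => (lam * (1 / 2) ^+ s) `^ q *
    psum (jump g (lam * (1 / 2) ^+ s.+2) K n) (scale N)) J +
  (lam * (1 / 2) ^+ J) `^ q * N%:R.

Lemma jump_pointwise (R : realType) (q lam : R) (g : nat -> R) K J n N N' :
  0 < q -> 0 < lam -> (forall t, 0 <= g t <= lam) -> (N <= N')%N -> (scale N' <= K)%N ->
  `|dyad (scale N) g n - dyad (scale N') g n| `^ q <=
  jweight q lam g K J n N' - jweight q lam g K J n N.
Proof.
move=> q0 l0 hg NN NK; rewrite /jweight.
set d := `|_|; have sN := scale_le NN.
have half0 s : 0 < (1 / 2 : R) ^+ s by apply: exprn_gt0; lra.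
rewrite opprD addrACA -psumB -mulrBr.
have eterm s : (lam * (1 / 2) ^+ s) `^ q * psum (jump g (lam * (1 / 2) ^+ s.+2) K n) (scale N')
   - (lam * (1 / 2) ^+ s) `^ q * psum (jump g (lam * (1 / 2) ^+ s.+2) K n) (scale N) =
   (lam * (1 / 2) ^+ s) `^ q * (psum (jump g (lam * (1 / 2) ^+ s.+2) K n) (scale N') -
     psum (jump g (lam * (1 / 2) ^+ s.+2) K n) (scale N)) by rewrite mulrBr.
rewrite (@psum_eq _ _ _ _ (fun s _ => eterm s)).
have t0 s : 0 <= (lam * (1 / 2) ^+ s) `^ q * (psum (jump g (lam * (1 / 2) ^+ s.+2) K n) (scale N') -
     psum (jump g (lam * (1 / 2) ^+ s.+2) K n) (scale N)).
  rewrite mulr_ge0 ?powR_ge0 // subr_ge0; apply: psum_mono => // i _; exact: jump_ge0.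
have S0 := psum_ge0 (fun s (_ : (s < J)%N) => t0 s).
have r0 : 0 <= (lam * (1 / 2) ^+ J) `^ q * (N'%:R - N%:R).
  by rewrite mulr_ge0 ?powR_ge0 // subr_ge0 ler_nat.
have [eN|neN] := eqVneq N N'.
  by rewrite /d {1}eN subrr normr0 powR0 ?gt_eqF // addr_ge0.
have d0 : 0 <= d := normr_ge0 _.
have dl : d <= lam.
  have /andP[a1 a2] := dyad_bounds (scale N) n hg; have /andP[b1 b2] := dyad_bounds (scale N') n hg.
  by rewrite /d ler_norml; lra.
have [small|big] := lerP d (lam * (1 / 2) ^+ J).
  apply: ler_wpDl => //; apply: (@le_trans _ _ ((lam * (1 / 2) ^+ J) `^ q)).
    by apply: ler_powR_base => //; exact: ltW.
  rewrite ler_peMr ?powR_ge0 // -natrB // -[1]/(1%:R) ler_nat subn_gt0.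
  by rewrite ltn_neqAle neN.
have [s sJ /andP[s1 s2]] := dyadic_pick dl big.
apply: ler_wpDr => //; apply: le_trans (psum_term sJ (fun s _ => t0 s)).
apply: (@le_trans _ _ ((lam * (1 / 2) ^+ s) `^ q)).
  by apply: ler_powR_base => //; exact: ltW.
rewrite ler_peMr ?powR_ge0 //; apply: jump_detect => //; first by rewrite mulr_gt0.
by rewrite -/d; move: s1; rewrite !exprS; lra.
Qed.

Lemma expr_unbounded (R : realType) (B y : R) : 1 < B -> exists J, y <= B ^+ J.
Proof.
move=> B1; have [y0|y0] := leP y 0.
  by exists 0%N; rewrite expr0; lra.
have d0 : 0 < B - 1 by lra.
exists (Num.bound (y / (B - 1))).
have h : y / (B - 1) < (Num.bound (y / (B - 1)))%:R by rewrite archi_boundP // divr_ge0 // ltW.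
set J := Num.bound _ in h *.
rewrite ltr_pdivrMr // in h.
have bern n : n%:R * (B - 1) <= B ^+ n.
  elim: n => [|n IH]; first by rewrite mul0r expr0.
  rewrite exprS -natr1.
  have : 1 <= B ^+ n by apply: exprn_ege1; exact: ltW.
  nra.
by apply: le_trans (bern J); exact: ltW.
Qed.

Lemma geometric_limit (R : realType) (r x y z : R) : 0 < r -> r < 1 -> 0 <= z ->
  (forall J, x <= y + z * r ^+ J) -> x <= y.
Proof.
move=> r0 r1 z0 h; rewrite leNgt; apply/negP => yx.
have e0 : 0 < x - y by lra.
have rV : 1 < r^-1 by rewrite invf_gt1.
have [J hJ] := @expr_unbounded R r^-1 ((z + 1) / (x - y)) rV.
have rJ : 0 < r ^+ J by rewrite exprn_gt0.
rewrite ler_pdivrMr // exprVn [_ * (x - y)]mulrC ler_pdivlMr // in hJ.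
by have := h J; nra.
Qed.

(** Layer s costs (lam 2^-s)^q / eta^2 with eta = lam 2^-(s+2), that is 16 (lam 2^-s)^(q-2) times
    the energy. The sum over s is geometric of ratio 2^-(q-2), which is where q > 2 enters. *)
Lemma vmax_dyad_sum (R : realType) (q lam : R) (g : nat -> R) K M :
  2 < q -> 0 < lam -> (forall t, 0 <= g t <= lam) ->
  (forall t, (2 ^ K <= t)%N -> g t = 0) -> (M <= 2 ^ K - 1)%N ->
  psum (fun n => vmax q M (fun N => dyad (scale N) g n)) (2 ^ K) <=
  16 * (1 - (1 / 2) `^ (q - 2))^-1 * lam `^ (q - 2) * l2 (2 ^ K) g.
Proof.
move=> q2 l0 hg gK MK; have q0 : 0 < q by lra.
set rho := (1 / 2) `^ (q - 2).
have rho0 : 0 <= rho := powR_ge0 _ _.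
have rho1 : rho < 1.
  have <- : (1 : R) `^ (q - 2) = 1 by rewrite powR1.
  by apply: ltr_powR_base; lra.
have half0 s : 0 < (1 / 2 : R) ^+ s by apply: exprn_gt0; lra.
have E0 := l2_ge0 (2 ^ K) g.
have sM : (scale M <= K)%N.
  by rewrite -ltnS scale_lt // expnS; have := pow2_gt0 K; lia.
apply: (@geometric_limit _ (1 / 2) _ _ ((2 ^ K)%:R * M%:R * lam `^ q)); [lra|lra| |].
  by rewrite !mulr_ge0 ?powR_ge0.
move=> J.
apply: (@le_trans _ _ (psum (fun n => jweight q lam g K J n M) (2 ^ K))).
  have jw0 n N : 0 <= jweight q lam g K J n N.
    rewrite /jweight addr_ge0 ?mulr_ge0 ?powR_ge0 ?psum_ge0 // => s _.
    by rewrite mulr_ge0 ?powR_ge0 // psum_ge0 // => i _; exact: jump_ge0.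
  apply: psum_le => n _; apply: vmax_le => // x s /path_ltn_leq h1 h2.
  apply: le_trans (@vpath_tel _ q _ (jweight q lam g K J n) M x s _ h1 h2) _.
    move=> i j ij jM; apply: jump_pointwise => //.
    exact: leq_trans (scale_le jM) sM.
  rewrite lerBlDr; apply: ler_wpDr => //.
  rewrite /jweight; apply: lerD.
    apply: psum_le => i _; apply: ler_wpM2l; first exact: powR_ge0.
    by apply: psum_mono => [|t _]; [exact: scale_le|exact: jump_ge0].
  by rewrite ler_wpM2l ?powR_ge0 // ler_nat.
rewrite psumD; apply: lerD; last first.
  rewrite psum_cst powRM ?(ltW l0) ?(ltW (half0 J)) // powRX; last by lra.
  have h : ((1 / 2 : R) `^ q) ^+ J <= (1 / 2) ^+ J.
    apply: lerXn2r; rewrite ?nnegrE ?powR_ge0 ?divr_ge0 //.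
    by apply: ge1r_powR; lra.
  have h2 : 0 <= (2 ^ K)%:R * M%:R * lam `^ q by rewrite !mulr_ge0 ?powR_ge0.
  by have := ler_wpM2l h2 h; lra.
rewrite psum_exch.
apply: (@le_trans _ _ (psum (fun s => 16 * lam `^ (q - 2) * l2 (2 ^ K) g * rho ^+ s) J)).
  apply: psum_le => s _; rewrite psumZ.
  set eta := lam * (1 / 2) ^+ s.+2.
  have eta0 : 0 < eta by rewrite mulr_gt0.
  have je := @jump_energy R g eta K (ltW eta0) gK.
  have ls0 : 0 <= lam * (1 / 2) ^+ s by rewrite mulr_ge0 ?ltW.
  rewrite (powR_split2 (ltW q2) ls0) powRM ?(ltW l0) ?(ltW (half0 s)) // powRX; last by lra.
  rewrite -/rho.
  have -> : (lam * (1 / 2) ^+ s) ^+ 2 = 16 * eta ^+ 2 :> R.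
    by rewrite /eta !exprS; field.
  have -> : 16 * lam `^ (q - 2) * l2 (2 ^ K) g * rho ^+ s =
     16 * lam `^ (q - 2) * rho ^+ s * l2 (2 ^ K) g by ring.
  have p0 : 0 <= 16 * lam `^ (q - 2) * rho ^+ s by rewrite !mulr_ge0 ?powR_ge0 ?exprn_ge0.
  apply: le_trans (ler_wpM2l p0 je).
  have sub : psum (fun n => psum (jump g eta K n) (scale M)) (2 ^ K) <=
     psum (fun n => psum (jump g eta K n) K.+1) (2 ^ K).
    apply: psum_le => n _; apply: psum_mono => [|t _]; last exact: jump_ge0.
    exact: leqW.
  have p1 : 0 <= 16 * lam `^ (q - 2) * rho ^+ s * eta ^+ 2 by rewrite mulr_ge0 ?sqr_ge0.
  by have := ler_wpM2l p1 sub; lra.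
rewrite psumZ.
have p0 : 0 <= 16 * lam `^ (q - 2) * l2 (2 ^ K) g by rewrite !mulr_ge0 ?powR_ge0.
by have := ler_wpM2l p0 (psum_geo J rho0 rho1); lra.
Qed.

(** The average is the dyadic average plus a remainder of modulus at most lam. Jumps of the
    remainder are at most 2 lam, so their q-th powers are at most (2 lam)^(q-2) times their
    squares. *)
Lemma good_part (R : realType) (q : R) : 2 < q ->
  exists2 C : R, 0 <= C & forall (lam : R) (g : nat -> R) L M,
    0 < lam -> (forall t, 0 <= g t <= lam) ->
    (forall t, (L <= t)%N -> g t = 0) ->
    psum (fun n => vmax q M (avg g n)) L <= C * lam `^ (q - 2) * l2 L g.
Proof.
move=> q2; have q0 : 0 < q by lra.
set rho := (1 / 2 : R) `^ (q - 2).
have rho1 : rho < 1.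
  have <- : (1 : R) `^ (q - 2) = 1 by rewrite powR1.
  by apply: ltr_powR_base; lra.
pose C1 := 16 * (1 - rho)^-1; pose C2 := 2 `^ (q - 2) * (64 * 980) : R.
have C10 : 0 <= C1 by rewrite mulr_ge0 // invr_ge0; lra.
have C20 : 0 <= C2 by rewrite mulr_ge0 ?powR_ge0 ?mulr_ge0 ?ler0n.
exists (2 `^ q * (C1 + C2)); first by rewrite mulr_ge0 ?powR_ge0 // addr_ge0.
move=> lam g L M l0 hg gL; set K := (L + M).+1.
have hK : (L + M < 2 ^ K)%N by apply: leq_trans (ltn_expl _ (isT : 1 < 2)%N) _; rewrite leq_exp2l.
have LK : (L <= 2 ^ K)%N by lia.
have MK : (M <= 2 ^ K - 1)%N by lia.
have gK t : (2 ^ K <= t)%N -> g t = 0 by move=> h; apply: gL; exact: leq_trans h.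
have -> : l2 L g = l2 (2 ^ K) g.
  by rewrite /l2 (@psum_supp _ _ L (2 ^ K)) // => i Li; rewrite gL // expr0n.
apply: (@le_trans _ _ (psum (fun n => vmax q M (avg g n)) (2 ^ K))).
  by apply: psum_mono => // n _; exact: vmax_ge0.
pose u n N := avg g n N - dyad (scale N) g n.
apply: (@le_trans _ _ (psum (fun n => 2 `^ q * vmax q M (fun N => dyad (scale N) g n) +
    2 `^ q * ((2 * lam) `^ (q - 2) * psum (sqweight K g n) M)) (2 ^ K))).
  apply: psum_le => n _.
  have := @vmax_add R q 1 (fun N => dyad (scale N) g n) (u n) M q0 ltr01.
  rewrite invr1 (_ : 1 + 1 = 2) // (@vmax_eq _ _ _ (avg g n)); last first.
    by move=> i _; rewrite /u addrC subrK.
  move=> h; apply: le_trans h _; rewrite lerD2l ler_wpM2l ?powR_ge0 //.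
  have w0 a b : (a <= b)%N -> psum (sqweight K g n) a <= psum (sqweight K g n) b.
    by move=> ab; apply: psum_mono => // i _; exact: sqweight_ge0.
  have lq0 : 0 <= (2 * lam) `^ (q - 2) := powR_ge0 _ _.
  apply: vmax_le.
    by rewrite mulr_ge0 // psum_ge0 // => i _; exact: sqweight_ge0.
  move=> x s /path_ltn_leq h1 h2.
  apply: le_trans (@vpath_tel _ q _ (fun N => (2 * lam) `^ (q - 2) * psum (sqweight K g n) N) M x s _ h1 h2) _.
    move=> i j ij jM; rewrite (powR_split2 (ltW q2)) // -mulrBr.
    apply: ler_pM; rewrite ?powR_ge0 ?sqr_ge0 //.
      apply: ler_powR_base => //; first lra.
      have /andP[a1 a2] := avg_bounds n i hg; have /andP[b1 b2] := avg_bounds n j hg.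
      have /andP[c1 c2] := dyad_bounds (scale i) n hg; have /andP[d1 d2] := dyad_bounds (scale j) n hg.
      by rewrite /u ler_norml; lra.
    rewrite real_normK ?num_real // /u; apply: sq_pointwise => //.
    by have := pow2_gt0 K; lia.
  rewrite -mulrBr ler_wpM2l // lerBlDr ler_wpDr ?w0 //.
  by apply: psum_ge0 => i _; exact: sqweight_ge0.
rewrite psumD !psumZ.
have h1 := vmax_dyad_sum q2 l0 hg gK MK.
have h2 := sq_total gK MK.
rewrite powRM ?(ltW l0) //.
have p1 : 0 <= 2 `^ (q - 2) * lam `^ (q - 2) by rewrite mulr_ge0 ?powR_ge0.
have p2 : 0 <= 2 `^ q :> R := powR_ge0 _ _.
have h3 := ler_wpM2l p1 h2.
have h4 := ler_wpM2l p2 (lerD h1 h3).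
rewrite mulrDr in h4; apply: le_trans h4 _.
by rewrite -/rho -/C1 /C2 le_eqVlt; apply/orP; left; apply/eqP; ring.
Qed.

Lemma vmax_weak11 (R : realType) (q : R) : 2 < q ->
  exists2 C : R, 0 <= C & forall (mu : R) (f : nat -> R) L M,
    0 < mu -> (forall i, 0 <= f i) -> (forall i, (L <= i)%N -> f i = 0) ->
    mu * psum (fun n => ind (mu `^ q < vmax q M (avg f n))) L <= C * psum f L.
Proof.
move=> q2; have q0 : 0 < q by lra.
have [C C0 hC] := @good_part R q q2.
exists (1 + 2 `^ q * (C + 8)); first by rewrite addr_ge0 // mulr_ge0 ?powR_ge0 // addr_ge0.
move=> mu f L M mu0 f0 fL.
have [g [h1 h2 h3 h4]] := @cz_decomposition R q mu f L M (ltW q2) mu0 f0 fL.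
have h5 := hC mu g L M mu0 h1 h2.
have h6 := @weak_max R f (fun=> mu) L f0 (fun=> ltW mu0) fL.
have mq0 : 0 < mu `^ q by rewrite powR_gt0.
pose k := 2 `^ q / mu `^ q.
have k0 : 0 <= k by rewrite divr_ge0 ?powR_ge0.
(* Chebyshev outside the exceptional set, which is itself charged to the maximal function. The
   decomposition is made at the height mu of the level set, so the good part satisfies g^2 <= mu
   g. *)
have pw n : ind (mu `^ q < vmax q M (avg f n)) <=
   ind (above f (fun=> mu) n) + k * vmax q M (avg g n)
   + k * (ind (~ above f (fun=> mu) n) * vmax q M (avg (fun i => f i - g i) n)).
  have vg := vmax_ge0 q M (avg g n).
  have vb := vmax_ge0 q M (avg (fun i => f i - g i) n).
  case: (indP R (mu `^ q < vmax q M (avg f n))) => -[hn ->]; last first.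
    by nng.
  case: (indP R (above f (fun=> mu) n)) => -[ha ->].
    by rewrite -addrA lerDl; nng.
  rewrite ind1 // mul1r add0r -mulrDr /k mulrAC ler_pdivlMr // mul1r mulrDr.
  apply: le_trans (ltW hn) _.
  have := @vmax_add R q 1 (avg g n) (avg (fun i => f i - g i) n) M q0 ltr01.
  rewrite invr1 (_ : 1 + 1 = 2) // (@vmax_eq _ _ _ (avg f n)) //.
  by move=> i _; rewrite avgB addrC subrK.
have := psum_le (fun n (_ : (n < L)%N) => pw n).
rewrite !psumD !psumZ => h7.
have S6 : psum (fun t => ind (above f (fun=> mu) t) * mu) L = mu * psum (fun t => ind (above f (fun=> mu) t)) L.
  by rewrite -psumZ; apply: psum_eq => i _; rewrite mulrC.
rewrite S6 in h6.
have F0 : 0 <= psum f L by apply: psum_ge0.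
have h8 : l2 L g <= mu * psum f L.
  apply: (@le_trans _ _ (mu * psum g L)); last by rewrite ler_wpM2l // ltW.
  rewrite -psumZ; apply: psum_le => n _; have /andP[a b] := h1 n.
  by rewrite expr2 ler_wpM2r.
have lq0 : 0 <= mu `^ (q - 2) := powR_ge0 _ _.
have eq2 : mu * k * (mu `^ (q - 2) * mu) = 2 `^ q.
  rewrite /k (powR_split2 (ltW q2) (ltW mu0)); field.
  by rewrite !gt_eqF // powR_gt0.
have h9 : psum (fun n => vmax q M (avg g n)) L <= C * (mu `^ (q - 2) * mu * psum f L).
  apply: le_trans h5 _; rewrite -!mulrA ler_wpM2l // ler_wpM2l //.
have mk0 : 0 <= mu * k by rewrite mulr_ge0 // ltW.
have h10 := ler_wpM2l mk0 (lerD h9 h4).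
have h11 := ler_wpM2l (ltW mu0) h7.
have e12 : mu * k * (C * (mu `^ (q - 2) * mu * psum f L) + 8 * mu `^ (q - 2) * mu * psum f L) =
   2 `^ q * (C + 8) * psum f L by rewrite -eq2; ring.
rewrite e12 in h10.
rewrite mulrDl mul1r.
move: h6 h10 h11; rewrite !mulrDr !mulrA; lra.
Qed.

(** * Good-lambda inequality *)

(** Reduces a global comparison to single runs [a, b) of O. The induction moves a to the next point
    outside O, so a run is characterized by its right end only. *)
Lemma run_le (R : realType) (O : nat -> Prop) (u v : nat -> R) L :
  (forall a b, (a < b)%N -> (b <= L)%N -> (forall n, (a <= n < b)%N -> O n) -> ~ O b ->
     psum u b - psum u a <= psum v b - psum v a) ->
  ~ O L -> (forall n, ~ O n -> u n <= v n) -> psum u L <= psum v L.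
Proof.
move=> hrun hL hout.
suff H k a : (a <= L)%N -> (L - a <= k)%N -> psum u L - psum u a <= psum v L - psum v a.
  by have := H L 0%N (leq0n _); rewrite subn0 !psum0 !subr0; apply.
elim: k a => [|k IH] a aL ka.
  have -> : a = L by nat_lia.
  by rewrite !subrr.
have [->|neq] := eqVneq a L; first by rewrite !subrr.
have [Oa|nOa] := EM (O a); last first.
  by have := IH a.+1; have := hout a nOa; rewrite !psumS => ? /(_ ltac:(nat_lia) ltac:(nat_lia)); lra.
pose P b := (a < b)%N && `[< ~ O b >].
have exP : exists b, P b by exists L; rewrite /P asboolT // andbT; nat_lia.
case: (ex_minnP exP) => b /andP[ab /asboolP nb] bmin.
have bL : (b <= L)%N by apply: bmin; rewrite /P asboolT // andbT; nat_lia.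
have h1 := hrun a b ab bL.
have {}h1 : psum u b - psum u a <= psum v b - psum v a.
  apply: h1 => // n /andP[an nb']; apply: contrapT => hn.
  have an' : (a < n)%N.
    by rewrite ltn_neqAle an andbT; apply/eqP => e; apply: hn; rewrite -e.
  by have := bmin n; rewrite /P an' asboolT // => /(_ isT); nat_lia.
by have := IH b bL; move=> /(_ ltac:(nat_lia)); lra.
Qed.

(* Sum of a comparison between consecutive dyadic rings [2^r, 2^(r+1)). *)
Lemma ring_sum (R : realType) (u u' : nat -> R) (D : R) T :
  (forall d, 0 <= u' d) -> 0 <= D -> (0 < T)%N -> u 1%N <= u' 1%N ->
  (forall r, (2 ^ r.+1 <= T)%N ->
     psum u (minn (2 ^ r.+2) T.+1) - psum u (2 ^ r.+1) <=
     D * (psum u' (2 ^ r.+1) - psum u' (2 ^ r))) ->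
  psum u T.+1 - psum u 1 <= (D + 1) * (psum u' T.+1 - psum u' 1).
Proof.
move=> u'0 D0 T0 u1 hr.
have mono x y : (x <= y)%N -> psum u' x <= psum u' y by move=> xy; apply: psum_mono.
have claim r : (2 ^ r <= T)%N ->
    psum u (minn (2 ^ r.+1) T.+1) - psum u 1 <= D * (psum u' (2 ^ r) - psum u' 1) + u 1%N.
  elim: r => [|r IH] rT.
    have -> : minn (2 ^ 1) T.+1 = 2%N by rewrite expn1; nat_lia.
    by rewrite expn0 subrr mulr0 add0r psumS; lra.
  have rT' : (2 ^ r <= T)%N by rewrite (leq_trans _ rT) // leq_exp2l.
  have := IH rT'; have := hr r rT.
  have -> : minn (2 ^ r.+1) T.+1 = (2 ^ r.+1)%N by nat_lia.
  lra.
have /andP[l1 l2] := trunc_log_bounds (isT : 1 < 2)%N T0.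
have := claim _ l1.
have -> : minn (2 ^ (trunc_log 2 T).+1) T.+1 = T.+1 by nat_lia.
move=> h; apply: le_trans h _.
have h1 := mono _ _ (leqW l1).
have h2 : u 1%N <= psum u' T.+1 - psum u' 1.
  apply: le_trans u1 _.
  have -> : u' 1%N = psum u' 2 - psum u' 1 by rewrite (psumS u' 1); ring.
  by rewrite lerD2r mono.
have h3 : D * (psum u' (2 ^ trunc_log 2 T) - psum u' 1) <= D * (psum u' T.+1 - psum u' 1).
  by rewrite ler_wpM2l // lerD2r.
lra.
Qed.

Lemma psum_flip (R : realType) (w : nat -> R) b x y : (x <= y)%N -> (y <= b.+1)%N ->
  psum (fun d => w (b - d)%N) y - psum (fun d => w (b - d)%N) x =
  psum w (b.+1 - x) - psum w (b.+1 - y).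
Proof.
elim: y => [|y IH]; first by rewrite leqn0 => /eqP -> _; rewrite !subrr.
rewrite leq_eqVlt => /orP[/eqP -> _|]; first by rewrite !subrr.
rewrite ltnS => xy yb; rewrite psumS; have := IH xy (ltnW yb).
have -> : (b.+1 - y = (b - y).+1)%N by nat_lia.
have -> : (b.+1 - y.+1 = b - y)%N by nat_lia.
by rewrite psumS; lra.
Qed.

(* The only consequence of the one-sided Muckenhoupt conditions that the
   good-lambda inequality uses. *)
Definition forward_comparable (R : realType) (D : R) (w : nat -> R) : Prop :=
  forall (a m c : nat) (F : nat -> Prop), (a <= m)%N -> (m <= c)%N ->
  (c.+1 - a)%N%:R <= 16 * (psum (fun n => @ind R (F n)) c.+1 - psum (fun n => ind (F n)) m) ->
  psum w m.+1 - psum w a <=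
  D * (psum (fun n => ind (F n) * w n) c.+1 - psum (fun n => ind (F n) * w n) m).

Lemma not_above (R : realType) (f : nat -> R) (mu : R) x : ~ above f (fun=> mu) x ->
  forall t, (x <= t)%N -> psum f t - psum f x <= mu * (t - x)%N%:R.
Proof.
move=> h t; rewrite leq_eqVlt => /orP[/eqP ->|xt]; first by rewrite subnn subrr mulr0.
rewrite leNgt; apply/negP => h2; apply: h; exists t; split => //.
by rewrite !psum_cst -mulrBl -natrB ?(ltnW xt) // mulrC.
Qed.

(** For q >= 1, the q-th powers of consecutive decrements add up to at most the q-th power of the
    total decrement. *)
Lemma vpath_nonincreasing (R : realType) (q : R) (c : nat -> R) x s : 1 <= q ->
  {homo c : i j / (i <= j)%N >-> j <= i} -> path leq x s ->
  vpath q c x s <= (c x - c (last x s)) `^ q.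
Proof.
move=> q1 hc; elim: s x => [|y s IH] x /=; first by rewrite subrr powR_ge0.
move=> /andP[xy ys]; have h1 := hc _ _ xy; have h2 := hc _ _ (path_leq_last ys).
rewrite ger0_norm ?subr_ge0 //.
have -> : c x - c (last y s) = (c x - c y) + (c y - c (last y s)) by ring.
apply: le_trans (powR_superadd q1 _ _); rewrite ?subr_ge0 //.
by rewrite lerD2l; exact: IH.
Qed.

(* Far part: [f2] lives on [b + h, oo); seen from [x = b - d] its averages are,
   up to a monotone error of size O(mu), the averages of [f] seen from [b]. *)
Lemma far_part (R : realType) (q th mu : R) (f : nat -> R) M x d h :
  1 <= q -> 0 < th -> (forall i, 0 <= f i) ->
  (0 < d)%N -> (d < 2 * h)%N -> 0 <= mu -> ~ above f (fun=> mu) x ->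
  vmax q M (avg (fun n => ind (x + d + h <= n)%N * f n) x) <=
  (1 + th) `^ q * vmax q M (avg f (x + d)%N) + (1 + th^-1) `^ q * (4 * mu) `^ q.
Proof.
move=> q1 th0 f0 d0 dh mu0 nx; have q0 : 0 < q by lra.
set b := (x + d)%N; set f2 := fun n => _.
have h0 : (0 < h)%N by nat_lia.
(* Change of time: the window of length T(N) from x has the same end as the one of length phi(N) + 1
   = T(N) - d from b. Lengths are raised to at least d + h, up to which the averages of [f2]
   vanish. *)
pose phi N := (maxn N (d + h).-1 - d)%N.
pose T N := maxn N.+1 (d + h).
have phi_mono i j : (i <= j)%N -> (phi i <= phi j)%N.
  by move=> ij; apply: leq_sub2r; rewrite geq_max !leq_max ij leqnn orbT.
have T_mono i j : (i <= j)%N -> (T i <= T j)%N.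
  by move=> ij; rewrite geq_max !leq_max ltnS ij leqnn orbT.
have phi_le N : ((d + h).-1 <= M)%N -> (N <= M)%N -> (phi N <= M)%N.
  by move=> h1 h2; rewrite (leq_trans (leq_subr _ _)) // geq_max h2.
(* With A the average from b and S the mass of [b, b + h), the average of [f2] is A - (d A + S)/T.
   Since A <= 3 mu and S <= mu (d + h), the coefficient of 1/T is at most mu (4d + h). *)
pose c N : R := mu * (4 * d%:R + h%:R) / (T N)%:R.
have F_mono s t : (s <= t)%N -> psum f s <= psum f t by move=> st; apply: psum_mono.
have P2 t : psum f2 t = psum f (maxn t (b + h)) - psum f (b + h).
  elim: t => [|t IH]; first by rewrite psum0 max0n subrr.
  rewrite psumS IH /f2; case: (boolP (b + h <= t)%N) => bt.
    by rewrite ind1 // mul1r (maxn_idPl bt) (maxn_idPl (leqW bt)) psumS; ring.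
  rewrite ind0 ?mul0r ?addr0; last exact/negP.
  by rewrite -ltnNge in bt; rewrite (maxn_idPr bt) (maxn_idPr (ltnW bt)).
have T0 N : 0 < (T N)%:R :> R by rewrite ltr0n /T; nat_lia.
have hT N : ((d + h)%:R <= (T N)%:R :> R) by rewrite ler_nat /T; nat_lia.
have A2 N : avg f2 x N = (psum f (x + T N) - psum f (b + h)) / (T N)%:R.
  rewrite /avg !P2 (maxn_idPr (_ : x <= b + h)%N) ?subrr ?subr0; last by rewrite /b; nat_lia.
  rewrite /T; case: (boolP (d + h <= N.+1)%N) => hN.
    by rewrite (maxn_idPl (_ : b + h <= x + N.+1)%N) ?(maxn_idPl hN) // /b; nat_lia.
  rewrite (maxn_idPr (_ : x + N.+1 <= b + h)%N); last by rewrite /b; nat_lia.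
  rewrite subrr mul0r (maxn_idPr (_ : N.+1 <= d + h)%N); last by nat_lia.
  by rewrite (_ : (x + (d + h) = b + h)%N) ?subrr ?mul0r // /b; nat_lia.
have Aphi N : avg f b (phi N) = (psum f (x + T N) - psum f b) / ((T N)%:R - d%:R).
  rewrite /avg; have -> : (b + (phi N).+1 = x + T N)%N by rewrite /phi /T /b; nat_lia.
  by rewrite -natrB; [congr (_ / _%:R); rewrite /phi /T; nat_lia|rewrite /T; nat_lia].
pose S := psum f (b + h) - psum f b.
have S0 : 0 <= S by rewrite subr_ge0 F_mono // leq_addr.
have dR : 0 < d%:R :> R by rewrite ltr0n.
have hR : 0 < h%:R :> R by rewrite ltr0n.
have dhR : d%:R <= 2 * h%:R :> R by rewrite -natrM ler_nat; nat_lia.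
have SU : S <= mu * (d%:R + h%:R).
  have := not_above nx (t := (b + h)%N); rewrite -natrD.
  have -> : (b + h - x = d + h)%N by rewrite /b -addnA addKn.
  rewrite /b -addnA leq_addr addnA => /(_ isT); apply: le_trans.
  by rewrite lerD2l lerN2 F_mono // /b leq_addr.
(* The window from b sits in one from x of length T, and T <= 3 (T - d) because d <= 2h and T >= d +
   h. *)
have aU N : avg f b (phi N) <= 3 * mu.
  rewrite Aphi; have t3 := hT N; rewrite natrD in t3.
  rewrite ler_pdivrMr; last by lra.
  have := not_above nx (t := (x + T N)%N); rewrite addKn leq_addr => /(_ isT) u1.
  have u2 : psum f x <= psum f b by rewrite F_mono // /b leq_addr.
  have u3 : mu * (T N)%:R <= mu * (3 * ((T N)%:R - d%:R)) by rewrite ler_wpM2l //; lra.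
  lra.
have a0 N : 0 <= avg f b (phi N).
  by rewrite /avg divr_ge0 // subr_ge0 F_mono // leq_addr.
have dec N : avg f2 x N = avg f b (phi N) - (d%:R * avg f b (phi N) + S) / (T N)%:R.
  rewrite A2 Aphi /S; have t3 := hT N; rewrite natrD in t3.
  by field; rewrite !gt_eqF //; lra.
have c_mono : {homo c : i j / (i <= j)%N >-> j <= i}.
  have k0 : 0 <= mu * (4 * d%:R + h%:R) by nng.
  move=> i j ij; rewrite /c ler_wpM2l //.
  by rewrite lef_pV2 ?posrE // ler_nat T_mono.
have key i j : (i <= j)%N -> (j <= M)%N -> `|avg f2 x i - avg f2 x j| <=
    `|(avg f b \o phi) i - (avg f b \o phi) j| + `|c i - c j|.
  move=> ij _; rewrite /= !dec.
  rewrite [`|c i - c j|]ger0_norm ?subr_ge0 ?c_mono // /c -mulrBr.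
  have ti := hT i; rewrite natrD in ti.
  have tj := hT j; rewrite natrD in tj.
  have iV : (T j)%:R^-1 <= (T i)%:R^-1 :> R by rewrite lef_pV2 ?posrE // ler_nat T_mono.
  have dV : d%:R * (T i)%:R^-1 <= 1 :> R by rewrite ler_pdivrMr // mul1r; lra.
  have dV0 : 0 <= d%:R * (T i)%:R^-1 :> R by rewrite divr_ge0.
  have aj := aU j; have aj0 := a0 j; have ai0 := a0 i.
  move: (avg f b (phi i)) (avg f b (phi j)) ((T i)%:R^-1) ((T j)%:R^-1) iV dV dV0 aj aj0 ai0.
  move=> ai a' vi vj iV dV dV0 aj aj0 ai0.
  have -> : ai - (d%:R * ai + S) * vi - (a' - (d%:R * a' + S) * vj) =
     (ai - a') * (1 - d%:R * vi) - (d%:R * a' + S) * (vi - vj) by ring.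
  apply: le_trans (ler_normB _ _) _; rewrite !normrM; apply: lerD.
    by rewrite ler_piMr // ler_norml; lra.
  rewrite [`|vi - vj|]ger0_norm ?subr_ge0 // ler_wpM2r ?subr_ge0 //.
  rewrite ger0_norm; last by rewrite addr_ge0 // mulr_ge0.
  by have : d%:R * a' <= d%:R * (3 * mu); [rewrite ler_wpM2l|lra].
have RHS0 : 0 <= (1 + th) `^ q * vmax q M (avg f b) + (1 + th^-1) `^ q * (4 * mu) `^ q by nng.
apply: vmax_le => // y s /path_ltn_leq s1 s2.
(* If no admissible window gets beyond b + h, all averages of [f2] are 0. This case is separate
   because phi could then exceed M. *)
have [small|big] := leqP M.+1 (d + h).
  apply: le_trans (@vpath_tel _ q _ (fun=> 0) M y s _ s1 s2) _; last by rewrite subrr.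
  move=> i j ij jM; rewrite subrr.
  have z N : (N <= M)%N -> avg f2 x N = 0.
    move=> NM; rewrite A2 (_ : (x + T N = b + h)%N) ?subrr ?mul0r //.
    by rewrite /T (maxn_idPr _) ?addnA // (leq_trans _ small).
  by rewrite !z ?(leq_trans ij) // subrr normr0 powR0 // gt_eqF.
apply: le_trans (@vpath_le_add _ q th _ _ _ M y s (ltW q0) th0 key s1 s2) _.
apply: lerD; apply: ler_wpM2l; rewrite ?powR_ge0 //.
  by apply: vpath_reparam => //; apply: phi_le => //; rewrite (leq_trans (leq_pred _)) // -ltnS.
apply: le_trans (vpath_nonincreasing q1 c_mono s1) _.
apply: ler_powR_base; rewrite ?subr_ge0 ?c_mono ?path_leq_last //; first exact: ltW.
apply: (@le_trans _ _ (c y)).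
  by rewrite lerBlDr lerDl /c divr_ge0 // mulr_ge0 // addr_ge0 // mulr_ge0.
rewrite /c ler_pdivrMr //; have t3 := hT y; rewrite natrD in t3.
have t4 : 4 * d%:R + h%:R <= 4 * (T y)%:R :> R by lra.
by have := ler_wpM2l mu0 t4; lra.
Qed.

Lemma powR_root (R : realType) (q x : R) : q != 0 -> 0 <= x -> (x `^ q^-1) `^ q = x.
Proof. by move=> q0 x0; rewrite -powRrM mulVf // powRr1. Qed.

(** At an exceptional point the part of f beyond b + h is nearly seen from b, where the variation is
    at most lam; so the part before b + h must have variation at least k' lam. The weak (1,1) bound
    makes such points rare, as that part has mass at most 3 gam lam h. *)
Lemma exceptional_ring (R : realType) (q B : R) : 2 < q -> 1 < B ->
  exists2 gam : R, 0 < gam & forall (f : nat -> R) L M (lam : R) b h,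
    (forall i, 0 <= f i) -> (forall i, (L <= i)%N -> f i = 0) -> 0 < lam ->
    (0 < h)%N -> vmax q M (avg f b) <= lam `^ q ->
    psum (fun n => @ind R (((B * lam) `^ q < vmax q M (avg f n) /\
        ~ above f (fun=> gam * lam) n) /\ (h <= b - n < 2 * h)%N)) b <= h%:R / 4.
Proof.
move=> q2 B1; have q0 : 0 < q by lra.
have qn0 : q != 0 by rewrite gt_eqF.
have [C C0 hC] := @vmax_weak11 R q q2.
(* For th <= 1, (1 + th)^3 <= 1 + 7 th, so that Q^3 <= B^q below. *)
pose th := Num.min 1 ((B - 1) / 7).
have th0 : 0 < th by rewrite lt_min ltr01 divr_gt0 // subr_gt0.
have th1 : th <= 1 by rewrite ge_min lexx.
have thB : th <= (B - 1) / 7 by rewrite ge_min lexx orbT.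
have th3 : (1 + th) ^+ 3 <= B.
  have : th ^+ 2 <= th by rewrite expr2 ler_piMl // ltW.
  have : th ^+ 3 <= th by rewrite exprSr ler_piMl ?(ltW th0) // exprn_ile1 // ltW.
  by rewrite (_ : (1 + th) ^+ 3 = 1 + 3 * th + 3 * th ^+ 2 + th ^+ 3); [lra|ring].
pose Q := (1 + th) `^ q; pose Ct := (1 + th^-1) `^ q.
have Q1 : 1 < Q.
  have <- : (1 : R) `^ q = 1 by rewrite powR1.
  by apply: ltr_powR_base; lra.
have thV : 0 < th^-1 by rewrite invr_gt0.
have Ct0 : 0 < Ct by rewrite powR_gt0 // addr_gt0.
(* One factor Q is lost in splitting f and one in [far_part], leaving the room Q^3 - Q^2 = 2 kap:
   half for the error 4 mu of the far part, half for the local part. *)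
pose kap := (Q ^+ 3 - Q ^+ 2) / 2.
have kap0 : 0 < kap.
  by rewrite divr_gt0 // subr_gt0 ltr_eXn2l.
have QB : Q ^+ 3 <= B `^ q.
  rewrite /Q -powRX; last by lra.
  by apply: ler_powR_base => //; [exact: ltW|apply: exprn_ge0; lra].
pose k' := (kap / Ct) `^ q^-1.
have k'0 : 0 < k' by rewrite powR_gt0 // divr_gt0.
pose g2 := (kap / (Q * Ct)) `^ q^-1 / 4.
have QCt0 : 0 < Q * Ct by rewrite mulr_gt0 //; lra.
have g20 : 0 < g2 by rewrite divr_gt0 // powR_gt0 // divr_gt0.
(* The first bound makes 3 C gam / k' at most 1/4, the second keeps the far error below kap. *)
pose gam := Num.min (k' / (12 * (C + 1))) g2.
have C1 : 0 < 12 * (C + 1) by rewrite mulr_gt0 //; lra.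
have gam0 : 0 < gam by rewrite lt_min g20 divr_gt0.
have gamk : 12 * (C + 1) * gam <= k'.
  by rewrite mulrC -ler_pdivlMr // ge_min lexx.
have gamQ : Q * Ct * (4 * gam) `^ q <= kap.
  have h1 : (4 * gam) `^ q <= kap / (Q * Ct).
    have kp : 0 <= kap / (Q * Ct) by rewrite ltW // divr_gt0.
    rewrite -[leRHS](powR_root qn0 kp).
    apply: ler_powR_base; [lra|lra|].
    have : gam <= g2 by rewrite ge_min lexx orbT.
    by rewrite /g2; lra.
  by rewrite mulrC -ler_pdivlMr.
exists gam => // f L M lam b h f0 fL l0 h0 Vb.
pose E n := (((B * lam) `^ q < vmax q M (avg f n) /\
        ~ above f (fun=> gam * lam) n) /\ (h <= b - n < 2 * h)%N).
change (psum (fun n => @ind R (E n)) b <= h%:R / 4).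
set mu := gam * lam in E *.
have mu0 : 0 < mu by rewrite mulr_gt0.
have [[n0 hn0]|none] := EM (exists n, E n); last first.
  rewrite (@psum_eq _ _ (fun=> 0)); first by rewrite psum_cst mulr0 divr_ge0.
  by move=> i _; rewrite ind0 // => hi; apply: none; exists i.
have exE : exists n, `[< E n >] by exists n0; exact/asboolP.
(* The leftmost exceptional point of the ring: f may be cut at xi without affecting the other
   exceptional points, and [xi] not being [above] bounds the mass of [xi, b + h), whose length is at
   most 3h. *)
case: (ex_minnP exE) => xi /asboolP[[_ nax] /andP[rx1 rx2]] ximin.
pose f1 n := ind (xi <= n < b + h)%N * f n.
have f10 n : 0 <= f1 n by rewrite mulr_ge0.
have f1L n : (b + h <= n)%N -> f1 n = 0.
  by move=> bn; rewrite /f1 ind0 ?mul0r // => /andP[_]; rewrite ltnNge bn.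
have hw := hC (k' * lam) f1 (b + h)%N M (mulr_gt0 k'0 l0) f10 f1L.
have F1 : psum f1 (b + h) <= 3 * mu * h%:R.
  have e1 : psum f1 (b + h) - psum f1 xi <= psum f (b + h) - psum f xi.
    apply: psum_leB => [|i _]; first by nat_lia.
    by rewrite /f1 ler_piMl // ?ind_le1 ?f0.
  have e2 : psum f1 xi = 0.
    rewrite (@psum_eq _ _ (fun=> 0)) ?psum_cst ?mulr0 // => i ix.
    by rewrite /f1 ind0 ?mul0r // => /andP[]; rewrite leqNgt ix.
  have e3 := @not_above _ _ _ _ nax (b + h)%N ltac:(nat_lia).
  have e4 : (b + h - xi)%N%:R <= 3 * h%:R :> R by rewrite -natrM ler_nat; nat_lia.
  have := ler_wpM2l (ltW mu0) e4; rewrite -/mu in e3; lra.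
have sub n : E n -> (k' * lam) `^ q < vmax q M (avg f1 n).
  move=> En; have xin : (xi <= n)%N by apply: ximin; exact/asboolP.
  case: En => -[big nan] /andP[r1 r2].
  have ed : (n + (b - n) = b)%N by nat_lia.
  have := @far_part R q th mu f M n (b - n) h _ th0 f0 _ r2 (ltW mu0) nan.
  rewrite ed => /(_ ltac:(lra) ltac:(nat_lia)) far.
  have split2 : vmax q M (avg f n) <= Q * vmax q M (avg (fun i => ind (b + h <= i)%N * f i) n)
     + Ct * vmax q M (avg f1 n).
    have := @vmax_add R q th (avg (fun i => ind (b + h <= i)%N * f i) n) (avg f1 n) M q0 th0.
    rewrite (@vmax_eq _ _ _ (avg f n)) // => N _.
    rewrite !avg_psum -mulrDl -psumD; congr (_ / _); apply: psum_eq => s _.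
    rewrite /f1; case: (leqP (b + h) (s + n)) => hb.
      by rewrite ind1 // ind0 ?mul0r ?addr0 ?mul1r // => /andP[_].
    rewrite ind0 ?mul0r ?add0r // ind1 ?mul1r //.
    by rewrite (leq_trans xin) // leq_addl.
  rewrite -/Q -/Ct in far.
  have lq0 : 0 < lam `^ q by rewrite powR_gt0.
  have e5 : (k' * lam) `^ q = kap / Ct * lam `^ q.
    have kp : 0 <= kap / Ct by rewrite ltW // divr_gt0.
    by rewrite powRM ?(ltW l0) ?(ltW k'0) // (powR_root qn0 kp).
  rewrite {}e5 mulrAC ltr_pdivrMr //.
  have emu : (4 * mu) `^ q = (4 * gam) `^ q * lam `^ q.
    rewrite /mu mulrA powRM ?(ltW l0) //; first lra.
  rewrite {}emu in far.
  have eB : (B * lam) `^ q = B `^ q * lam `^ q by rewrite powRM ?(ltW l0) //; lra.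
  rewrite {}eB in big.
  move: lq0 big split2 far Vb gamQ QB; rewrite /kap.
  move: (lam `^ q) (vmax q M (avg f n)) (vmax q M (avg f b)) (vmax q M (avg f1 n))
    (vmax _ _ _) ((4 * gam) `^ q) (B `^ q) => Lq V Vb V1 V2 G Bq lq0 big split2 far hVb hG hB.
  have Q0 : 0 <= Q by lra.
  have b1 := ler_wpM2r (ltW lq0) hB.
  have b2 := ler_wpM2l Q0 far.
  have b3 := ler_wpM2l Q0 (ler_wpM2l Q0 hVb).
  have b4 := ler_wpM2r (ltW lq0) hG.
  lra.
have klam0 : 0 < k' * lam by rewrite mulr_gt0.
rewrite -(ler_pM2l klam0).
apply: (@le_trans _ _ (k' * lam * psum (fun n => ind ((k' * lam) `^ q < vmax q M (avg f1 n))) (b + h))).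
  rewrite ler_wpM2l ?(ltW klam0) //.
  apply: (@le_trans _ _ (psum (fun n => ind ((k' * lam) `^ q < vmax q M (avg f1 n))) b)).
    by apply: psum_le => n _; apply: ind_imp; exact: sub.
  by apply: psum_mono => //; exact: leq_addr.
apply: le_trans hw _.
have c1 := ler_wpM2l C0 F1.
have hR : 0 <= lam * h%:R by rewrite mulr_ge0 // ltW.
have c2 : 12 * C * gam <= k' by have := mulr_ge0 C0 (ltW gam0); lra.
have := ler_wpM2l hR c2; rewrite /mu in c1; lra.
Qed.

(** The order of the quantifiers is the point: eps = 1 - 1/(D+1) depends on the weight constant
    alone, since on each run the non-exceptional points carry at least 1/(D+1) of the mass, while
    gam is chosen after B. *)
Lemma good_lambda (R : realType) (q D : R) : 2 < q -> 0 <= D ->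
  exists2 eps : R, 0 <= eps < 1 & forall B : R, 1 < B ->
  exists2 gam : R, 0 < gam & forall (w f : nat -> R) L M (lam : R),
    (forall i, 0 <= w i) -> forward_comparable D w ->
    (forall i, 0 <= f i) -> (forall i, (L <= i)%N -> f i = 0) -> 0 < lam ->
    psum (fun n => ind ((B * lam) `^ q < vmax q M (avg f n) /\
        ~ above f (fun=> gam * lam) n) * w n) L <=
    eps * psum (fun n => ind (lam `^ q < vmax q M (avg f n)) * w n) L.
Proof.
move=> q2 D0; have q0 : 0 < q by lra.
exists (1 - (D + 1)^-1).
  have : (D + 1)^-1 <= 1 by rewrite invf_le1; lra.
  have : 0 < (D + 1)^-1 by rewrite invr_gt0; lra.
  by move=> ? ?; apply/andP; split; lra.
move=> B B1; have [gam gam0 hgam] := @exceptional_ring R q B q2 B1.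
exists gam => // w f L M lam w0 fw f0 fL l0.
pose E n := ((B * lam) `^ q < vmax q M (avg f n) /\ ~ above f (fun=> gam * lam) n).
pose O n : Prop := lam `^ q < vmax q M (avg f n).
change (psum (fun n => ind (E n) * w n) L <=
  (1 - (D + 1)^-1) * psum (fun n => ind (O n) * w n) L).
have EO n : E n -> O n.
  case=> h _; apply: le_lt_trans h; apply: ler_powR_base; [lra|lra|].
  by rewrite ler_peMl ?ltW.
rewrite -psumZ; apply: (@run_le _ O); last 2 first.
- rewrite /O; apply/negP; rewrite -leNgt; apply: vmax_le; first exact: powR_ge0.
  move=> x s /path_ltn_leq h1 h2.
  apply: le_trans (@vpath_tel _ q _ (fun=> 0) M x s _ h1 h2) _; last by rewrite subrr powR_ge0.
  move=> i j _ _; rewrite subrr /avg !(@psum_supp _ f L (L + _)) ?leq_addr //.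
  by rewrite !subrr !mul0r subrr normr0 powR0 // gt_eqF.
- move=> n nO; have nE : ~ E n by move/EO.
  by rewrite (ind0 _ nE) (ind0 _ nO) !mul0r mulr0.
move=> a b ab bL Oab nOb.
have Vb : vmax q M (avg f b) <= lam `^ q by rewrite leNgt; apply/negP.
have ring h (h0 : (0 < h)%N) := hgam f L M lam b h f0 fL l0 h0 Vb.
pose T := (b - a)%N; have T0 : (0 < T)%N by rewrite subn_gt0.
pose u d := w (b - d)%N; pose E' d := E (b - d)%N.
have hsum : psum u T.+1 - psum u 1 <=
  (D + 1) * (psum (fun d => ind (~ E' d) * u d) T.+1 - psum (fun d => ind (~ E' d) * u d) 1).
  apply: ring_sum => //; first by move=> d; rewrite mulr_ge0 ?ind_ge0 // /u.
    (* In the ring h = 1, which is the single point b - 1, a count of at most 1/4 is zero. *)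
    have nE1 : ~ E' 1%N; last by rewrite ind1 // mul1r.
    move=> E1; have := ring 1%N isT.
    have : 1 <= psum (fun n => @ind R (E n /\ (1 <= b - n < 2 * 1)%N)) b.
      have hb1 : (b - 1 < b)%N by nat_lia.
      apply: le_trans (psum_term hb1 (fun j _ => ind_ge0 _ _)).
      by rewrite ind1 //; split; [exact: E1|nat_lia].
    by move=> h1 h2; have := le_trans h1 h2; rewrite ler_pdivlMr // mul1r ler_nat.
  move=> r rT.
  have p0 := pow2_gt0 r.
  have e1 : (2 ^ r.+1 = 2 * 2 ^ r)%N by rewrite expnS.
  have e2 : (2 ^ r.+2 = 4 * 2 ^ r)%N by rewrite !expnS; nat_lia.
  rewrite {}e1 {}e2 in rT *; move: (2 ^ r)%N p0 rT => h h0 rT.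
  have Tb : (T <= b)%N by rewrite leq_subr.
  rewrite (@psum_flip _ w); [|nat_lia|nat_lia].
  rewrite (@psum_flip _ (fun n => ind (~ E n) * w n)); [|nat_lia|nat_lia].
  (* The point b - 2h is shared by the two intervals of [forward_comparable] but belongs to the
     farther ring, so it is excluded. F keeps at least 3h/4 points of an interval of length at most
     3h. *)
  pose F n := (~ E n) /\ (b - 2 * h < n)%N.
  have := fw (b.+1 - minn (4 * h) T.+1)%N (b - 2 * h)%N (b - h)%N F ltac:(nat_lia) ltac:(nat_lia).
  have -> : ((b - 2 * h).+1 = b.+1 - 2 * h)%N by nat_lia.
  have -> : ((b - h).+1 = b.+1 - h)%N by nat_lia.
  move=> hfw; apply: le_trans (hfw _) _.
    have cnt : psum (fun n => @ind R (F n)) (b.+1 - h) - psum (fun n => @ind R (F n)) (b - 2 * h)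
        >= h%:R - h%:R / 4.
      have r1 := ring h h0.
      have : psum (fun n => ind (b - 2 * h < n)%N - ind (E n /\ (h <= b - n < 2 * h)%N)) (b.+1 - h)
        - psum (fun n => ind (b - 2 * h < n)%N - ind (E n /\ (h <= b - n < 2 * h)%N)) (b - 2 * h)
        <= psum (fun n => @ind R (F n)) (b.+1 - h) - psum (fun n => @ind R (F n)) (b - 2 * h).
        apply: psum_leB => [|i /andP[i1 i2]]; first nat_lia.
        case: (indP R (b - 2 * h < i)%N) => -[hi ->]; last by rewrite lerBlDr addr_ge0.
        case: (indP R (E i /\ (h <= b - i < 2 * h)%N)) => -[hE ->].
          by rewrite subrr.
        rewrite subr0 /F ind1 //; split => // Ei; apply: hE; split => //; nat_lia.
      apply: le_trans; rewrite !psumB.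
      have c1 : psum (fun n => @ind R (b - 2 * h < n)%N) (b.+1 - h) -
                psum (fun n => @ind R (b - 2 * h < n)%N) (b - 2 * h) = h%:R.
        have cc t : psum (fun n => @ind R (b - 2 * h < n)%N) t = (t - (b - 2 * h).+1)%N%:R.
          elim: t => [|t IH]; first by rewrite psum0.
          rewrite psumS IH; case: (indP R (b - 2 * h < t)%N) => -[ht ->].
            by rewrite natr1; congr (_%:R); nat_lia.
          by move/negP: ht => ht; rewrite addr0; congr (_%:R); nat_lia.
        by rewrite !cc -natrB; [congr (_%:R); nat_lia|nat_lia].
      have c2 : psum (fun n => @ind R (E n /\ (h <= b - n < 2 * h)%N)) (b.+1 - h) <= h%:R / 4.
        by apply: le_trans r1; apply: psum_mono => //; nat_lia.
      have c3 : 0 <= psum (fun n => @ind R (E n /\ (h <= b - n < 2 * h)%N)) (b - 2 * h).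
        by apply: psum_ge0.
      lra.
    have : ((b.+1 - h) - (b.+1 - minn (4 * h) T.+1))%N%:R <= 3 * h%:R :> R.
      by rewrite -natrM ler_nat; nat_lia.
    have : 0 < h%:R :> R by rewrite ltr0n.
    lra.
  apply: ler_wpM2l => //.
  have -> : psum (fun n => ind (F n) * w n) (b.+1 - h) - psum (fun n => ind (F n) * w n) (b - 2 * h)
     = psum (fun n => ind (F n) * w n) (b.+1 - h) - psum (fun n => ind (F n) * w n) (b.+1 - 2 * h).
    have -> : (b.+1 - 2 * h = (b - 2 * h).+1)%N by nat_lia.
    by rewrite psumS ind0 ?mul0r ?addr0 // /F ltnn => -[].
  apply: psum_leB => [|i _]; first nat_lia.
  by rewrite ler_wpM2r //; apply: ind_imp => -[].
have Tb : (T <= b)%N by rewrite leq_subr.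
move: hsum; rewrite (@psum_flip _ w) // (@psum_flip _ (fun n => ind (~ E n) * w n)) //.
have -> : (b.+1 - T.+1 = a)%N by rewrite /T; nat_lia.
rewrite subSS subn0 => hsum.
rewrite !psumZ -mulrBr.
have eqO (x : nat) : psum (fun n => ind (O n) * w n) b - psum (fun n => ind (O n) * w n) a =
    psum w b - psum w a.
  by apply/eqP; rewrite eq_le; apply/andP; split; apply: psum_leB (ltnW ab) _ => i iab;
     rewrite ind1 ?mul1r //; exact: Oab.
rewrite (eqO 0%N).
have eqE : psum (fun n => ind (E n) * w n) b - psum (fun n => ind (E n) * w n) a +
   (psum (fun d => ind (~ E d) * w d) b - psum (fun d => ind (~ E d) * w d) a) = psum w b - psum w a.
  have e x : psum w x = psum (fun n => ind (E n) * w n) x + psum (fun n => ind (~ E n) * w n) x.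
    rewrite -psumD; apply: psum_eq => i _; rewrite -mulrDl.
    by have [h|h] := EM (E i); [rewrite (ind1 _ h) ind0 ?addr0 ?mul1r|rewrite ind0 // ind1 // add0r mul1r].
  by rewrite !e addrACA -opprD.
have D1 : 0 < D + 1 by rewrite ltr_wpDl.
rewrite -ler_pdivrMl // in hsum.
rewrite mulrBl mul1r lerBrDr -[leRHS]eqE lerD2l.
exact: le_trans hsum _.
Qed.

(** * Muckenhoupt weights on a half line *)

Definition dualw (R : realType) (p : R) (w : nat -> R) (n : nat) : R :=
  w n `^ (- (1 / (p - 1))).

(** The one-sided condition with three free points: w on [a, m], its dual on [m, c], with the length
    of [a, c] on the right. The two intervals may have different lengths and share m. *)
Definition muckenhoupt3 (R : realType) (p C : R) (w : nat -> R) : Prop :=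
  forall a m c, (a <= m)%N -> (m <= c)%N ->
  (psum w m.+1 - psum w a) * (psum (dualw p w) c.+1 - psum (dualw p w) m) `^ (p - 1)
    <= C * (c.+1 - a)%N%:R `^ p.

Lemma psum_ind_diff (R : realType) (F : nat -> Prop) (w : nat -> R) x y :
  (forall i, 0 <= w i) -> (x <= y)%N ->
  0 <= psum (fun n => ind (F n) * w n) y - psum (fun n => ind (F n) * w n) x <=
  psum w y - psum w x.
Proof.
move=> w0 xy; apply/andP; split.
  by rewrite subr_ge0; apply: psum_mono => // i _; rewrite mulr_ge0.
by apply: psum_leB => // i _; rewrite ler_piMl // ind_le1.
Qed.

(** A form of Holder's inequality obtained from 1 <= t + t^(-e), e = 1/(p-1), applied to t = s w(i)
    and summed over F; the factor 1/2 is the price of this elementary inequality. *)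
Lemma holder_count (R : realType) (p : R) (w : nat -> R) (F : nat -> Prop) x y :
  1 < p -> (forall i, 0 < w i) -> (x <= y)%N ->
  ((psum (fun n => ind (F n)) y - psum (fun n => ind (F n)) x) / 2) `^ p <=
  (psum (fun n => ind (F n) * w n) y - psum (fun n => ind (F n) * w n) x) *
  (psum (fun n => ind (F n) * dualw p w n) y -
   psum (fun n => ind (F n) * dualw p w n) x) `^ (p - 1).
Proof.
move=> p1 w0 xy; set N := (_ - psum (fun n => ind (F n)) x).
set W := (_ - psum (fun n => ind (F n) * w n) x).
set S := (_ - psum (fun n => ind (F n) * dualw p w n) x).
have w0' i := ltW (w0 i).
have sg0 i : 0 <= dualw p w i by exact: powR_ge0.
have /andP[W0 _] := psum_ind_diff F w0' xy; rewrite -/W in W0.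
have /andP[S0 _] := psum_ind_diff F sg0 xy; rewrite -/S in S0.
have N0 : 0 <= N by rewrite subr_ge0; apply: psum_mono => // i _; exact: ind_ge0.
have [NN|NN] := eqVneq N 0.
  by rewrite NN mul0r powR0 ?gt_eqF ?mulr_ge0 ?powR_ge0 //; lra.
have {NN}Np : 0 < N by rewrite lt_neqAle eq_sym NN.
have Wp : 0 < W.
  apply: contrapT => hW; have {hW}W1 : W = 0 by apply/eqP; rewrite eq_le W0 andbT leNgt; exact/negP.
  have none n : (x <= n < y)%N -> ~ F n.
    move=> /andP[xn ny] Fn.
    have : w n <= W.
      have h1 : psum (fun n => ind (F n) * w n) x <= psum (fun n => ind (F n) * w n) n.
        by apply: psum_mono => // i _; rewrite mulr_ge0.
      have h2 : psum (fun n => ind (F n) * w n) n.+1 <= psum (fun n => ind (F n) * w n) y.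
        by apply: psum_mono => // i _; rewrite mulr_ge0.
      by move: h2; rewrite psumS ind1 // mul1r /W; lra.
    by rewrite W1 leNgt w0.
  have : N <= 0.
    rewrite /N -[leRHS](subrr (psum (fun=> 0) x)) -{1}(_ : psum (fun=> 0) y = psum (fun=> 0) x).
      by apply: psum_leB => // i hi; rewrite ind0 //; exact: none.
    by rewrite !psum_cst !mulr0.
  by rewrite leNgt Np.
pose e := 1 / (p - 1); have p10 : 0 < p - 1 by lra.
have e0 : 0 < e by rewrite divr_gt0.
(* Chosen so that the first term is N/2 and can be absorbed. *)
pose s := N / (2 * W).
have s0 : 0 < s by rewrite divr_gt0 // mulr_gt0.
have pt t : 0 < t -> 1 <= t + t `^ (- e).
  move=> t0; have [t1|t1] := leP 1 t; first by rewrite ler_wpDr // powR_ge0.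
  rewrite ler_wpDl ?(ltW t0) // powRN invf_ge1 ?powR_gt0 //.
  have <- : (1 : R) `^ e = 1 by rewrite powR1.
  by apply: ler_powR_base; rewrite ?ltW.
have key : N <= s * W + s `^ (- e) * S.
  have : N <= psum (fun n => s * (ind (F n) * w n) + s `^ (- e) * (ind (F n) * dualw p w n)) y -
     psum (fun n => s * (ind (F n) * w n) + s `^ (- e) * (ind (F n) * dualw p w n)) x.
    apply: psum_leB => // i _; case: (indP R (F i)) => -[_ ->]; last by rewrite !mul0r !mulr0 addr0.
    rewrite !mul1r /dualw -/e -powRM ?(ltW s0) //.
    by apply: pt; rewrite mulr_gt0.
  by rewrite !psumD !psumZ /W /S; move=> h; apply: le_trans h _; rewrite le_eqVlt; apply/orP; left; apply/eqP; ring.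
have eW : s * W = N / 2 by rewrite /s; field; rewrite gt_eqF.
have k2 : N / 2 <= s `^ (- e) * S by rewrite eW in key; lra.
have N2 : 0 <= N / 2 by lra.
have k3 : (N / 2) `^ (p - 1) <= s^-1 * S `^ (p - 1).
  have -> : s^-1 = (s `^ (- e)) `^ (p - 1).
    rewrite -powRrM mulNr /e mul1r mulVf ?gt_eqF // powR_inv1 // ltW //.
  by rewrite -powRM ?powR_ge0 //; apply: ler_powR_base => //; exact: ltW.
have p0 : 0 < p by lra.
rewrite -(mulr_powRB1 N2 p0).
have -> : W * S `^ (p - 1) = N / 2 * (s^-1 * S `^ (p - 1)).
  by rewrite /s; field; rewrite !gt_eqF.
by rewrite ler_wpM2l.
Qed.

(** With l the length of [a, c], F has at least l/16 points, so [holder_count] bounds (l/32)^p by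
    w(F) times a power of the dual mass of [m, c]. Multiplying by the w-mass of [a, m] and using the
    weight condition, l^p cancels. *)
Lemma muckenhoupt_forward (R : realType) (p C : R) (w : nat -> R) : 1 < p -> 0 <= C ->
  (forall i, 0 < w i) -> muckenhoupt3 p C w ->
  forward_comparable (C * 32 `^ p) w.
Proof.
move=> p1 C0 w0 h a m c F am mc cnt.
have mc' : (m <= c.+1)%N by exact: leqW.
have w0' i := ltW (w0 i).
have sg0 i : 0 <= dualw p w i by exact: powR_ge0.
have := holder_count F p1 w0 mc'.
have /andP[W0 _] := psum_ind_diff F w0' mc'.
have /andP[S0 SS] := psum_ind_diff F sg0 mc'.
have H := h a m c am mc.
have A0 : 0 <= psum w m.+1 - psum w a.
  by rewrite subr_ge0; apply: psum_mono => //; exact: leqW.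
have l0 : 0 < (c.+1 - a)%N%:R :> R by rewrite ltr0n; nat_lia.
have p10 : 0 < p - 1 by lra.
move: cnt H W0 S0 SS A0 l0.
move: (psum w m.+1 - _) (psum (dualw p w) c.+1 - _) (_ - psum (fun n => ind (F n)) m)
  (_ - psum (fun n => ind (F n) * w n) m) (_ - psum (fun n => ind (F n) * dualw p w n) m)
  ((c.+1 - a)%N%:R) => A Sg N W S l cnt H W0 S0 SS A0 l0 hold.
have l32 : (l / 32) `^ p <= (N / 2) `^ p by apply: ler_powR_base; lra.
have lp : 0 < (l / 32) `^ p by rewrite powR_gt0 // divr_gt0.
rewrite -(ler_pM2r lp).
have -> : C * 32 `^ p * W * (l / 32) `^ p = C * l `^ p * W.
  have -> : l `^ p = 32 `^ p * (l / 32) `^ p.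
    by rewrite -powRM ?divr_ge0 ?(ltW l0) //; congr (_ `^ _); field.
  by ring.
have s1 : S `^ (p - 1) <= Sg `^ (p - 1) by apply: ler_powR_base => //; exact: ltW.
have h1 := ler_wpM2l A0 (le_trans l32 hold).
have h2 := ler_wpM2l (mulr_ge0 A0 W0) s1.
have h3 := ler_wpM2r W0 H.
lra.
Qed.

Lemma muckenhoupt_backward (R : realType) (p C : R) (w : nat -> R) : 1 < p -> 0 <= C ->
  (forall i, 0 < w i) -> muckenhoupt3 p C w ->
  forall (a m c : nat) (F : nat -> Prop), (a <= m)%N -> (m <= c)%N ->
  (c.+1 - a)%N%:R <= 16 * (psum (fun n => @ind R (F n)) m.+1 - psum (fun n => ind (F n)) a) ->
  psum (dualw p w) c.+1 - psum (dualw p w) m <=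
  (C * 32 `^ p) `^ (p - 1)^-1 *
  (psum (fun n => ind (F n) * dualw p w n) m.+1 - psum (fun n => ind (F n) * dualw p w n) a).
Proof.
move=> p1 C0 w0 h a m c F am mc cnt.
have am' : (a <= m.+1)%N by exact: leqW.
have w0' i := ltW (w0 i).
have sg0 i : 0 <= dualw p w i by exact: powR_ge0.
have := holder_count F p1 w0 am'.
have /andP[W0 WW] := psum_ind_diff F w0' am'.
have /andP[S0 _] := psum_ind_diff F sg0 am'.
have H := h a m c am mc.
have A0 : 0 <= psum (dualw p w) c.+1 - psum (dualw p w) m.
  by rewrite subr_ge0; apply: psum_mono => //; exact: leqW.
have l0 : 0 < (c.+1 - a)%N%:R :> R by rewrite ltr0n; nat_lia.
have p10 : 0 < p - 1 by lra.
move: cnt H W0 WW S0 A0 l0.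
move: (psum w m.+1 - _) (psum (dualw p w) c.+1 - _) (_ - psum (fun n => ind (F n)) a)
  (_ - psum (fun n => ind (F n) * w n) a) (_ - psum (fun n => ind (F n) * dualw p w n) a)
  ((c.+1 - a)%N%:R) => Wt Sg N W S l cnt H W0 WW S0 A0 l0 hold.
have l32 : (l / 32) `^ p <= (N / 2) `^ p by apply: ler_powR_base; lra.
have lp : 0 < (l / 32) `^ p by rewrite powR_gt0 // divr_gt0.
have C320 : 0 <= C * 32 `^ p by rewrite mulr_ge0 // powR_ge0.
have goal2 : Sg `^ (p - 1) <= C * 32 `^ p * S `^ (p - 1).
  rewrite -(ler_pM2r lp).
  have -> : C * 32 `^ p * S `^ (p - 1) * (l / 32) `^ p = C * l `^ p * S `^ (p - 1).
    have -> : l `^ p = 32 `^ p * (l / 32) `^ p.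
      by rewrite -powRM ?divr_ge0 ?(ltW l0) //; congr (_ `^ _); field.
    by ring.
  have h1 := ler_wpM2l (powR_ge0 Sg (p - 1)) (le_trans l32 hold).
  have h2 := ler_wpM2r (mulr_ge0 (powR_ge0 Sg (p - 1)) (powR_ge0 S (p - 1))) WW.
  have h3 := ler_wpM2r (powR_ge0 S (p - 1)) H.
  lra.
have pn : p - 1 != 0 by rewrite gt_eqF.
rewrite leNgt; apply/negP => bad; move: goal2; rewrite leNgt => /negP; apply.
rewrite -{1}(powR_root pn C320) -powRM ?powR_ge0 //.
by apply: ltr_powR_base => //; rewrite mulr_ge0 // powR_ge0.
Qed.

(** * One-sided maximal function *)

(** Discrete layer cake: the levels below x form a geometric progression dominated by its last term,
    which is at most x^s. *)
Lemma layer_sum (R : realType) (B s c x : R) J : 1 < B -> 0 < s -> 0 < c -> 0 <= x ->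
  psum (fun j => (c * B ^+ j) `^ s * ind (c * B ^+ j < x)) J <=
  (1 - (B `^ s)^-1)^-1 * x `^ s.
Proof.
move=> B1 s0 c0 x0.
have B0 : 0 < B by lra.
have Bs : 1 < B `^ s.
  have <- : (1 : R) `^ s = 1 by rewrite powR1.
  by apply: ltr_powR_base; lra.
have Bs0 : 0 < B `^ s by lra.
have K0 : 0 < 1 - (B `^ s)^-1 by rewrite subr_gt0 invf_lt1.
set K := (1 - (B `^ s)^-1)^-1.
have KP : 0 < K by rewrite invr_gt0.
have eK : 1 + K * (B `^ s)^-1 = K.
  by rewrite /K; field; rewrite !gt_eqF //= subr_gt0.
pose y j := (c * B ^+ j) `^ s.
have yS j : y j.+1 * (B `^ s)^-1 = y j.
  have e : (B * (c * B ^+ j)) `^ s = B `^ s * (c * B ^+ j) `^ s by rewrite powRM; nng.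
  by rewrite /y exprS mulrCA e mulrC mulKf // gt_eqF.
have y0 j : 0 <= y j := powR_ge0 _ _.
have A n : psum (fun j => y j * ind (c * B ^+ j < x)) n <= K * (B `^ s)^-1 * y n.
  elim: n => [|n IH]; first by rewrite psum0; nng.
  rewrite psumS.
  have h1 : y n * ind (c * B ^+ n < x) <= y n by rewrite ler_piMr // ind_le1.
  have -> : K * (B `^ s)^-1 * y n.+1 = K * y n by rewrite -(yS n); ring.
  by rewrite -[X in X * y n]eK mulrDl mul1r addrC lerD.
elim: J => [|J IH]; first by rewrite psum0; nng.
rewrite psumS; case: (indP R (c * B ^+ J < x)) => -[h eh]; last by rewrite eh mulr0 addr0.
apply: (@le_trans _ _ (K * y J)).
  have := A J.+1; rewrite psumS -/(y J).
  by have -> : K * (B `^ s)^-1 * y J.+1 = K * y J by rewrite -(yS J); ring.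
rewrite ler_wpM2l ?(ltW KP) //; apply: ler_powR_base; [exact: ltW| |exact: ltW].
by rewrite mulr_ge0 ?exprn_ge0 // ltW.
Qed.

(** Only finitely many values occur, so finitely many levels suffice. The lowest one can be taken
    below any [c0], which later makes the bottom layer negligible. *)
Lemma layer_cover (R : realType) (B c0 : R) (X : nat -> R) L : 1 < B -> 0 < c0 ->
  exists c J, [/\ 0 < c, c <= c0 &
    forall n, (n < L)%N -> 0 < X n -> c < X n <= c * B ^+ J].
Proof.
move=> B1 c00; have B0 : 0 < B by lra.
elim: L => [|L [c [J [cp cc h]]]].
  by exists c0, 0%N; split.
have [x0|x0] := leP (X L) 0.
  exists c, J; split => // n; rewrite ltnS leq_eqVlt => /orP[/eqP ->|nL] Xn; last exact: h.
  by move: Xn; rewrite ltNge x0.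
pose c' := Num.min c (X L / 2).
have c'0 : 0 < c' by rewrite lt_min cp divr_gt0.
have c'1 : c' <= c by rewrite ge_min lexx.
have c'2 : c' <= X L / 2 by rewrite ge_min lexx orbT.
have [J' hJ'] := @expr_unbounded R B (Num.max (c * B ^+ J) (X L) / c') B1.
rewrite ler_pdivrMr // ge_max [_ * c']mulrC in hJ'; have /andP[j1 j2] := hJ'.
exists c', J'; split => //; first exact: le_trans cc.
move=> n; rewrite ltnS leq_eqVlt => /orP[/eqP ->|nL] Xn.
  by rewrite j2 andbT; lra.
have /andP[a1 a2] := h n nL Xn.
by rewrite (le_lt_trans c'1 a1) (le_trans a2 j1).
Qed.

Lemma layer_pick (R : realType) (B c x : R) J : c < x -> x <= c * B ^+ J ->
  exists2 j, (j < J)%N & c * B ^+ j < x <= c * B ^+ j.+1.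
Proof.
move=> cx; elim: J => [|J IH] h.
  by move: h; rewrite expr0 mulr1 leNgt cx.
have [h2|h2] := leP x (c * B ^+ J).
  by have [j jJ hj] := IH h2; exists j => //; rewrite ltnS ltnW.
by exists J; rewrite ?ltnSn ?h2.
Qed.

Lemma layer_bound (R : realType) (B s c x : R) J : 1 < B -> 0 < s -> 0 < c ->
  c < x -> x <= c * B ^+ J ->
  x `^ s <= B `^ s * psum (fun j => (c * B ^+ j) `^ s *
     ind (c * B ^+ j < x /\ ~ (c * B ^+ j.+1 < x))) J.
Proof.
move=> B1 s0 c0 cx xJ; have B0 : 0 < B by lra.
have [j jJ /andP[h1 h2]] := layer_pick cx xJ.
have p0 i : 0 <= c * B ^+ i by rewrite mulr_ge0 ?exprn_ge0 // ltW.
apply: (@le_trans _ _ (B `^ s * (c * B ^+ j) `^ s)).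
  rewrite -powRM ?(ltW B0) //; apply: ler_powR_base; [exact: ltW| |].
    by have := p0 0%N; rewrite expr0; lra.
  by move: h2; rewrite exprS mulrCA.
rewrite ler_wpM2l ?powR_ge0 //.
pose F i := (c * B ^+ i) `^ s * ind (c * B ^+ i < x /\ ~ (c * B ^+ i.+1 < x)).
apply: le_trans (@psum_term R F j J jJ _); last by move=> i _; rewrite mulr_ge0 ?powR_ge0.
by rewrite /F ind1 ?mulr1 //; split => //; apply/negP; rewrite -leNgt.
Qed.

(* Two-sided maximal function of [f / sg] with respect to the measure [sg]. *)
Definition smax (R : realType) (f sg : nat -> R) (L y : nat) : R :=
  \big[Num.max/0]_(i < L.+1) \big[Num.max/0]_(j < L.+1)
    (if (i <= y < j)%N then (psum f j - psum f i) / (psum sg j - psum sg i) else 0).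

Lemma smax_ge (R : realType) (f sg : nat -> R) L y u v :
  (u <= y < v)%N -> (v <= L)%N ->
  (psum f v - psum f u) / (psum sg v - psum sg u) <= smax f sg L y.
Proof.
move=> uyv vL; have uL : (u < L.+1)%N by nat_lia.
apply: le_trans (le_bigmax _ _ (Ordinal uL)) => /=.
apply: le_trans (le_bigmax _ _ (Ordinal (vL : (v < L.+1)%N))) => /=.
by rewrite uyv.
Qed.

Lemma smax_ge0 (R : realType) (f sg : nat -> R) L y : 0 <= smax f sg L y.
Proof. exact: bigmax_ge_id. Qed.

Lemma smax_gt (R : realType) (f sg : nat -> R) L y mu : 0 <= mu ->
  (forall i, 0 < sg i) -> mu < smax f sg L y ->
  exists u v, [/\ (u <= y < v)%N, (v <= L)%N &
    mu * (psum sg v - psum sg u) < psum f v - psum f u].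
Proof.
move=> mu0 sg0 h; apply: contrapT => hn; move: h; rewrite ltNge => /negP; apply.
apply: bigmax_le => // i _; apply: bigmax_le => // j _.
case: ifP => // ij; rewrite leNgt; apply/negP => bad; apply: hn.
exists i, j; split => //; first by rewrite -ltnS.
rewrite -ltr_pdivlMr // subr_gt0.
case/andP: ij => iy yj.
apply: (@lt_le_trans _ _ (psum sg i.+1)); first by rewrite psumS ltrDl.
by apply: psum_mono => [|k _]; [exact: leq_ltn_trans yj|exact: ltW].
Qed.

(** If the ratio over [u, v) exceeds mu, then the ratio over [y, v) or over [u, y] exceeds mu/2.
    Each side is one rising sun estimate, the left one after reflection, and 4 = 2 * 2. *)
Lemma smax_weak (R : realType) (f sg : nat -> R) L mu : 0 < mu ->
  (forall i, 0 < sg i) -> (forall i, 0 <= f i) -> (forall i, (L <= i)%N -> f i = 0) ->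
  mu * psum (fun y => ind (mu < smax f sg L y) * sg y) L <= 4 * psum f L.
Proof.
move=> mu0 sg0 f0 fL.
pose T (g : nat -> R) n := mu / 2 * g n.
have mu20 : 0 <= mu / 2 by lra.
have T0 g : (forall i, 0 < g i) -> forall i, 0 <= T g i.
  by move=> g0 i; rewrite mulr_ge0 // ltW.
have w1 := weak_max f0 (T0 _ sg0) fL.
(* Truncated subtraction sends every n >= L to 0, so the reflected f is cut off at L; the reflected
   [sg] stays positive everywhere, as required. *)
pose rv (g : nat -> R) n := g (L - n.+1)%N.
pose fr n := ind (n < L)%N * rv f n.
have fr0 i : 0 <= fr i by rewrite /fr mulr_ge0 ?ind_ge0 // /rv.
have frL i : (L <= i)%N -> fr i = 0.
  by move=> Li; rewrite /fr ind0 ?mul0r //; apply/negP; rewrite -leqNgt.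
have rsg0 i : 0 < rv sg i := sg0 _.
have w2 := weak_max fr0 (T0 _ rsg0) frL.
have flip (g : nat -> R) x y : (x <= y)%N -> (y <= L)%N ->
    psum (rv g) y - psum (rv g) x = psum g (L - x) - psum g (L - y).
  move=> xy; elim: y xy => [|y IH].
    by rewrite leqn0 => /eqP -> _; rewrite !subrr.
  rewrite leq_eqVlt => /orP[/eqP -> _|]; first by rewrite !subrr.
  rewrite ltnS => xy yL; rewrite psumS addrAC IH ?(ltnW yL) //.
  have -> : (L - y = (L - y.+1).+1)%N by nat_lia.
  by rewrite psumS /rv; ring.
have fre x y : (x <= y)%N -> (y <= L)%N -> psum fr y - psum fr x = psum f (L - x) - psum f (L - y).
  move=> xy yL; rewrite -flip //.
  have e t : (t <= L)%N -> psum fr t = psum (rv f) t.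
    by move=> tL; apply: psum_eq => i it; rewrite /fr ind1 ?mul1r // (leq_trans it).
  by rewrite !e // (leq_trans xy).
have S1 : psum fr L = psum f L.
  by have := fre 0%N L (leq0n _) (leqnn _); rewrite subn0 subnn !psum0 !subr0.
pose P2 y := above fr (T (rv sg)) (L - y.+1)%N.
have S2 : psum (fun y => ind (P2 y) * T sg y) L <= psum f L.
  rewrite -S1; apply: le_trans w2; rewrite le_eqVlt; apply/orP; left; apply/eqP.
  have := flip (fun y => ind (P2 y) * T sg y) 0%N L (leq0n _) (leqnn _).
  rewrite subn0 subnn !psum0 !subr0 => <-; apply: psum_eq => i iL.
  by rewrite /rv /P2 (_ : L - (L - i.+1).+1 = i)%N //; nat_lia.
have pw y : (y < L)%N -> ind (mu < smax f sg L y) * sg y <=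
    2 / mu * (ind (above f (T sg) y) * T sg y + ind (P2 y) * T sg y).
  move=> yL; rewrite -mulrDl /T.
  have -> : 2 / mu * ((ind (above f (T sg) y) + ind (P2 y)) * (mu / 2 * sg y)) =
    (ind (above f (T sg) y) + ind (P2 y)) * sg y by field; rewrite gt_eqF.
  rewrite ler_wpM2r ?(ltW (sg0 _)) //.
  case: (indP R (mu < smax f sg L y)) => -[h ->]; last by rewrite addr_ge0.
  have [u [v [/andP[uy yv] vL huv]]] := smax_gt (ltW mu0) sg0 h.
  have [hr|hr] := ltP (mu / 2 * (psum sg v - psum sg y)) (psum f v - psum f y).
    rewrite ind1 ?lerDl ?ind_ge0 //; exists v; split => //.
    by rewrite /T !psumZ -mulrBr.
  rewrite [X in _ <= _ + X]ind1 ?lerDr ?ind_ge0 //; exists (L - u)%N; split; first by nat_lia.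
  rewrite /T !psumZ -mulrBr flip; [|nat_lia|nat_lia].
  rewrite fre; [|nat_lia|nat_lia].
  have -> : (L - (L - y.+1) = y.+1)%N by nat_lia.
  have -> : (L - (L - u) = u)%N by nat_lia.
  rewrite !psumS; have h3 := f0 y; have h4 := sg0 y.
  have h5 : psum sg y.+1 <= psum sg v by apply: psum_mono => // i _; exact: ltW.
  rewrite psumS in h5.
  have h6 : psum sg u <= psum sg y by apply: psum_mono => // i _; exact: ltW.
  move: mu0 mu20 huv hr h3 h4 h5 h6; clear; move: (psum f v) (psum f u) (psum sg v) (psum sg u).
  move: (psum f y) (psum sg y) (f y) (sg y) => a b c d fv fu sv su mu0 mu20 huv hr h3 h4 h5 h6.
  have : mu / 2 * (b + d) <= mu / 2 * sv by rewrite ler_wpM2l.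
  have : mu / 2 * su <= mu / 2 * b by rewrite ler_wpM2l.
  lra.
rewrite -(psumZ mu).
apply: (@le_trans _ _ (psum (fun y => 2 * (ind (above f (T sg) y) * T sg y + ind (P2 y) * T sg y)) L)).
  apply: psum_le => y yL; have := ler_wpM2l (ltW mu0) (pw y yL).
  by rewrite [mu * (2 / mu * _)]mulrA (_ : mu * (2 / mu) = 2) //; field; rewrite gt_eqF.
by rewrite psumZ psumD; lra.
Qed.

(** Marcinkiewicz interpolation: at level lev, f is truncated to {f/sg > lev/2}, since the rest
    contributes at most lev/2 to any ratio; then the weak bounds are summed over the levels 2^j. *)
Lemma smax_strong (R : realType) (p : R) : 1 < p -> exists2 C : R, 0 <= C &
  forall (f sg : nat -> R) L,
  (forall i, 0 < sg i) -> (forall i, 0 <= f i) -> (forall i, (L <= i)%N -> f i = 0) ->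
  psum (fun y => smax f sg L y `^ p * sg y) L <=
  C * psum (fun y => (f y / sg y) `^ p * sg y) L.
Proof.
move=> p1; have p0 : 0 < p by lra.
have p10 : 0 < p - 1 by lra.
have two1 : (1 : R) < 2 by lra.
have two0 : (0 : R) < 2 by lra.
pose K := (1 - ((2 : R) `^ (p - 1))^-1)^-1.
have K0 : 0 <= K.
  have h := @layer_sum R 2 (p - 1) 1 1 0 two1 p10 ltr01 ler01.
  by rewrite psum0 powR1 mulr1 in h.
exists (2 `^ p * (8 * (K * 2 `^ (p - 1)))); first by rewrite !mulr_ge0 ?powR_ge0.
move=> f sg L sg0 f0 fL.
have [c [J [c0 _ hc]]] := @layer_cover R 2 1 (smax f sg L) L two1 ltr01.
pose lev j := c * 2 ^+ j.
have lev0 j : 0 < lev j by rewrite mulr_gt0 // exprn_gt0.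
have step j : psum (fun y => ind (lev j < smax f sg L y) * sg y) L <=
    8 / lev j * psum (fun y => f y * ind (lev j < 2 * (f y / sg y))) L.
  pose fm n := f n * ind (lev j < 2 * (f n / sg n)).
  have fm0 i : 0 <= fm i by rewrite mulr_ge0.
  have fmL i : (L <= i)%N -> fm i = 0 by move=> Li; rewrite /fm fL // mul0r.
  have h2 : 0 < lev j / 2 by rewrite divr_gt0.
  have w := smax_weak h2 sg0 fm0 fmL.
  have : psum (fun y => ind (lev j < smax f sg L y) * sg y) L <=
     psum (fun y => ind (lev j / 2 < smax fm sg L y) * sg y) L.
    apply: psum_le => y yL; rewrite ler_wpM2r ?(ltW (sg0 _)) //; apply: ind_imp => hy.
    have [u [v [uyv vL huv]]] := smax_gt (ltW (lev0 j)) sg0 hy.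
    apply: lt_le_trans (smax_ge fm sg uyv vL).
    have uv : (u <= v)%N by case/andP: uyv => a b; exact: leq_trans a (ltnW b).
    have sp : 0 < psum sg v - psum sg u.
      rewrite subr_gt0; case/andP: uyv => a b.
      apply: (@lt_le_trans _ _ (psum sg u.+1)); first by rewrite psumS ltrDl.
      by apply: psum_mono => [|k _]; [exact: leq_ltn_trans b|exact: ltW].
    rewrite ltr_pdivlMr //.
    have : psum f v - psum f u <= psum (fun n => fm n + lev j / 2 * sg n) v -
        psum (fun n => fm n + lev j / 2 * sg n) u.
      apply: psum_leB => // i _; rewrite /fm.
      case: (indP R (lev j < 2 * (f i / sg i))) => -[h ->].
        by rewrite mulr1 lerDl mulr_ge0 // ltW.
      rewrite mulr0 add0r; move/negP: h; rewrite -leNgt mulrA ler_pdivrMr // => h; lra.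
    by rewrite !psumD !psumZ; lra.
  move=> h; apply: le_trans h _.
  rewrite [8 / _ * _]mulrAC ler_pdivlMr //; move: w; rewrite -/fm.
  by move: (psum _ _) (psum _ _) => a b; lra.
apply: (@le_trans _ _ (2 `^ p * psum (fun j => lev j `^ p *
     psum (fun y => ind (lev j < smax f sg L y) * sg y) L) J)).
  have -> : psum (fun j => lev j `^ p * psum (fun y => ind (lev j < smax f sg L y) * sg y) L) J =
     psum (fun y => psum (fun j => lev j `^ p * (ind (lev j < smax f sg L y) * sg y)) J) L.
    by rewrite psum_exch; apply: psum_eq => j _; rewrite psumZ.
  rewrite -psumZ; apply: psum_le => y yL.
  have -> : psum (fun j => lev j `^ p * (ind (lev j < smax f sg L y) * sg y)) J =
     psum (fun j => lev j `^ p * ind (lev j < smax f sg L y)) J * sg y.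
    by rewrite mulrC -psumZ; apply: psum_eq => j _; ring.
  rewrite mulrA ler_wpM2r ?(ltW (sg0 _)) //.
  have [z|z] := leP (smax f sg L y) 0.
    have -> : smax f sg L y = 0 by apply/eqP; rewrite eq_le z smax_ge0.
    rewrite powR0 ?gt_eqF // mulr_ge0 ?powR_ge0 // psum_ge0 // => j _.
    by rewrite mulr_ge0 ?powR_ge0.
  have /andP[h1 h2] := hc y yL z.
  apply: le_trans (layer_bound two1 p0 c0 h1 h2) _.
  rewrite ler_wpM2l ?powR_ge0 //; apply: psum_le => j _.
  by rewrite ler_wpM2l ?powR_ge0 //; apply: ind_imp => -[].
rewrite -!mulrA ler_wpM2l ?powR_ge0 //.
apply: (@le_trans _ _ (psum (fun j => 8 * psum (fun y => lev j `^ (p - 1) * (f y * ind (lev j < 2 * (f y / sg y)))) L) J)).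
  apply: psum_le => j _; apply: le_trans (ler_wpM2l (powR_ge0 _ _) (step j)) _.
  rewrite -(mulr_powRB1 (ltW (lev0 j)) p0) psumZ.
  rewrite le_eqVlt; apply/orP; left; apply/eqP; field.
  by rewrite gt_eqF.
rewrite psumZ ler_wpM2l // psum_exch -psumZ -psumZ; apply: psum_le => y yL.
have -> : psum (fun j => lev j `^ (p - 1) * (f y * ind (lev j < 2 * (f y / sg y)))) J =
   f y * psum (fun j => lev j `^ (p - 1) * ind (lev j < 2 * (f y / sg y))) J.
  by rewrite -psumZ; apply: psum_eq => j _; ring.
have fs0 : 0 <= f y / sg y by rewrite divr_ge0 // ltW.
have := @layer_sum R 2 (p - 1) c (2 * (f y / sg y)) J two1 p10 c0 (mulr_ge0 (ltW two0) fs0).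
rewrite -/K powRM // => h; apply: le_trans (ler_wpM2l (f0 y) h) _.
rewrite -(mulr_powRB1 fs0 p0) le_eqVlt; apply/orP; left; apply/eqP; field.
by rewrite gt_eqF.
Qed.

(** If a window [n, t) has average above 16 lam, then 16 (t - n) < t - x, since x is not [above]; so
    t <= 2z - x. Only the mass of [x, 2z - x), at most 2 lam (z - x), matters, and the weak type
    bound at level 16 lam gives 1/8. *)
Lemma above_sparse (R : realType) (f : nat -> R) (lam : R) x z : 0 < lam ->
  (forall i, 0 <= f i) -> ~ above f (fun=> lam) x -> (x <= z)%N ->
  psum (fun n => @ind R (above f (fun=> 16 * lam) n)) z -
  psum (fun n => @ind R (above f (fun=> 16 * lam) n)) x <= (z - x)%N%:R / 8.
Proof.
move=> l0 f0 nx xz; pose L := (2 * z - x)%N.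
pose f' n := ind (x <= n < L)%N * f n.
have f'0 i : 0 <= f' i by rewrite mulr_ge0 // ind_ge0.
have f'L i : (L <= i)%N -> f' i = 0.
  by move=> Li; rewrite /f' ind0 ?mul0r // => /andP[_]; rewrite ltnNge Li.
have l16 : 0 < 16 * lam by lra.
have F_mono s t : (s <= t)%N -> psum f s <= psum f t by move=> st; apply: psum_mono.
have w := @weak_max R f' (fun=> 16 * lam) L f'0 (fun=> ltW l16) f'L.
have xL : (x <= L)%N by rewrite /L; nat_lia.
have zL : (z <= L)%N by rewrite /L; nat_lia.
have tot : psum f' L <= lam * (2 * (z - x)%N%:R).
  have e1 : psum f' L - psum f' x <= psum f L - psum f x.
    by apply: psum_leB => // i _; rewrite /f' ler_piMl // ind_le1.
  have e2 : psum f' x = 0.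
    rewrite (@psum_eq _ _ (fun=> 0)) ?psum_cst ?mulr0 // => i ix.
    by rewrite /f' ind0 ?mul0r // => /andP[]; rewrite leqNgt ix.
  have e3 := not_above nx xL.
  rewrite -natrM (_ : 2 * (z - x) = L - x)%N; last by rewrite /L; nat_lia.
  lra.
have ab n : (x <= n < z)%N -> above f (fun=> 16 * lam) n -> above f' (fun=> 16 * lam) n.
  move=> /andP[xn nz] [t [nt ht]]; exists t; split => //.
  rewrite !psum_cst -mulrBl -natrB ?(ltnW nt) // in ht *.
  have xt : (x <= t)%N by exact: leq_trans xn (ltnW nt).
  have h1 := not_above nx xt.
  have h2 := F_mono _ _ xn.
  have h3 : 16 * (t - n)%N%:R < (t - x)%N%:R :> R.
    by rewrite -(ltr_pM2l l0); lra.
  rewrite -natrM ltr_nat in h3.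
  have tL : (t <= L)%N by rewrite /L; nat_lia.
  apply: lt_le_trans ht _; apply: psum_leB => [|i /andP[i1 i2]]; first exact: ltnW.
  rewrite /f' ind1 ?mul1r //; apply/andP; split; first exact: leq_trans i1.
  exact: leq_trans i2 tL.
have cnt : psum (fun n => @ind R (above f (fun=> 16 * lam) n)) z -
    psum (fun n => @ind R (above f (fun=> 16 * lam) n)) x <=
    psum (fun n => @ind R (above f' (fun=> 16 * lam) n)) L.
  apply: (@le_trans _ _ (psum (fun n => @ind R (above f' (fun=> 16 * lam) n)) z -
    psum (fun n => @ind R (above f' (fun=> 16 * lam) n)) x)).
    by apply: psum_leB => // i ixz; apply: ind_imp; exact: ab.
  have a1 : psum (fun n => @ind R (above f' (fun=> 16 * lam) n)) z <=
    psum (fun n => @ind R (above f' (fun=> 16 * lam) n)) L.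
    by apply: psum_mono => // i _; exact: ind_ge0.
  have a2 : 0 <= psum (fun n => @ind R (above f' (fun=> 16 * lam) n)) x.
    by apply: psum_ge0 => i _; exact: ind_ge0.
  lra.
apply: le_trans cnt _; rewrite -(ler_pM2l l16) -psumZ.
rewrite (@psum_eq _ _ (fun t => ind (above f' (fun=> 16 * lam) t) * (16 * lam))).
  by apply: le_trans w _; apply: le_trans tot _; lra.
by move=> i _; rewrite mulrC.
Qed.

Lemma psum_slide (R : realType) (g : nat -> R) x i j : (0 < i)%N -> (i <= j)%N ->
  psum (fun d => g (d - 1 + x)%N) j - psum (fun d => g (d - 1 + x)%N) i =
  psum g (j - 1 + x) - psum g (i - 1 + x).
Proof.
move=> i0; elim: j => [|j IH]; first by rewrite leqn0 => /eqP e; rewrite e in i0.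
rewrite leq_eqVlt => /orP[/eqP <-|]; first by rewrite !subrr.
rewrite ltnS => ij; rewrite psumS addrAC IH //.
have -> : (j.+1 - 1 + x = (j - 1 + x).+1)%N by nat_lia.
by rewrite psumS; ring.
Qed.

Definition backward_comparable (R : realType) (D : R) (sg : nat -> R) : Prop :=
  forall (a m c : nat) (F : nat -> Prop), (a <= m)%N -> (m <= c)%N ->
  (c.+1 - a)%N%:R <= 16 * (psum (fun n => @ind R (F n)) m.+1 - psum (fun n => ind (F n)) a) ->
  psum sg c.+1 - psum sg m <=
  D * (psum (fun n => ind (F n) * sg n) m.+1 - psum (fun n => ind (F n) * sg n) a).

(** Mirror image of the ring argument, with rings growing to the right from x: each is compared with
    the good points of the previous one, which are dense by [above_sparse]. The index d = 1 of
    [ring_sum] is the point x itself. *)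
Lemma backward_dense (R : realType) (D : R) (f sg : nat -> R) (lam : R) x b : 0 <= D ->
  (forall i, 0 <= sg i) -> backward_comparable D sg -> 0 < lam ->
  (forall i, 0 <= f i) -> ~ above f (fun=> lam) x -> (x < b)%N ->
  psum sg b - psum sg x <=
  (D + 1) * (psum (fun n => ind (~ above f (fun=> 16 * lam) n) * sg n) b -
             psum (fun n => ind (~ above f (fun=> 16 * lam) n) * sg n) x).
Proof.
move=> D0 sg0 hD l0 f0 nx xb.
have sp := above_sparse l0 f0 nx.
pose E n := above f (fun=> 16 * lam) n.
pose T := (b - x)%N; have T0 : (0 < T)%N by rewrite subn_gt0.
have := @ring_sum R (fun d => sg (d - 1 + x)%N)
  (fun d => ind (~ E (d - 1 + x)%N) * sg (d - 1 + x)%N) D T.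
rewrite (psum_slide sg) // (psum_slide (fun n => ind (~ E n) * sg n)) //.
have -> : (T.+1 - 1 + x = b)%N by rewrite /T; nat_lia.
rewrite subnn add0n; apply => //.
- by move=> d; rewrite mulr_ge0 ?ind_ge0.
- have nE : ~ E (1 - 1 + x)%N; last by rewrite ind1 // mul1r.
  move=> Ex; have := sp x.+1 (leqnSn _); rewrite psumS ind1 // addrAC subrr add0r.
  by rewrite subSnn ler_pdivlMr // mul1r ler_nat.
move=> r rT.
have p0 := pow2_gt0 r.
have e1 : (2 ^ r.+1 = 2 * 2 ^ r)%N by rewrite expnS.
have e2 : (2 ^ r.+2 = 4 * 2 ^ r)%N by rewrite !expnS; nat_lia.
rewrite {}e1 {}e2 in rT *; move: (2 ^ r)%N p0 rT => h h0 rT.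
rewrite (psum_slide sg); [|nat_lia|nat_lia].
rewrite (psum_slide (fun n => ind (~ E n) * sg n)); [|nat_lia|nat_lia].
set m := (2 * h - 1 + x)%N; set a := (h - 1 + x)%N; set c' := (minn (4 * h) T.+1 - 1 + x)%N.
have am : (a < m)%N by rewrite /a /m; nat_lia.
have mc : (m < c')%N by rewrite /m /c'; nat_lia.
pose F n := ~ E n /\ (n < m)%N.
have ec : c' = c'.-1.+1 by rewrite prednK // (leq_ltn_trans _ mc).
have := hD a m c'.-1 F (ltnW am) ltac:(rewrite -ltnS -ec; exact: mc).
rewrite -ec => hfw; apply: le_trans (hfw _) _.
  have cnt : psum (fun n => @ind R (F n)) m.+1 - psum (fun n => @ind R (F n)) a >=
      h%:R - (2 * h - 1)%N%:R / 8.
    have -> : psum (fun n => @ind R (F n)) m.+1 = psum (fun n => @ind R (F n)) m.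
      by rewrite psumS ind0 ?addr0 // /F ltnn => -[].
    have : psum (fun n => 1 - ind (E n)) m - psum (fun n => 1 - ind (E n)) a
        <= psum (fun n => @ind R (F n)) m - psum (fun n => @ind R (F n)) a.
      apply: psum_leB => [|i /andP[i1 i2]]; first exact: ltnW.
      case: (indP R (E i)) => -[hE ->]; first by rewrite subrr ind_ge0.
      by rewrite subr0 /F ind1.
    apply: le_trans; rewrite !psumB !psum_cst !mulr1.
    have hh : m%:R - a%:R = h%:R :> R.
      by rewrite -natrB ?(ltnW am) //; congr (_%:R); rewrite /m /a; nat_lia.
    have c2 := sp m ltac:(rewrite /m; exact: leq_addl).
    have c3 : psum (fun n => @ind R (E n)) x <= psum (fun n => @ind R (E n)) a.
      by apply: psum_mono => [|i _]; [rewrite /a leq_addl|exact: ind_ge0].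
    have c4 : (m - x = 2 * h - 1)%N by rewrite /m addnK.
    rewrite c4 -/E in c2.
    have : psum (fun n => @ind R (E n)) m - psum (fun n => @ind R (E n)) x <= (2 * h - 1)%N%:R / 8 := c2.
    move: c3 hh; move: (psum _ _) (psum _ _) (psum _ _) => s1 s2 s3; lra.
  have k1 : (c' - a)%N%:R <= 3 * h%:R :> R.
    by rewrite -natrM ler_nat /c' /a; nat_lia.
  have k2 : (2 * h - 1)%N%:R <= 2 * h%:R :> R by rewrite -natrM ler_nat leq_subr.
  have k3 : 0 < h%:R :> R by rewrite ltr0n.
  lra.
apply: ler_wpM2l => //.
have -> : psum (fun n => ind (F n) * sg n) m.+1 = psum (fun n => ind (F n) * sg n) m.
  by rewrite psumS ind0 ?mul0r ?addr0 // /F ltnn => -[].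
apply: psum_leB => [|i _]; first exact: ltnW.
by rewrite ler_wpM2r //; apply: ind_imp => -[].
Qed.

(** From n one moves to a witness t of [above]. If t < b the argument continues from t; if t >= b
    the excess beyond b has average at most lam and can be removed. *)
Lemma run_average (R : realType) (f : nat -> R) (lam : R) a b :
  (forall n, (a <= n < b)%N -> above f (fun=> lam) n) -> ~ above f (fun=> lam) b ->
  forall n, (a <= n <= b)%N -> lam * (b - n)%N%:R <= psum f b - psum f n.
Proof.
move=> hab nb; suff H k n : (b - n <= k)%N -> (a <= n <= b)%N ->
    lam * (b - n)%N%:R <= psum f b - psum f n by move=> n; exact: H (leqnn _).
elim: k n => [|k IH] n bn /andP[an nbb].
  have -> : n = b by nat_lia.
  by rewrite subnn mulr0 subrr.
move: nbb; rewrite leq_eqVlt => /orP[/eqP ->|nltb]; first by rewrite subnn mulr0 subrr.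
have [t [nt]] := hab n ltac:(by rewrite an nltb).
rewrite !psum_cst -mulrBl -natrB ?(ltnW nt) // => ht.
have [bt|tb] := leqP b t.
  have := not_above nb bt.
  have -> : (b - n)%N%:R = (t - n)%N%:R - (t - b)%N%:R :> R.
    by rewrite -natrB; [congr (_%:R); nat_lia|nat_lia].
  lra.
have := IH t ltac:(nat_lia) ltac:(by rewrite (leq_trans an) ltnW).
have -> : (b - n)%N%:R = (t - n)%N%:R + (b - t)%N%:R :> R.
  by rewrite -natrD; congr (_%:R); nat_lia.
lra.
Qed.

(** A stopping argument along the run. From a point x where the maximal function is at most 16 lam,
    one goes to the point x' at which half of the dual mass, restricted to {maximal function at most
    256 lam}, has been used up. The remaining half enters the weight condition and controls w on [x,
    x'); the used half lies in [x, x') and pays for it through [A]. The process restarts at x', so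
    the payments are disjoint. *)
Lemma run_estimate (R : realType) (p C D lam : R) (w f A : nat -> R) a b :
  1 < p -> 0 <= C -> 0 <= D -> (forall i, 0 < w i) ->
  muckenhoupt3 p C w -> backward_comparable D (dualw p w) ->
  (forall i, 0 <= f i) -> 0 < lam -> (forall n, 0 <= A n) ->
  (forall n, (a <= n < b)%N -> above f (fun=> lam) n) -> ~ above f (fun=> lam) b ->
  (forall x y, (a <= x)%N -> (x <= y)%N -> (y < b)%N ->
     psum f b - psum f x <= A y * (psum (dualw p w) b - psum (dualw p w) x)) ->
  (a < b)%N ->
  lam `^ p * (psum (fun n => ind (~ above f (fun=> 16 * lam) n) * w n) b -
              psum (fun n => ind (~ above f (fun=> 16 * lam) n) * w n) a) <=
  C * (2 * (D + 1)) `^ p *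
  (psum (fun n => ind (~ above f (fun=> 16 * (16 * lam)) n) * (A n `^ p * dualw p w n)) b -
   psum (fun n => ind (~ above f (fun=> 16 * (16 * lam)) n) * (A n `^ p * dualw p w n)) a).
Proof.
move=> p1 C0 D0 w0 hM hD f0 l0 A0 hab nb hA ab.
set sg := dualw p w.
have sgp i : 0 < sg i by rewrite powR_gt0.
have sg0 i := ltW (sgp i).
have p0 : 0 < p by lra.
have p10 : 0 < p - 1 by lra.
pose Fm n := ~ above f (fun=> 16 * lam) n.
pose G n := ~ above f (fun=> 16 * (16 * lam)) n.
pose K := C * (2 * (D + 1)) `^ p.
have K0 : 0 <= K by rewrite mulr_ge0 ?powR_ge0.
pose V t := psum (fun n => ind (G n) * (A n `^ p * sg n)) t.
pose U t := psum (fun n => ind (Fm n) * w n) t.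
pose nu t := psum (fun n => ind (G n) * sg n) t.
have Vmono s t : (s <= t)%N -> V s <= V t.
  move=> st; apply: psum_mono => // i _.
  by rewrite mulr_ge0 ?ind_ge0 // mulr_ge0 ?powR_ge0.
have numono s t : (s <= t)%N -> nu s <= nu t.
  by move=> st; apply: psum_mono => // i _; rewrite mulr_ge0 ?ind_ge0.
suff H k x : (b - x <= k)%N -> (a <= x)%N -> (x <= b)%N ->
    lam `^ p * (U b - U x) <= K * (V b - V x).
  exact: (H (b - a)%N a (leqnn _) (leqnn _) (ltnW ab)).
elim: k x => [|k IH] x kx ax.
  by move=> xb; rewrite (_ : x = b) ?subrr ?mulr0 //; nat_lia.
rewrite leq_eqVlt => /orP[/eqP ->|xb]; first by rewrite !subrr !mulr0.
have lp0 : 0 <= lam `^ p := powR_ge0 _ _.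
have [Fx|nFx] := EM (Fm x); last first.
  have := IH x.+1 ltac:(nat_lia) (leqW ax) xb.
  rewrite /U psumS ind0 // mul0r addr0 => h; apply: le_trans h _.
  by rewrite ler_wpM2l // lerD2l lerN2 Vmono.
have l16 : 0 < 16 * lam by lra.
have dens := backward_dense D0 sg0 hD l16 f0 Fx xb.
rewrite -/G -/(nu b) -/(nu x) in dens.
set s := psum sg b - psum sg x in dens.
have s0 : 0 < s.
  rewrite subr_gt0; apply: (@lt_le_trans _ _ (psum sg x.+1)); first by rewrite psumS ltrDl.
  by apply: psum_mono.
have D1 : 0 < D + 1 by lra.
have nu0 : 0 < nu b - nu x.
  by rewrite -(pmulr_rgt0 _ D1); exact: lt_le_trans dens.
(* Minimality of x' leaves at least half of the mass on [y, b) for y = x' - 1, while at least half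
   of it is in [x, x'). The point y is counted on both sides, as [muckenhoupt3] allows. *)
pose P t := (x < t)%N && (nu b - nu t < (nu b - nu x) / 2).
have exP : exists t, P t by exists b; rewrite /P xb subrr divr_gt0.
case: (ex_minnP exP) => x' /andP[xx' hx'] x'min.
have x'b : (x' <= b)%N by apply: x'min; rewrite /P xb subrr divr_gt0.
have ex' : x' = x'.-1.+1 by rewrite prednK // (leq_ltn_trans _ xx').
set y := x'.-1 in ex'.
have xy : (x <= y)%N by rewrite -ltnS -ex'.
have yb : (y < b)%N by rewrite -ex'.
have nuy : (nu b - nu x) / 2 <= nu b - nu y.
  have [e|ne] := eqVneq y x; first by rewrite e; lra.
  rewrite leNgt; apply/negP => hy; have := x'min y.
  rewrite /P hy andbT ltn_neqAle eq_sym ne xy => /(_ isT).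
  by rewrite ex' ltnn.
pose phi := psum f b - psum f x.
have phi0 : 0 <= phi by rewrite subr_ge0; apply: psum_mono => //; exact: ltnW.
have lphi : lam * (b - x)%N%:R <= phi.
  by apply: (run_average hab nb); rewrite ax /= ltnW.
have sy : s / (2 * (D + 1)) <= psum sg b - psum sg y.
  rewrite ler_pdivrMr ?mulr_gt0 //.
  have h1 : nu b - nu y <= psum sg b - psum sg y.
    by have /andP[_] := psum_ind_diff G sg0 (ltnW yb).
  have h2 := ler_wpM2r (ltW D1) (le_trans nuy h1).
  lra.
have eb : b.-1.+1 = b by apply: prednK; exact: leq_ltn_trans xb.
have yb1 : (y <= b.-1)%N by rewrite -ltnS eb.
have m3 := hM x y b.-1 xy yb1.
rewrite eb -/sg -ex' in m3.
have bx0 : 0 < (b - x)%N%:R :> R by rewrite ltr0n subn_gt0.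
pose Wxy := psum w x' - psum w x.
have Wxy0 : 0 <= Wxy by rewrite subr_ge0; apply: psum_mono => [|i _]; [exact: ltnW|exact: ltW].
have ds0 : 0 < s / (2 * (D + 1)) by rewrite divr_gt0 // mulr_gt0.
(* The weight condition at x, y, b - 1, with lam times the length replaced by the mass phi of f on
   [x, b), which is where the run enters. *)
have main1 : lam `^ p * Wxy * (s / (2 * (D + 1))) `^ (p - 1) <= C * phi `^ p.
  have h1 : Wxy * (s / (2 * (D + 1))) `^ (p - 1) <= C * (b - x)%N%:R `^ p.
    apply: le_trans m3; rewrite ler_wpM2l //.
    by apply: ler_powR_base => //; exact: ltW.
  have h2 := ler_wpM2l lp0 h1.
  rewrite -mulrA; apply: le_trans h2 _; rewrite mulrCA ler_wpM2l //.
  rewrite -powRM ?(ltW l0) //; apply: ler_powR_base => //; first exact: ltW.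
  by rewrite mulr_ge0 // ltW.
(* Every point of [x, b) has [A] at least phi / s, the ratio over [x, b). *)
have main2 : (phi / s) `^ p * (s / (2 * (D + 1))) <= V x' - V x.
  have h1 : (phi / s) `^ p * (nu x' - nu x) <= V x' - V x.
    rewrite mulrBr -!psumZ; apply: psum_leB => [|i /andP[i1 i2]]; first exact: ltnW.
    have ib : (i < b)%N by exact: leq_trans i2 x'b.
    rewrite mulrCA ler_wpM2l ?ind_ge0 // ler_wpM2r //.
    apply: ler_powR_base; [exact: ltW|by rewrite divr_ge0 // ltW|].
    by rewrite ler_pdivrMr //; exact: (hA x i ax i1 ib).
  apply: le_trans h1; rewrite ler_wpM2l ?powR_ge0 //.
  rewrite ler_pdivrMr ?mulr_gt0 //.
  have h3 : (nu b - nu x) / 2 <= nu x' - nu x by lra.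
  have := ler_wpM2r (ltW D1) h3; lra.
have main : lam `^ p * Wxy <= K * (V x' - V x).
  have ds1 : 0 < (s / (2 * (D + 1))) `^ (p - 1) by rewrite powR_gt0.
  rewrite -(ler_pM2r ds1); apply: le_trans main1 _.
  have h4 := ler_wpM2l K0 main2.
  have h5 := ler_wpM2r (ltW ds1) h4.
  apply: le_trans h5; rewrite le_eqVlt; apply/orP; left; apply/eqP.
  have e1 : (s / (2 * (D + 1))) * (s / (2 * (D + 1))) `^ (p - 1) = (s / (2 * (D + 1))) `^ p.
    by rewrite mulr_powRB1 // ltW.
  have e2 : phi `^ p = (phi / s) `^ p * (2 * (D + 1)) `^ p * (s / (2 * (D + 1))) `^ p.
    rewrite -powRM; [|by rewrite divr_ge0 // ltW|by rewrite mulr_ge0 // ltW].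
    rewrite -powRM; [|by rewrite mulr_ge0 ?divr_ge0 ?mulr_ge0 // ltW|exact: ltW].
    by congr (_ `^ _); field; rewrite !gt_eqF.
  by rewrite e2 -e1 /K; ring.
have h6 : U x' - U x <= Wxy.
  by have /andP[_] := psum_ind_diff Fm (fun i => ltW (w0 i)) (ltnW xx').
have h7 := ler_wpM2l lp0 h6.
have h8 := IH x' ltac:(nat_lia) (leq_trans ax (ltnW xx')) x'b.
move: h7 h8 main; rewrite !mulrBr; lra.
Qed.

Definition fmax (R : realType) (f : nat -> R) (L n : nat) : R :=
  \big[Num.max/0]_(t < L.+1)
    (if (n < t)%N then (psum f t - psum f n) / (t - n)%N%:R else 0).

Lemma fmax_ge0 (R : realType) (f : nat -> R) L n : 0 <= fmax f L n.
Proof. exact: bigmax_ge_id. Qed.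

Lemma above_supp (R : realType) (f : nat -> R) (mu : R) L : 0 <= mu ->
  (forall i, (L <= i)%N -> f i = 0) -> ~ above f (fun=> mu) L.
Proof.
move=> mu0 fL [t [Lt]]; rewrite !psum_cst -mulrBl -natrB ?(ltnW Lt) //.
by rewrite (psum_supp fL (ltnW Lt)) subrr ltNge mulr_ge0.
Qed.

Lemma above_fmax (R : realType) (f : nat -> R) L (mu : R) n : 0 <= mu ->
  (forall i, 0 <= f i) -> (forall i, (L <= i)%N -> f i = 0) ->
  above f (fun=> mu) n <-> mu < fmax f L n.
Proof.
move=> mu0 f0 fL; split=> [[t [nt]]|h].
  rewrite !psum_cst -mulrBl -natrB ?(ltnW nt) // mulrC => ht.
  have tn0 s : (n < s)%N -> 0 < (s - n)%N%:R :> R by move=> ns; rewrite ltr0n subn_gt0.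
  have [tL|Lt] := leqP t L.
    have tL' : (t < L.+1)%N by [].
    apply: lt_le_trans (le_bigmax _ _ (Ordinal tL')) => /=.
    by rewrite nt ltr_pdivlMr // tn0.
  have nL : (n < L)%N.
    rewrite ltnNge; apply/negP => Ln; move: ht.
    rewrite (psum_supp fL Ln) (psum_supp fL (ltnW Lt)) subrr ltNge.
    by rewrite mulr_ge0.
  apply: lt_le_trans (le_bigmax _ _ (Ordinal (ltnSn L))) => /=.
  rewrite nL ltr_pdivlMr ?tn0 //; apply: le_lt_trans (_ : mu * (t - n)%N%:R < _).
    by rewrite ler_wpM2l // ler_nat leq_sub2r // ltnW.
  by rewrite (psum_supp fL (ltnW Lt)) in ht.
apply: contrapT => hn; move: h; rewrite ltNge => /negP; apply.
apply: bigmax_le => // t _; case: ifP => // nt.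
rewrite ler_pdivrMr ?ltr0n ?subn_gt0 //.
exact: (not_above hn (ltnW nt)).
Qed.

(** The levels have ratio 16 to match [above_sparse]. The layer between levels j and j+1 is charged
    to [smax] on the points between levels j and j+2, and each point is charged at most twice. *)
Lemma fmax_strong (R : realType) (p C : R) : 1 < p -> 0 <= C ->
  exists2 K : R, 0 <= K & forall (w f : nat -> R) L,
    (forall i, 0 < w i) -> muckenhoupt3 p C w ->
    (forall i, 0 <= f i) -> (forall i, (L <= i)%N -> f i = 0) ->
    psum (fun n => fmax f L n `^ p * w n) L <= K * psum (fun n => f n `^ p * w n) L.
Proof.
move=> p1 C0; have p0 : 0 < p by lra.
have [CM CM0 hCM] := @smax_strong R p p1.
pose D := (C * 32 `^ p) `^ (p - 1)^-1.
have D0 : 0 <= D := powR_ge0 _ _.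
pose K := C * (2 * (D + 1)) `^ p.
have K0 : 0 <= K by rewrite mulr_ge0 ?powR_ge0.
exists (16 `^ p * (2 * K * CM)); first by nng.
move=> w f L w0 hM f0 fL; set sg := dualw p w.
have w0' i := ltW (w0 i).
have sgp i : 0 < sg i by rewrite powR_gt0.
have hD : backward_comparable D sg := muckenhoupt_backward p1 C0 w0 hM.
have sixteen : (1 : R) < 16 by lra.
have [c [J [c0 _ hc]]] := @layer_cover R 16 1 (fmax f L) L sixteen ltr01.
pose lev j := c * 16 ^+ j.
have lev0 j : 0 < lev j by rewrite mulr_gt0 // exprn_gt0.
have levS j : lev j.+1 = 16 * lev j by rewrite /lev exprS; ring.
pose A n := smax f sg L n.
have A0 n : 0 <= A n := smax_ge0 f sg L n.
have ab j n : above f (fun=> lev j) n <-> lev j < fmax f L n.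
  by apply: above_fmax => //; exact: ltW.
have level j : lev j `^ p * psum (fun n => ind (lev j < fmax f L n /\ ~ (lev j.+1 < fmax f L n)) * w n) L
   <= K * psum (fun n => ind (lev j < fmax f L n /\ ~ (lev j.+2 < fmax f L n)) * (A n `^ p * sg n)) L.
  rewrite -!psumZ; apply: (@run_le _ (above f (fun=> lev j))); last 2 first.
  - by apply: above_supp => //; exact: ltW.
  - move=> n /ab hn; rewrite [X in X * w n]ind0 ?mul0r ?mulr0; last by case.
    by rewrite mulr_ge0 // mulr_ge0 ?ind_ge0 // mulr_ge0 ?powR_ge0 // ltW.
  move=> a b ltab bL hab nb.
  have run := @run_estimate R p C D (lev j) w f A a b p1 C0 D0 w0 hM hD f0 (lev0 j) A0 hab nb _ ltab.
  rewrite !psumZ -!mulrBr.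
  rewrite -!levS in run.
  apply: (le_trans _ (le_trans (run _) _)).
  - rewrite ler_wpM2l ?powR_ge0 //; apply: psum_leB => [|i _]; first exact: ltnW.
    by rewrite ler_wpM2r //; apply: ind_imp => -[_ h] /ab.
  - move=> x y ax xy yb; rewrite -ler_pdivrMr.
      by apply: smax_ge => //; rewrite xy yb.
    rewrite subr_gt0; apply: (@lt_le_trans _ _ (psum sg x.+1)); first by rewrite psumS ltrDl.
    by apply: psum_mono => [|i _]; [exact: leq_ltn_trans yb|exact: ltW].
  - rewrite -/K ler_wpM2l //; apply: psum_leB => [|i hi]; first exact: ltnW.
    rewrite ler_wpM2r ?mulr_ge0 ?powR_ge0 ?(ltW (sgp _)) //; apply: ind_imp => h.
    by split; [apply/ab; exact: hab|move/ab].
have count (y : R) : psum (fun j => ind (lev j < y /\ ~ (lev j.+2 < y))) J <= (2 : R).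
  have tele n : psum (fun j => ind (lev j < y /\ ~ (lev j.+2 < y))) n <=
      (2 : R) - ind (lev n < y) - ind (lev n.+1 < y).
    elim: n => [|n IH].
      have := ind_le1 R (lev 0%N < y); have := ind_le1 R (lev 1%N < y).
      by rewrite psum0; lra.
    rewrite psumS.
    have : @ind R (lev n < y /\ ~ (lev n.+2 < y)) <= ind (lev n < y) - ind (lev n.+2 < y).
      case: (indP R (lev n < y)) => -[h1 ->].
        case: (indP R (lev n.+2 < y)) => -[h2 ->]; last by rewrite subr0 ind_le1.
        by rewrite ind0 ?subrr // => -[].
      rewrite ind0; last by case.
      rewrite ind0 ?subr0 // => h2; apply: h1; apply: le_lt_trans h2.
      rewrite !levS; have := lev0 n; lra.
    by move: IH; lra.
  apply: le_trans (tele J) _.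
  by have := ind_ge0 R (lev J < y); have := ind_ge0 R (lev J.+1 < y); lra.
apply: (@le_trans _ _ (16 `^ p * psum (fun j => lev j `^ p *
    psum (fun n => ind (lev j < fmax f L n /\ ~ (lev j.+1 < fmax f L n)) * w n) L) J)).
  have -> : psum (fun j => lev j `^ p * psum (fun n => ind (lev j < fmax f L n /\ ~ (lev j.+1 < fmax f L n)) * w n) L) J =
     psum (fun n => psum (fun j => lev j `^ p * ind (lev j < fmax f L n /\ ~ (lev j.+1 < fmax f L n))) J * w n) L.
    rewrite (@psum_eq _ (fun j => _ * psum _ L) (fun j => psum (fun n => lev j `^ p * (ind (lev j < fmax f L n /\ ~ (lev j.+1 < fmax f L n)) * w n)) L)).
      by rewrite psum_exch; apply: psum_eq => n _; rewrite mulrC -psumZ; apply: psum_eq => j _; ring.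
    by move=> j _; rewrite psumZ.
  rewrite -psumZ; apply: psum_le => n nL; rewrite mulrA ler_wpM2r //.
  have [z|z] := leP (fmax f L n) 0.
    have -> : fmax f L n = 0 by apply/eqP; rewrite eq_le z fmax_ge0.
    rewrite powR0 ?gt_eqF // mulr_ge0 ?powR_ge0 // psum_ge0 // => j _.
    by rewrite mulr_ge0 ?powR_ge0 ?ind_ge0.
  have /andP[h1 h2] := hc n nL z.
  exact: layer_bound.
set SF := psum (fun n => f n `^ p * w n) L.
have -> : 16 `^ p * (2 * K * CM) * SF = 16 `^ p * (K * (2 * (CM * SF))) by ring.
rewrite ler_wpM2l ?powR_ge0 //.
apply: (@le_trans _ _ (psum (fun j => K * psum (fun n => ind (lev j < fmax f L n /\ ~ (lev j.+2 < fmax f L n)) * (A n `^ p * sg n)) L) J)).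
  by apply: psum_le => j _; exact: level.
rewrite psumZ ler_wpM2l // psum_exch.
apply: (@le_trans _ _ (psum (fun n => 2 * (A n `^ p * sg n)) L)).
  apply: psum_le => n _.
  have -> : psum (fun j => ind (lev j < fmax f L n /\ ~ (lev j.+2 < fmax f L n)) * (A n `^ p * sg n)) J =
    psum (fun j => ind (lev j < fmax f L n /\ ~ (lev j.+2 < fmax f L n))) J * (A n `^ p * sg n).
    by rewrite [RHS]mulrC -psumZ; apply: psum_eq => j _; ring.
  by rewrite ler_wpM2r // mulr_ge0 ?powR_ge0 // ltW.
rewrite psumZ ler_wpM2l //; apply: le_trans (hCM f sg L sgp f0 fL) _.
rewrite ler_wpM2l //; apply: psum_le => n _.
(* With sg the dual weight, sg^(1-p) = w, so (f/sg)^p sg = f^p w and the dual maximal bound returns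
   the right-hand side. *)
have p10 : p - 1 != 0 by rewrite gt_eqF //; lra.
have wn := w0 n; have sn := sgp n.
rewrite powRM ?f0 ?invr_ge0 ?(ltW sn) // -mulrA ler_wpM2l ?powR_ge0 //.
rewrite -powR_inv1 ?(ltW sn) // -powRrM mulN1r -{2}(powRr1 (ltW sn)) -powRD; last by rewrite (gt_eqF sn) implybT.
rewrite /sg /dualw -powRrM.
have -> : - (1 / (p - 1)) * (- p + 1) = 1 by field; rewrite gt_eqF //; lra.
by rewrite powRr1 // ltW.
Qed.

Definition muckenhoupt1 (R : realType) (C : R) (w : nat -> R) : Prop :=
  forall a m x, (a <= m)%N -> (m <= x)%N ->
  psum w m.+1 - psum w a <= C * (x.+1 - a)%N%:R * w x.

(** Each point i of [m, c] satisfies W <= C l w(i), with W the mass of [a, m] and l the length of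
    [a, c]; this is summed over F. *)
Lemma muckenhoupt1_forward (R : realType) (C : R) (w : nat -> R) : 0 <= C ->
  (forall i, 0 < w i) -> muckenhoupt1 C w -> forward_comparable (16 * C) w.
Proof.
move=> C0 w0 h a m c F am mc cnt.
have l0 : 0 < (c.+1 - a)%N%:R :> R by rewrite ltr0n; nat_lia.
rewrite -(ler_pM2l l0).
set W := _ - psum w a; have W0 : 0 <= W.
  by rewrite subr_ge0; apply: psum_mono => [|i _]; [exact: leqW|exact: ltW].
apply: (@le_trans _ _ (16 * (W * (psum (fun n => ind (F n)) c.+1 - psum (fun n => ind (F n)) m)))).
  by rewrite mulrC mulrCA ler_wpM2l.
have -> : (c.+1 - a)%N%:R * (16 * C * (psum (fun n => ind (F n) * w n) c.+1 - psum (fun n => ind (F n) * w n) m))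
  = 16 * (C * (c.+1 - a)%N%:R * (psum (fun n => ind (F n) * w n) c.+1 - psum (fun n => ind (F n) * w n) m)) by ring.
rewrite ler_wpM2l // !mulrBr -!psumZ; apply: psum_leB => [|i /andP[mi ic]]; first exact: leqW.
rewrite mulrC [leRHS]mulrCA ler_wpM2l ?ind_ge0 //.
apply: le_trans (h a m i am mi) _; rewrite ler_wpM2r ?(ltW (w0 _)) // ler_wpM2l // ler_nat.
by rewrite leq_sub2r // ltnS.
Qed.

(** For k > 0 the minimum of w over [b - k, b). The value at k = 0 repeats w(b - 1), so that the
    function h built from it is nondecreasing up to b. *)
Fixpoint tailmin (R : realType) (w : nat -> R) (b k : nat) : R :=
  if k is k'.+1 then Num.min (w (b - k)%N) (tailmin w b k') else w b.-1.

(* [h n] is the minimum of [w] over [n, b); as [h] is nondecreasing, the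
   rising sun inequality f[n,b) >= lam (b - n) can be integrated against it. *)
Lemma weak_maximal (R : realType) (C : R) : 0 <= C ->
  forall (w f : nat -> R) L (lam : R),
    (forall i, 0 < w i) -> muckenhoupt1 C w ->
    (forall i, 0 <= f i) -> (forall i, (L <= i)%N -> f i = 0) -> 0 < lam ->
    lam * psum (fun n => ind (above f (fun=> lam) n) * w n) L <=
    (4 * C + 1) * psum (fun n => f n * w n) L.
Proof.
move=> C0 w f L lam w0 hw f0 fL l0.
have w0' i := ltW (w0 i).
rewrite -!psumZ; apply: (@run_le _ (above f (fun=> lam))); last 2 first.
- by apply: above_supp => //; exact: ltW.
- move=> n hn; rewrite ind0 // mul0r mulr0 mulr_ge0 ?mulr_ge0 //.
  by rewrite addr_ge0 // mulr_ge0.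
move=> a b ab bL hab nb.
pose h n := tailmin w b (b - n).
have hS n : (n < b)%N -> h n = Num.min (w n) (h n.+1).
  move=> nb'; rewrite /h; have -> : (b - n = (b - n.+1).+1)%N by nat_lia.
  by rewrite /=; have -> : (b - (b - n.+1).+1 = n)%N by nat_lia.
have tm0 k : 0 < tailmin w b k by elim: k => //= k IH; rewrite lt_min w0 IH.
have h0 n : 0 <= h n := ltW (tm0 _).
have hw' n : (n < b)%N -> h n <= w n by move=> nb'; rewrite hS // ge_min lexx.
have hmono n : (n < b)%N -> h n <= h n.+1 by move=> nb'; rewrite hS // ge_min lexx orbT.
have hlow n v : (n < b)%N -> (forall i, (n <= i < b)%N -> v <= w i) -> v <= h n.
  move=> nb' hv; suff H k : (0 < k)%N -> (k <= b - n)%N -> v <= tailmin w b k.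
    by apply: H; rewrite ?subn_gt0.
  elim: k => // k IH _ kn /=; rewrite le_min hv /=; last by nat_lia.
  case: k IH kn => [|k] IH kn; last by apply: IH => //; exact: ltnW.
  by apply: hv; nat_lia.
have ra := run_average hab nb.
(* Summation by parts from the right end. The boundary term h(x) times the excess is kept for the
   induction; one step adds the increment of h times the excess at x + 1, both nonnegative. *)
have abel x : (a <= x <= b)%N ->
    h x * (psum f b - psum f x - lam * (b - x)%N%:R) <=
    psum (fun n => f n * h n) b - psum (fun n => f n * h n) x -
    lam * (psum h b - psum h x).
  move=> /andP[ax xb]; have [k kx] : exists k, (b - x <= k)%N by exists (b - x)%N.
  elim: k x ax xb kx => [|k IH] x ax xb kx.
    have -> : x = b by nat_lia.
    by rewrite !subrr subnn !mulr0 subrr mulr0.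
  move: xb; rewrite leq_eqVlt => /orP[/eqP ->|xb]; first by rewrite !subrr subnn !mulr0 subrr ?mulr0.
  have := IH x.+1 (leqW ax) xb ltac:(nat_lia).
  have := ra x.+1 ltac:(by rewrite leqW).
  have := hmono x xb; rewrite !psumS.
  have -> : (b - x)%N%:R = (b - x.+1)%N%:R + 1 :> R.
    by rewrite natr1; congr (_%:R); nat_lia.
  move: (psum _ b) (psum _ x) (psum f b) (psum f x) (psum h b) (psum h x) (h x) (h x.+1) ((b - x.+1)%N%:R) (f x).
  move=> P Q Fb Fx S T u v m fx uv hr hi.
  have : 0 <= (v - u) * (Fb - (Fx + fx) - lam * m) by apply: mulr_ge0; lra.
  lra.
have fh : lam * (psum h b - psum h a) <= psum (fun n => f n * w n) b - psum (fun n => f n * w n) a.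
  have h1 := abel a ltac:(by rewrite leqnn ltnW).
  have h2 : 0 <= h a * (psum f b - psum f a - lam * (b - a)%N%:R).
    by rewrite mulr_ge0 // subr_ge0; apply: ra; rewrite leqnn ltnW.
  have h3 : psum (fun n => f n * h n) b - psum (fun n => f n * h n) a <=
     psum (fun n => f n * w n) b - psum (fun n => f n * w n) a.
    by apply: psum_leB => [|i /andP[_ ib]]; [exact: ltnW|rewrite ler_wpM2l // hw'].
  lra.
(* Ring by ring: the mass W of the ring of size 2d forces w >= W/(4 C d) at every later point before
   b, hence the same bound for h on the next ring. The case C = 0 is separate because of this
   division. *)
have dense : psum w b - psum w a <= (4 * C + 1) * (psum h b - psum h a).
  pose T := (b - a)%N; have T0 : (0 < T)%N by rewrite subn_gt0.
  have Tb : (T <= b)%N by rewrite leq_subr.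
  have := @ring_sum R (fun d => w (b - d)%N) (fun d => h (b - d)%N) (4 * C) T.
  rewrite (psum_flip w) // (psum_flip h) // subSS subn0.
  have -> : (b.+1 - T.+1 = a)%N by rewrite /T; nat_lia.
  apply => //; first by rewrite mulr_ge0.
    rewrite /h; have -> : (b - (b - 1) = 1)%N by nat_lia.
    by rewrite /= le_min lexx subn1 lexx.
  move=> r rT; have p0 := pow2_gt0 r.
  have e1 : (2 ^ r.+1 = 2 * 2 ^ r)%N by rewrite expnS.
  have e2 : (2 ^ r.+2 = 4 * 2 ^ r)%N by rewrite !expnS; nat_lia.
  rewrite {}e1 {}e2 in rT *; move: (2 ^ r)%N p0 rT => d d0 rT.
  rewrite (psum_flip w); [|nat_lia|nat_lia].
  rewrite (psum_flip h); [|nat_lia|nat_lia].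
  set a' := (b.+1 - minn (4 * d) T.+1)%N.
  set W := _ - psum w a'.
  have am : (a' <= b - 2 * d)%N by rewrite /a'; nat_lia.
  have em : (b.+1 - 2 * d = (b - 2 * d).+1)%N by nat_lia.
  have dR : 0 < d%:R :> R by rewrite ltr0n.
  have W0 : 0 <= W.
    by rewrite subr_ge0 em; apply: psum_mono => //; exact: leqW.
  have [C1|C1] := eqVneq C 0.
    have := hw a' (b - 2 * d)%N (b - 2 * d)%N am (leqnn _).
    rewrite C1 !mul0r mulr0 mul0r -em -/W => h1.
    by [].
  have Cp : 0 < C by rewrite lt_neqAle eq_sym C1.
  pose v := W / (C * (4 * d%:R)).
  have vw i : (b - 2 * d <= i < b)%N -> v <= w i.
    move=> /andP[i1 i2]; rewrite ler_pdivrMr ?mulr_gt0 // mulrC.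
    have := hw a' (b - 2 * d)%N i am i1; rewrite -em -/W => h1; apply: le_trans h1 _.
    rewrite ler_wpM2r // ler_wpM2l // -natrM ler_nat /a'; nat_lia.
  have -> : W = 4 * C * (d%:R * v) by rewrite /v; field; rewrite !gt_eqF.
  rewrite ler_wpM2l ?mulr_ge0 //.
  have -> : d%:R * v = psum (fun=> v) (b.+1 - d) - psum (fun=> v) (b.+1 - 2 * d).
    rewrite !psum_cst -mulrBl -natrB; last by nat_lia.
    by congr (_%:R * _); nat_lia.
  apply: psum_leB => [|i /andP[i1 i2]]; first by nat_lia.
  apply: hlow => [|j /andP[j1 j2]]; first by nat_lia.
  by apply: vw; nat_lia.
rewrite !psumZ -!mulrBr.
have -> : psum (fun n => ind (above f (fun=> lam) n) * w n) b -
    psum (fun n => ind (above f (fun=> lam) n) * w n) a = psum w b - psum w a.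
  by apply/eqP; rewrite eq_le; apply/andP; split; apply: psum_leB (ltnW ab) _ => i iab;
     rewrite ind1 ?mul1r //; exact: hab.
have k1 := ler_wpM2l (ltW l0) dense.
have k2 : 0 <= 4 * C + 1 by rewrite addr_ge0 // mulr_ge0.
have := ler_wpM2l k2 fh; lra.
Qed.

(** * Variation of averages on a half line *)

Lemma exists_base (R : realType) (p eps : R) : 0 < p -> 0 <= eps < 1 ->
  exists2 B : R, 1 < B & B `^ p * eps < 1.
Proof.
move=> p0 /andP[e0 e1]; have pn : p != 0 by rewrite gt_eqF.
have h2 : 1 < 2 / (1 + eps) by rewrite ltr_pdivlMr; lra.
exists ((2 / (1 + eps)) `^ p^-1).
  have e : (1 : R) `^ p^-1 = 1 by rewrite powR1.
  by rewrite -[X in X < _]e; apply: ltr_powR_base; rewrite ?invr_gt0 ?ler01.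
rewrite powR_root //; last by lra.
by rewrite mulrAC ltr_pdivrMr; lra.
Qed.

Lemma powR_lt_root (R : realType) (q mu V : R) : 0 < q -> 0 <= mu -> 0 <= V ->
  mu `^ q < V <-> mu < V `^ q^-1.
Proof.
move=> q0 mu0 V0; have qn : q != 0 by rewrite gt_eqF.
split=> h; last by rewrite -[V](powR_root qn V0); exact: ltr_powR_base.
by apply: (@ltr_powR_inv _ q); rewrite ?powR_ge0 ?powR_root // ltW.
Qed.

(** The good-lambda inequality is summed over the levels c B^j. The sum S is a finite real number,
    so the term B^p eps S can be absorbed since B^p eps < 1; the maximal function pays for the
    rest. *)
Theorem variation_strong (R : realType) (q p C : R) : 2 < q -> 1 < p -> 0 <= C ->
  exists2 K : R, 0 <= K & forall (w f : nat -> R) L M,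
    (forall i, 0 < w i) -> muckenhoupt3 p C w ->
    (forall i, 0 <= f i) -> (forall i, (L <= i)%N -> f i = 0) ->
    psum (fun n => vmax q M (avg f n) `^ (p / q) * w n) L <=
    K * psum (fun n => f n `^ p * w n) L.
Proof.
move=> q2 p1 C0; have q0 : 0 < q by lra.
have p0 : 0 < p by lra.
pose D := C * 32 `^ p; have D0 : 0 <= D by rewrite mulr_ge0 ?powR_ge0.
have [eps heps hgl] := @good_lambda R q D q2 D0.
have /andP[eps0 eps1] := heps.
have [B B1 hB] := exists_base p0 heps.
have B0 : 0 < B by lra.
have [gam gam0 hgam] := hgl B B1.
have [K2 K20 hK2] := @fmax_strong R p C p1 C0.
pose K1 := (1 - (B `^ p)^-1)^-1.
have K10 : 0 <= K1.
  by have := @layer_sum R B p 1 1 0 B1 p0 ltr01 ler01; rewrite psum0 powR1 mulr1.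
pose A := B `^ p / (1 - B `^ p * eps).
have A0 : 0 <= A by rewrite divr_ge0 ?powR_ge0 //; lra.
pose K := A * (B `^ p * (K1 * (gam^-1 `^ p * K2))).
have K0 : 0 <= K by rewrite /K; nng; exact: powR_ge0.
exists K => // w f L M w0 hM f0 fL.
have w0' i := ltW (w0 i).
set SF := psum (fun n => f n `^ p * w n) L.
pose V n := vmax q M (avg f n); pose T n := V n `^ q^-1.
have V0 n : 0 <= V n := vmax_ge0 _ _ _.
have T0 n : 0 <= T n := powR_ge0 _ _.
have Wt0 : 0 <= psum w L by apply: psum_ge0.
apply: (@geometric_limit _ (1 / 2) _ _ (A * psum w L)); [lra|lra| |move=> J0].
  by rewrite mulr_ge0.
(* The lowest level, which no good-lambda step controls, is bounded by c0^p = 2^-J0 times the total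
   weight and vanishes as J0 grows. *)
pose c0 : R := ((1 / 2) ^+ J0) `^ p^-1.
have hJ0 : 0 < (1 / 2 : R) ^+ J0 by apply: exprn_gt0; lra.
have c00 : 0 < c0 by rewrite powR_gt0.
have [c [J [cp cc hc]]] := @layer_cover R B c0 T L B1 c00.
pose lev j := c * B ^+ j.
have lev0 j : 0 < lev j by rewrite mulr_gt0 // exprn_gt0.
have levS j : lev j.+1 = B * lev j by rewrite /lev exprS mulrCA.
pose W j := psum (fun n => ind (lev j < T n) * w n) L.
pose Z j := psum (fun n => ind (gam * lev j < fmax f L n) * w n) L.
have W0 j : 0 <= W j by apply: psum_ge0 => n _; rewrite mulr_ge0 ?ind_ge0.
pose S := psum (fun j => lev j `^ p * W j) J.
have S0 : 0 <= S by apply: psum_ge0 => j _; rewrite mulr_ge0 ?powR_ge0.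
have glam j : W j.+1 <= eps * W j + Z j.
  have h := hgam w f L M (lev j) w0' (muckenhoupt_forward p1 C0 w0 hM) f0 fL (lev0 j).
  have e1 : psum (fun n => ind (lev j `^ q < vmax q M (avg f n)) * w n) L = W j.
    apply: psum_eq => n _; congr (_ * _); apply/eqP; rewrite eq_le.
    by apply/andP; split; apply: ind_imp => hn; apply/(powR_lt_root q0 (ltW (lev0 j)) (V0 n)).
  rewrite e1 in h; apply: le_trans (lerD h (lexx _)).
  rewrite -psumD; apply: psum_le => n _; rewrite -mulrDl ler_wpM2r //.
  case: (indP R (lev j.+1 < T n)) => -[hT ->]; last by rewrite addr_ge0 ?ind_ge0.
  have hV : (B * lev j) `^ q < vmax q M (avg f n).
    by apply/(powR_lt_root q0 (ltW (mulr_gt0 B0 (lev0 j))) (V0 n)); rewrite -levS.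
  have g0 : 0 <= gam * lev j by rewrite ltW // mulr_gt0.
  case: (indP R (gam * lev j < fmax f L n)) => -[hF ->]; first by rewrite lerDr ind_ge0.
  rewrite ind1 ?addr0 //; split => // hab; apply: hF.
  by apply/(@above_fmax R f L _ n g0 f0 fL).
have Zsum : psum (fun j => lev j `^ p * Z j) J <= K1 * (gam^-1 `^ p * K2) * SF.
  rewrite (@psum_eq _ _ (fun j => psum (fun n => lev j `^ p * (ind (gam * lev j < fmax f L n) * w n)) L)); last first.
    by move=> j _; rewrite psumZ.
  rewrite psum_exch.
  apply: (@le_trans _ _ (psum (fun n => K1 * gam^-1 `^ p * (fmax f L n `^ p * w n)) L)).
    apply: psum_le => n _.
    have -> : psum (fun j => lev j `^ p * (ind (gam * lev j < fmax f L n) * w n)) J =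
       psum (fun j => lev j `^ p * ind (lev j < gam^-1 * fmax f L n)) J * w n.
      rewrite [RHS]mulrC -psumZ; apply: psum_eq => j _.
      by rewrite ltr_pdivlMl //; ring.
    rewrite [leRHS]mulrA ler_wpM2r //.
    have gf : 0 <= gam^-1 * fmax f L n by rewrite mulr_ge0 ?fmax_ge0 // invr_ge0 ltW.
    have := @layer_sum R B p c (gam^-1 * fmax f L n) J B1 p0 cp gf.
    by rewrite powRM ?fmax_ge0 ?invr_ge0 ?(ltW gam0) // mulrA.
  rewrite psumZ; have := hK2 w f L w0 hM f0 fL; rewrite -/SF => h.
  have k0 : 0 <= K1 * gam^-1 `^ p by rewrite mulr_ge0 ?powR_ge0.
  by have := ler_wpM2l k0 h; lra.
have Srec : S <= c0 `^ p * psum w L + B `^ p * (eps * S + psum (fun j => lev j `^ p * Z j) J).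
  have F0 : lev 0%N `^ p * W 0%N <= c0 `^ p * psum w L.
    apply: ler_pM; rewrite ?powR_ge0 //.
      apply: ler_powR_base; [exact: ltW|exact: ltW|by rewrite /lev expr0 mulr1].
    by apply: psum_le => n _; rewrite ler_piMl // ind_le1.
  apply: (@le_trans _ _ (psum (fun j => lev j `^ p * W j) J.+1)).
    by rewrite psumS lerDl mulr_ge0 ?powR_ge0.
  have -> : psum (fun j => lev j `^ p * W j) J.+1 =
     lev 0%N `^ p * W 0%N + psum (fun j => lev j.+1 `^ p * W j.+1) J.
    have := psum_shift (fun j => lev j `^ p * W j) 1 J.
    rewrite addn1 (psumS _ 0) psum0 add0r => e.
    rewrite -[LHS](subrK (lev 0%N `^ p * W 0%N)) -e addrC; congr (_ + _).
    by apply: psum_eq => j _; rewrite addn1.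
  apply: lerD => //.
  rewrite -[eps * S]psumZ -psumD -psumZ; apply: psum_le => j _.
  rewrite levS powRM ?(ltW B0) ?(ltW (lev0 j)) // -mulrA ler_wpM2l ?powR_ge0 //.
  by rewrite mulrCA -mulrDr ler_wpM2l ?powR_ge0.
have e0 : c0 `^ p = (1 / 2) ^+ J0 by rewrite /c0 powR_root ?gt_eqF // ltW.
apply: (@le_trans _ _ (B `^ p * S)).
  have -> : B `^ p * S = psum (fun n => B `^ p * psum (fun j => lev j `^ p * ind (lev j < T n)) J * w n) L.
    rewrite /S (@psum_eq _ (fun j => lev j `^ p * W j) (fun j => psum (fun n => lev j `^ p * (ind (lev j < T n) * w n)) L)); last first.
      by move=> j _; rewrite psumZ.
    rewrite psum_exch -psumZ; apply: psum_eq => n _.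
    rewrite -mulrA; congr (_ * _); rewrite [RHS]mulrC -psumZ.
    by apply: psum_eq => j _; ring.
  apply: psum_le => n nL; rewrite ler_wpM2r //.
  have -> : vmax q M (avg f n) `^ (p / q) = T n `^ p by rewrite /T -powRrM mulrC.
  have [z|z] := leP (T n) 0.
    have -> : T n = 0 by apply/eqP; rewrite eq_le z T0.
    rewrite powR0 ?gt_eqF // mulr_ge0 ?powR_ge0 // psum_ge0 // => j _.
    by rewrite mulr_ge0 ?powR_ge0 ?ind_ge0.
  have /andP[h1 h2] := hc n nL z.
  apply: le_trans (layer_bound B1 p0 cp h1 h2) _.
  rewrite ler_wpM2l ?powR_ge0 //; apply: psum_le => j _.
  by rewrite ler_wpM2l ?powR_ge0 //; apply: ind_imp => -[].
have d0 : 0 < 1 - B `^ p * eps by lra.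
have Sfin : S <= (c0 `^ p * psum w L + B `^ p * (K1 * (gam^-1 `^ p * K2) * SF)) / (1 - B `^ p * eps).
  rewrite ler_pdivlMr //.
  by have := ler_wpM2l (powR_ge0 B p) Zsum; lra.
apply: le_trans (ler_wpM2l (powR_ge0 B p) Sfin) _.
rewrite -e0 /K /A le_eqVlt; apply/orP; left; apply/eqP; field.
by rewrite gt_eqF.
Qed.

(** No sum over levels here: the good-lambda step from mu / B to mu is iterated at a single
    level. *)
Theorem variation_weak (R : realType) (q C : R) : 2 < q -> 0 <= C ->
  exists2 K : R, 0 <= K & forall (w f : nat -> R) L M (lam : R),
    (forall i, 0 < w i) -> muckenhoupt1 C w ->
    (forall i, 0 <= f i) -> (forall i, (L <= i)%N -> f i = 0) -> 0 < lam ->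
    lam * psum (fun n => ind (lam `^ q < vmax q M (avg f n)) * w n) L <=
    K * psum (fun n => f n * w n) L.
Proof.
move=> q2 C0; have q0 : 0 < q by lra.
pose D := 16 * C; have D0 : 0 <= D by rewrite mulr_ge0.
have [eps heps hgl] := @good_lambda R q D q2 D0.
have /andP[eps0 eps1] := heps.
have [B B1 hB] := exists_base ltr01 heps.
have B0 : 0 < B by lra.
rewrite powRr1 ?(ltW B0) // in hB.
have [gam gam0 hgam] := hgl B B1.
pose A := B * (4 * C + 1) / gam.
have A0 : 0 <= A.
  by rewrite divr_ge0 ?(ltW gam0) // mulr_ge0 ?(ltW B0) // addr_ge0 // mulr_ge0.
have d0 : 0 < 1 - B * eps by lra.
exists (A / (1 - B * eps)); first by rewrite divr_ge0 // ltW.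
move=> w f L M lam w0 hM f0 fL l0.
have w0' i := ltW (w0 i).
set SF := psum (fun n => f n * w n) L.
have SF0 : 0 <= SF by apply: psum_ge0 => n _; rewrite mulr_ge0.
pose W mu := psum (fun n => ind (mu `^ q < vmax q M (avg f n)) * w n) L.
have Wt mu : W mu <= psum w L.
  by apply: psum_le => n _; rewrite ler_piMl // ind_le1.
have W0 mu : 0 <= W mu by apply: psum_ge0 => n _; rewrite mulr_ge0 ?ind_ge0.
have Wt0 : 0 <= psum w L by apply: psum_ge0.
have step mu : 0 < mu -> B * mu * W (B * mu) <= B * eps * (mu * W mu) + A * SF.
  move=> mu0.
  have h := hgam w f L M mu w0' (muckenhoupt1_forward C0 w0 hM) f0 fL mu0.
  have gm0 : 0 < gam * mu by rewrite mulr_gt0.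
  have hw := weak_maximal C0 w0 hM f0 fL gm0.
  have hs : W (B * mu) <= eps * W mu + psum (fun n => ind (above f (fun=> gam * mu) n) * w n) L.
    apply: le_trans (lerD h (lexx _)); rewrite -psumD; apply: psum_le => n _.
    rewrite -mulrDl ler_wpM2r //.
    case: (indP R ((B * mu) `^ q < vmax q M (avg f n))) => -[hT ->]; last by rewrite addr_ge0 ?ind_ge0.
    case: (indP R (above f (fun=> gam * mu) n)) => -[hF ->]; first by rewrite lerDr ind_ge0.
    by rewrite ind1 ?addr0.
  have h2 : mu * psum (fun n => ind (above f (fun=> gam * mu) n) * w n) L <= (4 * C + 1) / gam * SF.
    rewrite [leRHS]mulrAC ler_pdivlMr //; apply: le_trans hw.
    by rewrite le_eqVlt; apply/orP; left; apply/eqP; ring.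
  have h3 := ler_wpM2l (ltW (mulr_gt0 B0 mu0)) hs.
  have h4 := ler_wpM2l (ltW B0) h2.
  have -> : A * SF = B * ((4 * C + 1) / gam * SF) by rewrite /A; ring.
  move: h3 h4; rewrite mulrDr; lra.
(* At the bottom of the iteration W is bounded by the total weight of [0, L), which is finite, with
   a factor eps^m tending to 0; the errors form a geometric series of ratio B eps. *)
have iter m mu : 0 < mu -> mu * W mu <= eps ^+ m * (mu * psum w L) + A / (1 - B * eps) * SF.
  elim: m mu => [|m IH] mu mu0.
    rewrite expr0 mul1r ler_wpDr //; first by rewrite mulr_ge0 // divr_ge0 // ltW.
    by rewrite ler_wpM2l // ltW.
  have muB : 0 < mu / B by rewrite divr_gt0.
  have := step _ muB; have -> : B * (mu / B) = mu by field; rewrite gt_eqF.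
  move=> h; apply: le_trans h _.
  have Be : 0 <= B * eps by rewrite mulr_ge0 // ltW.
  have h1 := ler_wpM2l Be (IH _ muB).
  apply: le_trans (lerD h1 (lexx _)) _.
  rewrite le_eqVlt; apply/orP; left; apply/eqP.
  by rewrite exprS; field; rewrite !gt_eqF.
have [e0|ep] := eqVneq eps 0.
  by have := iter 1%N lam l0; rewrite e0 expr1 mul0r add0r.
have epos : 0 < eps by rewrite lt_neqAle eq_sym ep.
apply: (@geometric_limit _ eps _ _ (lam * psum w L)) => //.
  by rewrite mulr_ge0 // ltW.
by move=> m; apply: le_trans (iter m lam l0) _; rewrite addrC lerD2l mulrC.
Qed.

(** * Sufficiency on the integers *)

Lemma sum_psum (R : realType) (g : nat -> R) x y : (x <= y)%N ->
  \sum_(x <= i < y) g i = psum g y - psum g x.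
Proof.
elim: y => [|y IH]; first by rewrite leqn0 => /eqP ->; rewrite big_geq // subrr.
rewrite leq_eqVlt => /orP[/eqP ->|]; first by rewrite big_geq // subrr.
by rewrite ltnS => xy; rewrite big_nat_recr //= IH // psumS; ring.
Qed.
Lemma muckenhoupt3_shift (R : realType) (p : R) (w : int -> R) :
  1 < p -> weight w -> Applus p w ->
  exists2 C : R, 0 <= C & forall s : int, muckenhoupt3 p C (fun n => w (s + n%:Z)).
Proof.
move=> p1 hw [C hC]; exists `|C| => // s a m c am mc.
have p0 : 0 < p by lra.
(* The two intervals are enlarged to equal length k + 1 around the common point m, which becomes the
   index k of the condition at n. Their length still does not exceed c + 1 - a. *)
pose k := maxn (m - a) (c - m).
pose n : int := s + m%:Z - k%:Z.
have := hC n k; rewrite sum_psum // sum_psum; last by lia.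
rewrite psum0 subr0 => h.
have g0 i : 0 <= w (n + i%:Z) by exact: ltW.
have s0 i : 0 <= w (n + i%:Z) `^ (- (1 / (p - 1))) by exact: powR_ge0.
have e1 : psum (fun j => w (s + j%:Z)) m.+1 - psum (fun j => w (s + j%:Z)) a <=
    psum (fun i => w (n + i%:Z)) k.+1.
  have mk : (m - a <= k)%N by rewrite leq_maxl.
  have := psum_shift (fun i => w (n + i%:Z)) (k - (m - a)) (m - a).+1.
  have -> : ((m - a).+1 + (k - (m - a)) = k.+1)%N by lia.
  have := psum_shift (fun j => w (s + j%:Z)) a (m - a).+1.
  have -> : ((m - a).+1 + a = m.+1)%N by lia.
  move=> <- e; rewrite (@psum_eq _ _ (fun i => w (n + (i + (k - (m - a)))%N%:Z))).
    by rewrite e gerBl; apply: psum_ge0.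
  by move=> i _; congr w; rewrite /n; lia.
have e2 : psum (dualw p (fun j => w (s + j%:Z))) c.+1 - psum (dualw p (fun j => w (s + j%:Z))) m <=
    psum (fun i => w (n + i%:Z) `^ (- (1 / (p - 1)))) (2 * k).+1 -
    psum (fun i => w (n + i%:Z) `^ (- (1 / (p - 1)))) k.
  have ck : (c - m <= k)%N by rewrite leq_maxr.
  have := psum_shift (fun i => w (n + i%:Z) `^ (- (1 / (p - 1)))) k (c - m).+1.
  have := psum_shift (dualw p (fun j => w (s + j%:Z))) m (c - m).+1.
  have -> : ((c - m).+1 + m = c.+1)%N by lia.
  move=> <- e; rewrite (@psum_eq _ _ (fun i => w (n + (i + k)%N%:Z) `^ (- (1 / (p - 1))))).
    by rewrite e lerD2r; apply: psum_mono => //; lia.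
  by move=> i _; rewrite /dualw; congr (w _ `^ _); rewrite /n; lia.
have d0 : 0 <= psum (dualw p (fun j => w (s + j%:Z))) c.+1 - psum (dualw p (fun j => w (s + j%:Z))) m.
  by rewrite subr_ge0; apply: psum_mono => [|i _]; [exact: leqW|exact: powR_ge0].
have kR : k.+1%:R <= (c.+1 - a)%N%:R :> R by rewrite ler_nat /k; lia.
apply: (@le_trans _ _ (C * k.+1%:R `^ p)).
  apply: le_trans h; apply: ler_pM; rewrite ?powR_ge0 //.
    by rewrite subr_ge0; apply: psum_mono => [|i _]; [exact: leqW|exact: ltW].
  by apply: ler_powR_base => //; lra.
apply: (@le_trans _ _ (`|C| * k.+1%:R `^ p)); first by rewrite ler_wpM2r ?powR_ge0 // ler_norm.
by rewrite ler_wpM2l //; apply: ler_powR_base => //; exact: ltW.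
Qed.

Lemma muckenhoupt1_shift (R : realType) (w : int -> R) : weight w -> A1plus w ->
  exists2 C : R, 0 <= C & forall s : int, muckenhoupt1 C (fun n => w (s + n%:Z)).
Proof.
move=> hw [C hC]; exists `|C| => // s a m x am mx.
pose k := maxn (m - a) (x - m).
have sumE (g : nat -> R) y : \sum_(0 <= i < y) g i = psum g y by rewrite big_mkord.
have := hC (s + m%:Z) k; rewrite sumE => h.
have mk : (m - a <= k)%N by rewrite leq_maxl.
have e1 : psum (fun j => w (s + j%:Z)) m.+1 - psum (fun j => w (s + j%:Z)) a <=
    psum (fun i => w (s + m%:Z - k%:Z + i%:Z)) k.+1.
  have := psum_shift (fun i => w (s + m%:Z - k%:Z + i%:Z)) (k - (m - a)) (m - a).+1.
  have -> : ((m - a).+1 + (k - (m - a)) = k.+1)%N by lia.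
  have := psum_shift (fun j => w (s + j%:Z)) a (m - a).+1.
  have -> : ((m - a).+1 + a = m.+1)%N by lia.
  move=> <- e; rewrite (@psum_eq _ _ (fun i => w (s + m%:Z - k%:Z + (i + (k - (m - a)))%N%:Z))).
    by rewrite e gerBl; apply: psum_ge0 => i _; exact: ltW.
  by move=> i _; congr w; lia.
have min0 : 0 <= \big[Num.min/w (s + m%:Z)]_(0 <= i < k.+1) w (s + m%:Z + i%:Z).
  by elim/big_rec: _ => [|i y _ y0]; [exact: ltW|rewrite le_min y0 ltW].
have minx : \big[Num.min/w (s + m%:Z)]_(0 <= i < k.+1) w (s + m%:Z + i%:Z) <= w (s + x%:Z).
  have xk : (x - m)%N \in index_iota 0 k.+1.
    by rewrite mem_index_iota /= ltnS leq_maxr.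
  have -> : w (s + x%:Z) = w (s + m%:Z + (x - m)%N%:Z) by congr w; lia.
  elim: (index_iota 0 k.+1) xk => // i l IH; rewrite inE => /orP[/eqP <-|/IH h'].
    by rewrite big_cons ge_min lexx.
  by rewrite big_cons ge_min h' orbT.
apply: le_trans e1 _; apply: le_trans h _.
apply: (@le_trans _ _ (`|C| * k.+1%:R * \big[Num.min/w (s + m%:Z)]_(0 <= i < k.+1) w (s + m%:Z + i%:Z))).
  by rewrite ler_wpM2r // ler_wpM2r // ler_norm.
apply: ler_pM => //.
by rewrite ler_wpM2l // ler_nat /k; lia.
Qed.

Lemma vmax_mono (R : realType) (q : R) (a : nat -> R) M M' : 0 < q -> (M <= M')%N ->
  vmax q M a <= vmax q M' a.
Proof.
move=> q0 MM; apply: vmax_le; first exact: vmax_ge0.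
move=> x s /path_ltn_leq h1 h2; apply: vpath_le_vmax => //; exact: leq_trans MM.
Qed.

(** * Complex values, windows and unordered sums over the integers *)

Definition cpart (R : realType) (i : nat) (z : R[i]) : R :=
  match i with
  | 0%N => Num.max 0 (complex.Re z)
  | 1%N => Num.max 0 (- complex.Re z)
  | 2%N => Num.max 0 (complex.Im z)
  | _ => Num.max 0 (- complex.Im z)
  end.

Lemma cpart_ge0 (R : realType) i (z : R[i]) : 0 <= cpart i z.
Proof. by case: i => [|[|[|i]]]; rewrite /cpart le_max lexx. Qed.

Lemma normc_Re (R : realType) (z : R[i]) : `|complex.Re z| <= cabs z.
Proof.
case: z => a b /=; rewrite -sqrtr_sqr ler_wsqrtr // lerDl; exact: sqr_ge0.
Qed.

Lemma normc_Im (R : realType) (z : R[i]) : `|complex.Im z| <= cabs z.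
Proof.
case: z => a b /=; rewrite -sqrtr_sqr ler_wsqrtr // lerDr; exact: sqr_ge0.
Qed.

Lemma normc_sum (R : realType) (z : R[i]) : cabs z <= `|complex.Re z| + `|complex.Im z|.
Proof.
case: z => a b /=; rewrite -[leRHS]ger0_norm ?addr_ge0 // -sqrtr_sqr ler_wsqrtr //.
rewrite sqrrD !real_normK ?num_real // addrAC lerDl.
by rewrite mulrn_wge0 ?mulr_ge0.
Qed.

Lemma normc_ge0 (R : realType) (z : R[i]) : 0 <= cabs z.
Proof. by case: z => a b /=; exact: sqrtr_ge0. Qed.

Lemma cpart_le (R : realType) i (z : R[i]) : cpart i z <= cabs z.
Proof.
have n0 := normc_ge0 z; have r := normc_Re z; have m := normc_Im z.
have r1 := ler_norm (complex.Re z); have r2 := ler_norm (- complex.Re z).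
have m1 := ler_norm (complex.Im z); have m2 := ler_norm (- complex.Im z).
rewrite !normrN in r2 m2.
case: i => [|[|[|i]]]; rewrite /cpart ge_max n0 /=; lra.
Qed.

Lemma Re_cpart (R : realType) (z : R[i]) : complex.Re z = cpart 0 z - cpart 1 z.
Proof. by rewrite /cpart; case: (lerP 0 (complex.Re z)) => h1; case: (lerP 0 (- complex.Re z)) => h2; lra. Qed.

Lemma Im_cpart (R : realType) (z : R[i]) : complex.Im z = cpart 2 z - cpart 3 z.
Proof. by rewrite /cpart; case: (lerP 0 (complex.Im z)) => h1; case: (lerP 0 (- complex.Im z)) => h2; lra. Qed.

Definition ray (R : realType) (f : int -> R[i]) (i : nat) (n : int) (k : nat) : R :=
  cpart i (f (n + k%:Z)).

Lemma Re_avg (R : realType) (f : int -> R[i]) n N :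
  complex.Re (ergodic_avg f n N) = avg (ray f 0 n) 0 N - avg (ray f 1 n) 0 N.
Proof.
rewrite /ergodic_avg -avgB big_mkord.
have -> : N.+1%:R^-1 = real_complex R N.+1%:R^-1.
  by rewrite fmorphV rmorph_nat.
rewrite avg_psum [RHS]mulrC -psumZ /psum.
rewrite mulrC mulr_sumr raddf_sum; apply: eq_bigr => i _.
rewrite addn0 /ray -Re_cpart.
by case: (f _) => a b /=; ring.
Qed.

Lemma Im_avg (R : realType) (f : int -> R[i]) n N :
  complex.Im (ergodic_avg f n N) = avg (ray f 2 n) 0 N - avg (ray f 3 n) 0 N.
Proof.
rewrite /ergodic_avg -avgB big_mkord.
have -> : N.+1%:R^-1 = real_complex R N.+1%:R^-1.
  by rewrite fmorphV rmorph_nat.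
rewrite avg_psum [RHS]mulrC -psumZ /psum.
rewrite mulrC mulr_sumr raddf_sum; apply: eq_bigr => i _.
rewrite addn0 /ray -Im_cpart.
by case: (f _) => a b /=; ring.
Qed.

Lemma powR_psum (R : realType) (r : R) (x : nat -> R) n : 0 <= r -> (forall i, 0 <= x i) ->
  psum x n.+1 `^ r <= n.+1%:R `^ r * psum (fun i => x i `^ r) n.+1.
Proof.
move=> r0 x0.
have [i0 _ hi] := @arg_maxP _ R 'I_n.+1 ord0 xpredT (fun i => x i) isT.
apply: (@le_trans _ _ ((n.+1%:R * x i0) `^ r)).
  apply: ler_powR_base => //; first by apply: psum_ge0 => i _.
  by rewrite -psum_cst; apply: psum_le => i ni; exact: (hi (Ordinal ni)).
rewrite powRM // ler_wpM2l ?powR_ge0 //.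
by apply: (@psum_term _ (fun i => x i `^ r)) => // j _; exact: powR_ge0.
Qed.

Lemma vpath_map_iota (R : realType) (q : R) (a : nat -> R) (N : nat -> nat) J k :
  vpath q a (N k) (map N (iota k.+1 J)) =
  psum (fun j => `|a (N (k + j)%N) - a (N (k + j).+1)| `^ q) J.
Proof.
elim: J k => [|J IH] k; first by rewrite psum0.
rewrite /= IH /psum big_ord_recl addn0; congr (_ + _).
by apply: eq_bigr => i _; rewrite /= /bump /= add1n addSnnS.
Qed.

Definition vsum (R : realType) (q : R) (f : int -> R[i]) (n : int) (M : nat) : R :=
  psum (fun i => vmax q M (avg (ray f i n) 0)) 4.

Lemma vsum_ge0 (R : realType) (q : R) (f : int -> R[i]) n M : 0 <= vsum q f n M.
Proof. by apply: psum_ge0 => i _; exact: vmax_ge0. Qed.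

Lemma vsum_mono (R : realType) (q : R) (f : int -> R[i]) n M M' : 0 < q -> (M <= M')%N ->
  vsum q f n M <= vsum q f n M'.
Proof. by move=> q0 MM; apply: psum_le => i _; exact: vmax_mono. Qed.

Lemma cabs_avgB (R : realType) (f : int -> R[i]) n N N' :
  cabs (ergodic_avg f n N - ergodic_avg f n N') <=
  psum (fun i => `|avg (ray f i n) 0 N - avg (ray f i n) 0 N'|) 4.
Proof.
have hB (x y u v : R) : `|x - y - (u - v)| <= `|x - u| + `|y - v|.
  by rewrite (_ : x - y - (u - v) = (x - u) - (y - v)); [exact: ler_normB|ring].
apply: le_trans (normc_sum _) _.
rewrite !raddfB /= !Re_avg !Im_avg !psumS psum0 add0r -[leRHS]addrA.
by apply: lerD; exact: hB.
Qed.

Lemma variation_psum_le (R : realType) (q : R) (f : int -> R[i]) n (N : nat -> nat) J : 0 < q ->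
  {homo N : i j / (i <= j)%N} ->
  psum (fun j => cabs (ergodic_avg f n (N j) - ergodic_avg f n (N j.+1)) `^ q) J <=
  4 `^ q * vsum q f n (N J).
Proof.
move=> q0 hN.
apply: (@le_trans _ _ (psum (fun j => 4 `^ q * psum (fun i =>
    `|avg (ray f i n) 0 (N j) - avg (ray f i n) 0 (N j.+1)| `^ q) 4) J)).
  apply: psum_le => j _.
  apply: le_trans (powR_psum (x := fun i => `|avg (ray f i n) 0 (N j) - avg (ray f i n) 0 (N j.+1)|)
    3 (ltW q0) (fun i => normr_ge0 _)).
  apply: ler_powR_base; [exact: ltW|exact: normc_ge0|exact: cabs_avgB].
rewrite psumZ ler_wpM2l ?powR_ge0 // psum_exch; apply: psum_le => i _.
have := @vpath_map_iota _ q (avg (ray f i n) 0) N J 0; rewrite /= => <-.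
have hp k : path leq (N k) (map N (iota k.+1 J)) /\ last (N k) (map N (iota k.+1 J)) = N (k + J)%N.
  elim: J k => [|J IH] k /=; first by rewrite addn0.
  by have [h1 h2] := IH k.+1; rewrite h1 h2 hN // addSnnS.
have [h1 h2] := hp 0%N.
by apply: vpath_le_vmax => //; rewrite h2.
Qed.

Lemma variation_norm_le (R : realType) (q A : R) (a : nat -> R[i]) : 0 < q -> 0 <= A ->
  (forall N, increasing_seq N -> forall J,
    psum (fun j => cabs (a (N j) - a (N j.+1)) `^ q) J <= A `^ q) ->
  (variation_norm q a <= A%:E)%E.
Proof.
move=> q0 A0 h; apply: ge_ereal_sup => _ [N hN <-].
have u0 j : (0 <= (cabs (a (N j) - a (N j.+1)) `^ q)%:E)%E by rewrite lee_fin powR_ge0.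
have le : (\sum_(0 <= j <oo) (cabs (a (N j) - a (N j.+1)) `^ q)%:E <= (A `^ q)%:E)%E.
  apply: lime_le; first by apply: is_cvg_nneseries => j _ _.
  apply: nearW => J; rewrite sumEFin lee_fin big_mkord; exact: h.
have -> : A%:E = ((A `^ q)%:E `^ q^-1)%E.
  by rewrite poweR_EFin -powRrM mulfV ?gt_eqF // powRr1.
have s0 : (0 <= \sum_(0 <= j <oo) (cabs (a (N j) - a (N j.+1)) `^ q)%:E)%E.
  by apply: nneseries_ge0 => j _ _.
apply: gt0_ler_poweR => //; first by rewrite invr_ge0 ltW.
  by rewrite in_itv /= s0 leey.
by rewrite in_itv /= lee_fin powR_ge0 leey.
Qed.

Lemma variation_norm_ge (R : realType) (q : R) (a : nat -> R[i]) M N : 0 < q -> (M < N)%N ->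
  ((cabs (a M - a N))%:E <= variation_norm q a)%E.
Proof.
move=> q0 MN.
(* Admissible sequences are infinite, so the pair M < N is continued by N + 1, N + 2, ...; the first
   term alone gives the bound. *)
pose s j := if j is j'.+1 then (N + j')%N else M.
have hs : increasing_seq s.
  by apply/increasing_seqP => -[|j] /=; rewrite ltEnat /= ?addn0 ?addnS.
have u0 j : (0 <= (cabs (a (s j) - a (s j.+1)) `^ q)%:E)%E by rewrite lee_fin powR_ge0.
apply: le_trans (ereal_sup_ubound _); last by exists s.
have -> : (cabs (a M - a N))%:E = ((cabs (a M - a N) `^ q)%:E `^ q^-1)%E.
  by rewrite poweR_EFin -powRrM mulfV ?gt_eqF // powRr1 // normc_ge0.
have le : ((cabs (a M - a N) `^ q)%:E <= \sum_(0 <= j <oo) (cabs (a (s j) - a (s j.+1)) `^ q)%:E)%E.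
  have := @nneseries_lim_ge R (fun j => (cabs (a (s j) - a (s j.+1)) `^ q)%:E) xpredT 0 1 (fun j _ _ => u0 j).
  by rewrite big_nat1 /= addn0.
apply: gt0_ler_poweR => //; first by rewrite invr_ge0 ltW.
  by rewrite in_itv /= lee_fin powR_ge0 leey.
by rewrite in_itv /= leey andbT; apply: nneseries_ge0 => j _ _.
Qed.

Lemma esum_window (R : realType) (g : int -> R) (s : int) L : (forall i, 0 <= g i) ->
  (\esum_(n in (fun k : nat => (s + k%:Z)%R) @` `I_L) (g n)%:E = (psum (fun k => g (s + k%:Z)%R) L)%:E)%E.
Proof.
move=> g0; rewrite esum_image; last by move=> i j _ _ /addrI [].
rewrite esum_fset //; last by move=> i _; rewrite lee_fin.
by rewrite -fsbig_ord sumEFin.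
Qed.

Lemma psum_le_esum (R : realType) (g : int -> R) (s : int) L : (forall i, 0 <= g i) ->
  ((psum (fun k => g (s + k%:Z)%R) L)%:E <= \esum_(n in [set: int]) (g n)%:E)%E.
Proof.
move=> g0; rewrite -esum_window // esum_mkcond; apply: le_esum => i _.
by case: ifP => _ //; rewrite lee_fin.
Qed.

(** The unordered sum is a supremum over finite sets, and each finite set of integers lies in a
    symmetric window. *)
Lemma esum_le_psum (R : realType) (g : int -> R) (c : R) : (forall i, 0 <= g i) ->
  (forall s L, psum (fun k => g (s + k%:Z)) L <= c) ->
  (\esum_(n in [set: int]) (g n)%:E <= c%:E)%E.
Proof.
move=> g0 h; apply: ge_ereal_sup => _ [X [finX _] <-].
have [B hB] : exists B : nat, X `<=` (fun k : nat => (- B%:Z + k%:Z)%R) @` `I_(2 * B).+1.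
  have hx (l : seq int) (x : int) : x \in l -> (`|x| <= \sum_(y <- l) `|y|)%N.
    by move=> xl; rewrite (big_rem x) //= leq_addr.
  move/finite_seqP: finX => [l ->]; exists (\sum_(y <- l) `|y|)%N => x /= /hx.
  move: (\sum_(y <- l) _)%N => b xb.
  exists (absz (x + b%:Z)) => /=; move: (x : int) xb => y; lia.
rewrite -(@esum_fset _ _ X (fun n => (g n)%:E)) //; last by move=> i _; rewrite lee_fin.
apply: (@le_trans _ _ (\esum_(n in (fun k : nat => (- B%:Z + k%:Z)%R) @` `I_(2 * B).+1) (g n)%:E)%E).
  rewrite esum_mkcond [leRHS]esum_mkcond; apply: le_esum => i _.
  case: ifP => [/set_mem /hB/mem_set -> //|_].
  by case: ifP => _ //; rewrite lee_fin.
by rewrite esum_window // lee_fin.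
Qed.

(** From a position k < L, averages of length at most M + 1 read only indices below L + M + 1, so
    cutting f there gives finite support without changing them. *)
Lemma vmax_window (R : realType) (q : R) (f : int -> R[i]) (s : int) i L M k : (k < L)%N ->
  vmax q M (avg (fun t => if (t < L + M.+1)%N then ray f i s t else 0) k) =
  vmax q M (avg (ray f i (s + k%:Z)) 0).
Proof.
move=> kL; apply: vmax_eq => N NM; rewrite !avg_psum; congr (_ / _).
apply: psum_eq => t tN; rewrite addn0 ifT; last by lia.
by rewrite /ray; congr (cpart _ (f _)); lia.
Qed.

Lemma variation_strong_window (R : realType) (q p : R) (w : int -> R) :
  2 < q -> 1 < p -> weight w -> Applus p w ->
  exists2 K : R, 0 <= K & forall f s L M e,
    (\esum_(n in [set: int]) (cabs (f n) `^ p * w n)%:E <= e%:E)%E ->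
    psum (fun k => vsum q f (s + k%:Z) M `^ (p / q) * w (s + k%:Z)) L <= K * e.
Proof.
move=> q2 p1 hw hA; have [C C0 hC] := muckenhoupt3_shift p1 hw hA.
have [K K0 hK] := variation_strong q2 p1 C0.
have q0 : 0 < q by lra.
have p0 : 0 < p by lra.
have r0 : 0 <= p / q by rewrite divr_ge0 // ltW.
exists (4 `^ (p / q) * (4 * K)); first by rewrite !mulr_ge0 ?powR_ge0 ?ler0n.
move=> f s L M e he.
pose V i k := vmax q M (avg (ray f i (s + k%:Z)) 0).
have hV i : psum (fun k => V i k `^ (p / q) * w (s + k%:Z)) L <= K * e.
  pose h t := if (t < L + M.+1)%N then ray f i s t else 0.
  have h0 t : 0 <= h t by rewrite /h; case: ifP => _ //; exact: cpart_ge0.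
  have hL t : (L + M.+1 <= t)%N -> h t = 0 by move=> Lt; rewrite /h ltnNge Lt.
  have := hK (fun k => w (s + k%:Z)) h (L + M.+1)%N M (fun k => hw _) (hC s) h0 hL.
  move=> hs; apply: le_trans (le_trans hs _).
    apply: (@le_trans _ _ (psum (fun k => vmax q M (avg h k) `^ (p / q) * w (s + k%:Z)) L)).
      by apply: psum_le => k kL; rewrite vmax_window.
    by apply: psum_mono => [|k _]; [exact: leq_addr|rewrite mulr_ge0 ?powR_ge0 // ltW].
  rewrite ler_wpM2l //.
  apply: (@le_trans _ _ (psum (fun k => cabs (f (s + k%:Z)) `^ p * w (s + k%:Z)) (L + M.+1))).
    apply: psum_le => k kL; rewrite /h kL ler_wpM2r ?(ltW (hw _)) //.
    by apply: ler_powR_base; [exact: ltW|exact: cpart_ge0|exact: cpart_le].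
  rewrite -lee_fin; apply: le_trans he.
  apply: (@psum_le_esum R (fun n => cabs (f n) `^ p * w n)) => n.
  by rewrite mulr_ge0 ?powR_ge0 // ltW.
apply: (@le_trans _ _ (psum (fun k => 4 `^ (p / q) *
    psum (fun i => V i k `^ (p / q) * w (s + k%:Z)) 4) L)).
  apply: psum_le => k _.
  have := @powR_psum R (p / q) (V^~ k) 3 r0 (fun i => vmax_ge0 _ _ _).
  move=> /(ler_wpM2r (ltW (hw (s + k%:Z)))) /le_trans; apply.
  rewrite -mulrA ler_wpM2l ?powR_ge0 // mulrC -psumZ; apply: psum_le => i _.
  by rewrite mulrC.
rewrite psumZ -mulrA ler_wpM2l ?powR_ge0 // psum_exch.
apply: (@le_trans _ _ (psum (fun=> K * e) 4)); first by apply: psum_le => i _; exact: hV.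
by rewrite psum_cst mulrA.
Qed.

Lemma variation_weak_window (R : realType) (q : R) (w : int -> R) :
  2 < q -> weight w -> A1plus w ->
  exists2 K : R, 0 <= K & forall f s L M (lam e : R), 0 < lam ->
    (\esum_(n in [set: int]) (cabs (f n) * w n)%:E <= e%:E)%E ->
    psum (fun k => ind (lam `^ q < vsum q f (s + k%:Z) M) * w (s + k%:Z)) L <= K / lam * e.
Proof.
move=> q2 hw hA; have [C C0 hC] := muckenhoupt1_shift hw hA.
have [K K0 hK] := variation_weak q2 C0.
have q0 : 0 < q by lra.
exists (16 * K); first by rewrite mulr_ge0 ?ler0n.
move=> f s L M lam e l0 he.
pose V i k := vmax q M (avg (ray f i (s + k%:Z)) 0).
have l40 : 0 < lam / 4 by rewrite divr_gt0.
have hV i : psum (fun k => ind ((lam / 4) `^ q < V i k) * w (s + k%:Z)) L <= 4 * K / lam * e.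
  pose h t := if (t < L + M.+1)%N then ray f i s t else 0.
  have h0 t : 0 <= h t by rewrite /h; case: ifP => _ //; exact: cpart_ge0.
  have hL t : (L + M.+1 <= t)%N -> h t = 0 by move=> Lt; rewrite /h ltnNge Lt.
  have := hK (fun k => w (s + k%:Z)) h (L + M.+1)%N M (lam / 4) (fun k => hw _) (hC s) h0 hL l40.
  have e1 : psum (fun k => h k * w (s + k%:Z)) (L + M.+1) <= e.
    apply: (@le_trans _ _ (psum (fun k => cabs (f (s + k%:Z)) * w (s + k%:Z)) (L + M.+1))).
      apply: psum_le => k kL; rewrite /h kL ler_wpM2r ?(ltW (hw _)) //.
      exact: cpart_le.
    rewrite -lee_fin; apply: le_trans he.
    apply: (@psum_le_esum R (fun n => cabs (f n) * w n)) => n.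
    by rewrite mulr_ge0 ?normc_ge0 // ltW.
  move=> hs; have := le_trans hs (ler_wpM2l K0 e1).
  rewrite mulrC -ler_pdivlMr // => /(le_trans _) hs'.
  rewrite (_ : 4 * K / lam * e = K * e / (lam / 4)); last by field; rewrite gt_eqF.
  apply: hs'.
  apply: (@le_trans _ _ (psum (fun k => ind ((lam / 4) `^ q < vmax q M (avg h k)) * w (s + k%:Z)) L)).
    by apply: psum_le => k kL; rewrite vmax_window.
  by apply: psum_mono => [|k _]; [exact: leq_addr|rewrite mulr_ge0 ?ind_ge0 // ltW].
apply: (@le_trans _ _ (psum (fun k => psum (fun i => ind ((lam / 4) `^ q < V i k) * w (s + k%:Z)) 4) L)).
  apply: psum_le => k _.
  have t0 i : 0 <= ind ((lam / 4) `^ q < V i k) * w (s + k%:Z) by rewrite mulr_ge0 ?ind_ge0 // ltW.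
  have s0 : 0 <= psum (fun i => ind ((lam / 4) `^ q < V i k) * w (s + k%:Z)) 4 by apply: psum_ge0.
  case: (indP R (lam `^ q < vsum q f (s + k%:Z) M)) => -[hl ->]; last by rewrite mul0r.
  (* Pigeonhole over the four parts, as 4 (lam/4)^q <= lam^q for q >= 1. *)
  have [i i4 hi] : exists2 i, (i < 4)%N & (lam / 4) `^ q < V i k.
    apply: contrapT => hn; move: hl; apply/negP; rewrite -leNgt.
    apply: (@le_trans _ _ (psum (fun=> (lam / 4) `^ q) 4)).
      by apply: psum_le => i i4; rewrite leNgt; apply/negP => hi; apply: hn; exists i.
    rewrite psum_cst -(@mulr_powRB1 _ (lam / 4) q) ?(ltW l40) // mulrA.
    rewrite -(@mulr_powRB1 _ lam q) ?(ltW l0) // (_ : 4%:R * (lam / 4) = lam); last by field.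
    by rewrite ler_wpM2l ?(ltW l0) //; apply: ler_powR_base; lra.
  have := @psum_term R (fun i => ind ((lam / 4) `^ q < V i k) * w (s + k%:Z)) i 4 i4 (fun j _ => t0 j).
  by rewrite ind1.
rewrite psum_exch; apply: (@le_trans _ _ (psum (fun=> 4 * K / lam * e) 4)).
  by apply: psum_le => i _; exact: hV.
by rewrite psum_cst !mulrA -natrM.
Qed.

Lemma variation_op_le (R : realType) (q A : R) (f : int -> R[i]) n : 0 < q -> 0 <= A ->
  (forall M, 4 `^ q * vsum q f n M <= A `^ q) -> (variation_op q f n <= A%:E)%E.
Proof.
move=> q0 A0 h; apply: variation_norm_le => // N hN J.
by apply: le_trans (h (N J)); apply: variation_psum_le => // i j; rewrite -hN.
Qed.

Lemma variation_op_ge0 (R : realType) (q : R) (f : int -> R[i]) n : 0 < q ->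
  (0 <= variation_op q f n)%E.
Proof.
move=> q0; apply: le_trans (@variation_norm_ge R q (ergodic_avg f n) 0 1 q0 isT).
by rewrite lee_fin normc_ge0.
Qed.

(** The passage from bounded lengths to the full variation takes a supremum at each point instead of
    a limit theorem. Windows of one point show that it is finite. *)
Lemma variation_strong_sufficient (R : realType) (q p : R) (w : int -> R) :
  2 < q -> 1 < p -> weight w -> Applus p w ->
  exists C : R, forall f : int -> R[i], ellp p w f ->
    (\esum_(n in [set: int]) (variation_op q f n `^ p * (w n)%:E) <=
     C%:E * \esum_(n in [set: int]) (cabs (f n) `^ p * w n)%:E)%E.
Proof.
move=> q2 p1 hw hA; have [K K0 hK] := variation_strong_window q2 p1 hw hA.
have q0 : 0 < q by lra.
have p0 : 0 < p by lra.
exists (8 `^ p * K) => f; rewrite /ellp /=.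
set E := esum _ _ => Efin.
have E0 : (0 <= E)%E.
  by apply: esum_ge0 => n _; rewrite lee_fin mulr_ge0 ?powR_ge0 // ltW.
have eE : E = (fine E)%:E by rewrite fineK // ge0_fin_numE.
move: (fine E) eE => e eE; rewrite eE; move: (hK f) => {}hK.
have he : (E <= e%:E)%E by rewrite eE.
pose a n M := 4 * vsum q f n M `^ q^-1.
have a0 n M : 0 <= a n M by rewrite mulr_ge0 ?powR_ge0 ?ler0n.
have ap n M : a n M `^ p = 4 `^ p * vsum q f n M `^ (p / q).
  by rewrite powRM ?powR_ge0 ?ler0n // -powRrM (mulrC q^-1).
have amono n M M' : (M <= M')%N -> a n M <= a n M'.
  move=> MM; rewrite ler_wpM2l ?ler0n //; apply: ler_powR_base; rewrite ?invr_ge0 ?(ltW q0) ?vsum_ge0 //.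
  exact: vsum_mono.
pose S n := [set a n M | M in [set: nat]].
have hS n : has_sup (S n).
  split; first by exists (a n 0%N), 0%N.
  exists (((4 `^ p * (K * e)) / w n) `^ p^-1) => _ [M _ <-].
  have -> : a n M = (a n M `^ p) `^ p^-1 by rewrite -powRrM mulfV ?gt_eqF // powRr1.
  apply: ler_powR_base; rewrite ?invr_ge0 ?(ltW p0) ?powR_ge0 //.
  rewrite ler_pdivlMr // ap -mulrA ler_wpM2l ?powR_ge0 //.
  have := hK n 1%N M e he; rewrite psumS psum0 add0r.
  by rewrite (_ : n + 0%:Z = n) // addr0.
pose A n := sup (S n).
have aA n M : a n M <= A n by apply: sup_upper_bound => //; exists M.
have A0 n : 0 <= A n by exact: le_trans (a0 n 0%N) (aA n 0%N).
have adh n : exists M, A n <= 2 * a n M.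
  have := A0 n; rewrite le_eqVlt => /orP[/eqP <-|An]; first by exists 0%N; rewrite mulr_ge0 ?ler0n.
  have A2 : 0 < A n / 2 by rewrite divr_gt0.
  have [_ [M _ <-] h] := sup_adherent A2 (hS n).
  by exists M; move: h; rewrite -/(A n); move: (a n M) (A n) => x y; lra.
have vA n : (variation_op q f n <= (A n)%:E)%E.
  apply: variation_op_le => // M.
  apply: (@le_trans _ _ (a n M `^ q)); last first.
    by apply: ler_powR_base => //; exact: ltW.
  by rewrite powRM ?powR_ge0 ?ler0n // -powRrM mulVf ?gt_eqF // powRr1 // vsum_ge0.
apply: (@le_trans _ _ (\esum_(n in [set: int]) (A n `^ p * w n)%:E)%E).
  apply: le_esum => n _; rewrite EFinM lee_wpmul2r ?lee_fin ?(ltW (hw n)) //.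
  rewrite -poweR_EFin; apply: gt0_ler_poweR; rewrite ?in_itv /= ?variation_op_ge0 ?leey ?lee_fin ?A0 //.
  exact: ltW.
apply: esum_le_psum => [n|s L]; first by rewrite mulr_ge0 ?powR_ge0 // ltW.
(* The truncated variations increase with M, so one M is within a factor 2 of the supremum at all
   points of the window. With the factor 4 of [a] this gives 8^p. *)
have [M hM] : exists M, forall k, (k < L)%N -> A (s + k%:Z) <= 2 * a (s + k%:Z) M.
  elim: L => [|L [M hM]]; first by exists 0%N.
  have [M' hM'] := adh (s + L%:Z); exists (maxn M M') => k.
  rewrite ltnS leq_eqVlt => /orP[/eqP ->|/hM h]; [apply: le_trans hM' _|apply: le_trans h _];
    by rewrite ler_wpM2l ?ler0n // amono ?leq_maxl ?leq_maxr.
apply: (@le_trans _ _ (psum (fun k => 8 `^ p * (vsum q f (s + k%:Z) M `^ (p / q) * w (s + k%:Z))) L)).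
  apply: psum_le => k kL; rewrite mulrA ler_wpM2r ?(ltW (hw _)) //.
  apply: (@le_trans _ _ ((2 * a (s + k%:Z) M) `^ p)).
    by apply: ler_powR_base; rewrite ?(ltW p0) ?A0 ?hM.
  rewrite powRM ?ler0n // ap mulrA -powRM ?ler0n // (_ : 2 * 4 = 8 :> R) //.
  by rewrite -natrM.
by rewrite psumZ -mulrA ler_wpM2l ?powR_ge0 // hK.
Qed.

Lemma variation_weak_sufficient (R : realType) (q : R) (w : int -> R) :
  2 < q -> weight w -> A1plus w ->
  exists C : R, forall (f : int -> R[i]) (lambda : R), ellp 1 w f -> 0 < lambda ->
    (weight_measure w [set n | lambda%:E < variation_op q f n] <=
     (C / lambda)%:E * \esum_(n in [set: int]) (cabs (f n) * w n)%:E)%E.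
Proof.
move=> q2 hw hA; have [K K0 hK] := variation_weak_window q2 hw hA.
have q0 : 0 < q by lra.
exists (4 * K) => f lam; rewrite /ellp /=.
under eq_esum do rewrite powRr1 ?normc_ge0 //.
set E := esum _ _ => Efin l0.
have E0 : (0 <= E)%E.
  by apply: esum_ge0 => n _; rewrite lee_fin mulr_ge0 ?normc_ge0 // ltW.
have eE : E = (fine E)%:E by rewrite fineK // ge0_fin_numE.
move: (fine E) eE => e eE; rewrite eE; move: (hK f) => {}hK.
have he : (E <= e%:E)%E by rewrite eE.
have l40 : 0 < lam / 4 by rewrite divr_gt0.
have adh n : (lam%:E < variation_op q f n)%E -> exists M, (lam / 4) `^ q < vsum q f n M.
  move=> h; apply: contrapT => hn; move: h; apply/negP; rewrite -leNgt.
  apply: variation_op_le => //; first exact: ltW.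
  move=> M; have -> : lam `^ q = 4 `^ q * (lam / 4) `^ q.
    by rewrite -powRM ?ler0n ?(ltW l40) // mulrC divfK.
  rewrite ler_wpM2l ?powR_ge0 // leNgt; apply/negP => h; by apply: hn; exists M.
have {1}-> : weight_measure w [set n | (lam%:E < variation_op q f n)%E] =
    (\esum_(n in [set: int]) (ind (lam%:E < variation_op q f n)%E * w n)%:E)%E.
  rewrite /weight_measure esum_mkcond; apply: eq_esum => n _.
  case: ifP => [/set_mem h|h]; first by rewrite ind1 // mul1r.
  by rewrite ind0 ?mul0r // => h'; move/negP: h; apply; apply/mem_set.
rewrite -EFinM.
apply: esum_le_psum => [n|s L]; first by rewrite mulr_ge0 ?ind_ge0 // ltW.
have [M hM] : exists M, forall k, (k < L)%N -> (lam%:E < variation_op q f (s + k%:Z))%E ->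
    (lam / 4) `^ q < vsum q f (s + k%:Z) M.
  elim: L => [|L [M hM]]; first by exists 0%N.
  have [h|h] := pselect (lam%:E < variation_op q f (s + L%:Z))%E; last first.
    by exists M => k; rewrite ltnS leq_eqVlt => /orP[/eqP -> //|/hM].
  have [M' hM'] := adh _ h; exists (maxn M M') => k.
  rewrite ltnS leq_eqVlt => /orP[/eqP -> _|kL hk].
    by apply: lt_le_trans hM' _; apply: vsum_mono => //; exact: leq_maxr.
  by apply: lt_le_trans (hM k kL hk) _; apply: vsum_mono => //; exact: leq_maxl.
apply: (@le_trans _ _ (psum (fun k => ind ((lam / 4) `^ q < vsum q f (s + k%:Z) M) * w (s + k%:Z)) L)).
  by apply: psum_le => k kL; rewrite ler_wpM2r ?(ltW (hw _)) //; apply: ind_imp; exact: hM.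
rewrite (_ : 4 * K / lam * e = K / (lam / 4) * e); last by field; rewrite gt_eqF.
exact: hK.
Qed.

(** * Necessity *)

Lemma ergodic_avg_real (R : realType) (g : int -> R) n N :
  ergodic_avg (fun m => real_complex R (g m)) n N =
  real_complex R (psum (fun t => g (n + t%:Z)) N.+1 / N.+1%:R).
Proof.
by rewrite /ergodic_avg big_mkord /psum rmorphM rmorph_sum /= fmorphV rmorph_nat.
Qed.

Lemma normc_real (R : realType) (x : R) : 0 <= x -> cabs (real_complex R x) = x.
Proof. by move=> x0; rewrite /= expr0n addr0 sqrtr_sqr ger0_norm. Qed.

Lemma esum_supp (R : realType) (g : int -> R) (n : int) L : (forall i, 0 <= g i) ->
  (forall m : int, ~ (n <= m < n + L%:Z) -> g m = 0) ->
  (\esum_(m in [set: int]) (g m)%:E = (psum (fun t => g (n + t%:Z)%R) L)%:E)%E.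
Proof.
move=> g0 gn; rewrite -esum_window // [RHS]esum_mkcond; apply: eq_esum => m _.
case: ifPn => // /negP hm; rewrite gn // => hn; apply: hm; apply/mem_set.
by exists (absz (m - n)) => /=; lia.
Qed.

(* At a point of [n, n+k] the averages of lengths 2k+1 and 4k+2 both contain
   the whole support of g, so they differ by a factor 2. *)
Lemma variation_op_ge (R : realType) (q : R) (g : int -> R) (n : int) (k i : nat) : 0 < q ->
  (forall m, 0 <= g m) -> (forall m : int, ~ (n + k%:Z <= m < n + (2 * k).+1%:Z) -> g m = 0) ->
  (i <= k)%N ->
  ((psum (fun t => g (n + t%:Z)%R) (2 * k).+1 / (4 * k).+2%:R)%:E <=
   variation_op q (fun m => real_complex R (g m)) (n + i%:Z)%R)%E.
Proof.
move=> q0 g0 gn ik; set s := psum _ _.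
have s0 : 0 <= s by apply: psum_ge0.
have hs N : (2 * k <= N)%N -> psum (fun t => g (n + i%:Z + t%:Z)) N.+1 = s.
  move=> kN; rewrite (@psum_eq _ _ (fun t => g (n + (t + i)%N%:Z))); last first.
    by move=> t _; congr g; lia.
  rewrite (psum_shift (fun t => g (n + t%:Z))).
  rewrite (@psum_supp _ (fun t => g (n + t%:Z)) (2 * k).+1) -/s; last by lia.
    rewrite (@psum_eq _ _ (fun=> 0)); first by rewrite psum_cst mulr0 subr0.
    by move=> t ti; rewrite gn //; lia.
  by move=> t kt; rewrite gn //; lia.
have kk : (2 * k < (4 * k).+1)%N by lia.
have := @variation_norm_ge R q (ergodic_avg (fun m => real_complex R (g m)) (n + i%:Z)) _ _ q0 kk.
apply: le_trans; rewrite lee_fin !ergodic_avg_real !hs; [|lia|lia].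
rewrite -rmorphB.
(* The second length is exactly twice the first. *)
have d : s / (2 * k).+1%:R - s / (4 * k).+2%:R = s / (4 * k).+2%:R.
  have -> : (4 * k).+2%:R = 2 * (2 * k).+1%:R :> R by rewrite -natrM; congr _%:R; lia.
  have : (2 * k).+1%:R != 0 :> R by rewrite pnatr_eq0.
  by move: (_%:R) => y y0; field.
by rewrite d normc_real // divr_ge0 ?ler0n.
Qed.

(** Testing on the dual weight makes the norm of f and the mass of f the same number s, so the
    inequality reads (s/D)^p W <= C s with D = 4k + 2 <= 4 (k + 1). Dividing by s gives the
    condition with 4^p. *)
Lemma variation_strong_necessary (R : realType) (q p : R) (w : int -> R) :
  0 < q -> 1 < p -> weight w ->
  (exists C : R, forall f : int -> R[i], ellp p w f ->
    (\esum_(n in [set: int]) (variation_op q f n `^ p * (w n)%:E) <=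
     C%:E * \esum_(n in [set: int]) (cabs (f n) `^ p * w n)%:E)%E) ->
  Applus p w.
Proof.
move=> q0 p1 hw [C hC]; exists (`|C| * 4 `^ p) => n k.
have p0 : 0 < p by lra.
pose sg m := w m `^ (- (1 / (p - 1))).
have sg0 m : 0 < sg m by exact: powR_gt0.
pose g m : R := if (n + k%:Z <= m < n + (2 * k).+1%:Z) then sg m else 0.
have g0 m : 0 <= g m by rewrite /g; case: ifP => // _; exact: ltW.
have gn (m : int) : ~ (n + k%:Z <= m < n + (2 * k).+1%:Z) -> g m = 0.
  by move=> /negP; rewrite /g => /negbTE ->.
pose f m := real_complex R (g m).
(* The exponents agree: -p/(p-1) + 1 = -1/(p-1). *)
have gp m : cabs (f m) `^ p * w m = g m.
  rewrite normc_real // /g; case: ifP => _; last by rewrite powR0 ?gt_eqF // mul0r.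
  rewrite /sg -{2}(powRr1 (ltW (hw m))).
  rewrite -powRrM -powRD; last by apply/implyP => _; rewrite gt_eqF.
  by congr (_ `^ _); field; lra.
pose s := psum (fun t => g (n + t%:Z)) (2 * k).+1.
have eE : (\esum_(m in [set: int]) (cabs (f m) `^ p * w m)%:E = s%:E)%E.
  under eq_esum do rewrite gp.
  by apply: esum_supp => // m hm; apply: gn => h; apply: hm; lia.
have hf : ellp p w f by rewrite /ellp /= eE ltry.
have sE : \sum_(k <= i < (2 * k).+1) w (n + i%:Z) `^ (- (1 / (p - 1))) = s.
  rewrite (@eq_big_nat _ _ _ _ _ _ (fun i => g (n + i%:Z))); last first.
    by move=> i ki; rewrite /g ifT //; lia.
  rewrite sum_psum; last by lia.
  rewrite (@psum_eq _ _ (fun=> 0) k); first by rewrite psum_cst mulr0 subr0.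
  by move=> t tk; rewrite gn //; lia.
have s0 : 0 < s.
  rewrite -sE; apply: (@lt_le_trans _ _ (sg (n + k%:Z))) => //.
  rewrite big_ltn; last by lia.
  by rewrite lerDl; apply: sumr_ge0 => i _; exact: powR_ge0.
rewrite sE big_mkord -/(psum (fun i => w (n + i%:Z)) k.+1).
pose D : R := (4 * k).+2%:R.
have D0 : 0 < D by rewrite ltr0n.
have main : psum (fun i => (s / D) `^ p * w (n + i%:Z)) k.+1 <= C * s.
  rewrite -lee_fin EFinM -eE; apply: le_trans (hC f hf).
  rewrite -(@esum_window R (fun m => (s / D) `^ p * w m)); last first.
    by move=> m; rewrite mulr_ge0 ?powR_ge0 // ltW.
  rewrite esum_mkcond; apply: le_esum => m _.
  have v0 := @variation_op_ge0 R q f m q0.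
  case: ifPn => [/set_mem[i /= ik <-]|_]; last by rewrite mule_ge0 ?poweR_ge0 // lee_fin ltW.
  rewrite EFinM lee_wpmul2r ?lee_fin ?(ltW (hw _)) // -poweR_EFin.
  have sD : 0 <= s / D by rewrite divr_ge0 ?(ltW s0) ?(ltW D0).
  apply: gt0_ler_poweR; first exact: ltW.
  - by rewrite in_itv /= lee_fin sD leey.
  - by rewrite in_itv /= leey andbT; exact: variation_op_ge0.
  - by apply: variation_op_ge.
have sp : s `^ p = s * s `^ (p - 1) by rewrite mulr_powRB1 // ltW.
move: main; rewrite psumZ powRM ?invr_ge0 ?(ltW s0) ?(ltW D0) // sp.
set W := psum _ _ => main.
have DV : D^-1 `^ p = (D `^ p)^-1.
  by apply: (mulfI (x := D `^ p)); rewrite ?gt_eqF ?powR_gt0 // -powRM ?invr_ge0 ?(ltW D0) // !mulfV ?gt_eqF ?powR_gt0 // powR1.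
have h1 : W * s `^ (p - 1) <= C * D `^ p.
  rewrite -(ler_pM2l s0) (_ : s * (C * D `^ p) = C * s * D `^ p); last by ring.
  rewrite -ler_pdivrMr ?powR_gt0 //; apply: le_trans main.
  by rewrite DV le_eqVlt; apply/orP; left; apply/eqP; ring.
apply: le_trans h1 _.
apply: (@le_trans _ _ (`|C| * D `^ p)); first by rewrite ler_wpM2r ?powR_ge0 // ler_norm.
rewrite -mulrA ler_wpM2l // -powRM ?ler0n //; apply: ler_powR_base; rewrite ?(ltW p0) ?(ltW D0) //.
by rewrite -natrM ler_nat; lia.
Qed.

(** The minimum over [n, n + k] is reached by testing each of its points separately with a unit
    mass. The lower bound for the variation is used from the base point n - k, so that it holds on
    [n - k, n]. *)
Lemma variation_weak_necessary (R : realType) (q : R) (w : int -> R) : 0 < q -> weight w ->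
  (exists C : R, forall (f : int -> R[i]) (lambda : R), ellp 1 w f -> 0 < lambda ->
    (weight_measure w [set n | lambda%:E < variation_op q f n] <=
     (C / lambda)%:E * \esum_(n in [set: int]) (cabs (f n) * w n)%:E)%E) ->
  A1plus w.
Proof.
move=> q0 hw [C hC]; exists (8 * `|C|) => n k.
suff hm t : (t <= k)%N ->
    \sum_(0 <= i < k.+1) w (n - k%:Z + i%:Z) <= 8 * `|C| * k.+1%:R * w (n + t%:Z).
  move: hm; set T := \sum_(0 <= i < k.+1) w (_ + _) => hm.
  rewrite big_mkord; elim/big_ind: _ => [|x y hx hy|i _]; last by apply: hm; rewrite -ltnS.
    by have := hm 0%N isT; rewrite addr0.
  by rewrite /Num.min; case: ifP.
move=> tk; pose m0 := n + t%:Z.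
pose g m : R := if m == m0 then 1 else 0.
have g0 m : 0 <= g m by rewrite /g; case: ifP.
have gn (m : int) : ~ (n - k%:Z + k%:Z <= m < n - k%:Z + (2 * k).+1%:Z) -> g m = 0.
  by move=> h; rewrite /g; case: eqP => // e; exfalso; apply: h; rewrite e /m0; lia.
pose f m := real_complex R (g m).
have fE m : cabs (f m) * w m = g m * w m by rewrite normc_real.
have eE : (\esum_(m in [set: int]) (cabs (f m) * w m)%:E = (w m0)%:E)%E.
  under eq_esum do rewrite fE.
  rewrite (@esum_supp _ (fun m => g m * w m) m0 1) => [|m|m hm].
  - by rewrite psumS psum0 add0r addr0 /g eqxx mul1r.
  - by rewrite mulr_ge0 // ltW.
  - by rewrite /g; case: eqP => [e|_]; [exfalso; apply: hm; lia|rewrite mul0r].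
have hf : ellp 1 w f.
  rewrite /ellp /=; under eq_esum do rewrite powRr1 ?normc_ge0 //.
  by rewrite eE ltry.
pose D : R := (4 * k).+2%:R.
have D0 : 0 < D by rewrite ltr0n.
have s1 : psum (fun t => g (n - k%:Z + t%:Z)) (2 * k).+1 = 1.
  have := @esum_supp R g (n - k%:Z) (2 * k).+1 g0.
  rewrite (@esum_supp _ g m0 1) => [|//|m hm].
    rewrite psumS psum0 add0r addr0 (_ : g m0 = 1) => [h|]; last by rewrite /g eqxx.
    by apply/esym/EFin_inj/h => m hm; apply: gn => h'; apply: hm; lia.
  by rewrite /g; case: eqP => [e|//]; exfalso; apply: hm; lia.
(* The variation is at least 1/D and the level set is strict, so half of 1/D is taken as level; 2D =
   8k + 4 <= 8 (k + 1) gives the factor 8. *)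
have l0 : 0 < (2 * D)^-1 by rewrite invr_gt0 mulr_gt0.
have main : psum (fun i => w (n - k%:Z + i%:Z)) k.+1 <= C / (2 * D)^-1 * w m0.
  rewrite -lee_fin EFinM -eE; apply: le_trans (hC f _ hf l0).
  rewrite -(@esum_window R w) => [|m]; last exact: ltW.
  rewrite /weight_measure esum_mkcond [leRHS]esum_mkcond; apply: le_esum => m _.
  case: ifPn => [/set_mem[i /= ik <-]|_]; last by case: ifP => _ //; rewrite lee_fin ltW.
  rewrite ifT //; apply/mem_set => /=.
  apply: lt_le_trans (@variation_op_ge R q g (n - k%:Z) k i q0 g0 gn ik).
  by rewrite s1 lte_fin mul1r ltf_pV2 ?posrE ?mulr_gt0 // -/D; lra.
rewrite big_mkord; apply: le_trans main _; rewrite ler_wpM2r ?(ltW (hw _)) // invrK.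
apply: (@le_trans _ _ (`|C| * (2 * D))).
  by rewrite ler_wpM2r ?mulr_ge0 ?(ltW D0) // ler_norm.
rewrite [8 * _]mulrC -mulrA ler_wpM2l // /D -!natrM ler_nat; lia.
Qed.

Theorem theorem2p1 (R : realType) (q : R) (hq : 2 < q)
    (w : int -> R) (hw : weight w) :
  (forall p : R, 1 < p ->
     (exists C : R, forall f : int -> R[i], ellp p w f ->
        (\esum_(n in [set: int]) (variation_op q f n `^ p * (w n)%:E) <=
         C%:E * \esum_(n in [set: int]) (cabs (f n) `^ p * w n)%:E)%E)
     <-> Applus p w)
  /\
  ((exists C : R, forall (f : int -> R[i]) (lambda : R), ellp 1 w f ->
      0 < lambda ->
      (weight_measure w [set n | lambda%:E < variation_op q f n] <=
       (C / lambda)%:E * \esum_(n in [set: int]) (cabs (f n) * w n)%:E)%E)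
   <-> A1plus w).
Proof.
have q0 : 0 < q by lra.
split=> [p p1|]; split=> h.
- exact: variation_strong_necessary h.
- exact: variation_strong_sufficient.
- exact: variation_weak_necessary h.
- exact: variation_weak_sufficient.
Qed.
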